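(* Let $\gamma\in(0,\infty)$, $r>0$, $\sigma>0$, and for $\lambda>0$ let $m(-\lambda)$, $m'(-\lambda)$ be the values at $z=-\lambda$ of $m(z)=\frac{1-\gamma-z-\sqrt{(1-\gamma-z)^2-4\gamma z}}{2\gamma z}$ and its derivative. (A) (Well-specified isotropic model.) For each $n$ let $p=p(n)$ and let $(x_i,y_i)$, $i\le n$, be i.i.d. with $y_i=x_i^T\beta+\epsilon_i$, $\epsilon_i$ independent of $x_i$ with mean $0$ and variance $\sigma^2$, $x_i\in\mathbb{R}^p$ with i.i.d. entries of zero mean, unit variance and finite moment of order $4+\eta$ for some $\eta>0$, and $\beta$ deterministic with $\|\beta\|_2^2=r^2$ for all $n,p$. Then for every $\lambda>0$, as $n,p\to\infty$ with $p/n\to\gamma$, almost surely $$R_X(\hat\beta_\lambda;\beta)\to r^2\lambda^2m'(-\lambda)+\sigma^2\gamma\left(m(-\lambda)-\lambda m'(-\lambda)\right).$$ Furthermore, the limiting risk is minimized over $\lambda$ at $\lambda^*=\sigma^2\gamma/r^2$, and for $\lambda=\lambda^*$ the limit equals $\sigma^2\gamma\,m(-\lambda^* )$. (B) (Misspecified isotropic model.) Let $\kappa\in(0,1]$. For each $n$ let $p=p(n)$, $q=q(n)$, and let $((x_i,w_i),y_i)$, $i\le n$, be i.i.d. with $y_i=x_i^T\beta+w_i^T\theta+\epsilon_i$, $\epsilon_i$ independent of $(x_i,w_i)$ with mean $0$ and variance $\sigma^2$, $(x_i,w_i)\in\mathbb{R}^{p+q}$ with i.i.d. entries of zero mean, unit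 variance and finite moment of order $8+\eta$ for some $\eta>0$, and $\beta,\theta$ deterministic with $\|\beta\|_2^2+\|\theta\|_2^2=r^2$, $\|\beta\|_2^2/r^2=\kappa$ for all $n,p$. Put $\tilde r^2=r^2\kappa$ and $\tilde\sigma^2=\sigma^2+r^2(1-\kappa)$. Then for every $\lambda>0$, as $n,p\to\infty$ with $p/n\to\gamma$, almost surely $$R_X(\hat\beta_\lambda;\beta,\theta)\to r^2(1-\kappa)+\tilde r^2\lambda^2m'(-\lambda)+\tilde\sigma^2\gamma\left(m(-\lambda)-\lambda m'(-\lambda)\right),$$ this limit is minimized at $\tilde\lambda^*=\tilde\sigma^2\gamma/\tilde r^2$, and its minimal value is $r^2(1-\kappa)+\tilde\sigma^2\gamma\,m(-\tilde\lambda^* )$.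
   Context: $X\in\mathbb{R}^{n\times p}$ has rows $x_i^T$; $\hat\beta_\lambda=(X^TX+n\lambda I)^{-1}X^Ty$ is the ridge estimator of $y$ on $X$ (the $w_i$ are unobserved in (B)). In (A), $R_X(\hat\beta;\beta)=\mathbb{E}[(x_0^T\hat\beta-x_0^T\beta)^2\mid X]$ with $x_0$ an independent copy of $x_1$. In (B), $R_X(\hat\beta;\beta,\theta)=\mathbb{E}[(x_0^T\hat\beta-x_0^T\beta-w_0^T\theta)^2\mid X]$ with $(x_0,w_0)$ an independent copy of $(x_1,w_1)$. Convention: the laws of the entries do not depend on $n,p$, and the problems for all $n$ are defined on a common probability space. *)

(* Defs.v *)
From HB Require Import structures.
From mathcomp Require Import all_boot all_order all_algebra.
From mathcomp Require Import all_classical all_reals all_analysis.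

Set Implicit Arguments.
Unset Strict Implicit.
Unset Printing Implicit Defensive.

Import Order.TTheory GRing.Theory Num.Theory.
Import numFieldNormedType.Exports.

Local Open Scope classical_set_scope.
Local Open Scope ring_scope.

Section Probability.
Context {d : measure_display} {T : measurableType d} {R : realType}.
Variable P : probability T R.

Definition same_law {dE} {E : measurableType dE} (f g : T -> E) : Prop :=
  forall A : set E, measurable A -> P (f @^-1` A) = P (g @^-1` A).

Definition independent {dE dF} {E : measurableType dE} {F : measurableType dF}
    (f : T -> E) (g : T -> F) : Prop :=
  forall (A : set E) (B : set F), measurable A -> measurable B ->
    P (f @^-1` A `&` g @^-1` B) = (P (f @^-1` A) * P (g @^-1` B))%E.

Definition mutually_independent {dE} {E : measurableType dE} {I : finType}
    (f : I -> T -> E) : Prop :=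
  forall (J : {set I}) (A : I -> set E), (forall i, measurable (A i)) ->
    P (\bigcap_(i in [set` J]) (f i @^-1` A i))
    = (\prod_(i in J) P (f i @^-1` A i))%E.

(* [Z] is a version of the conditional expectation E[Y | X], that is, of
   E[Y | G] for the sigma-algebra G generated by [X]. *)
Record cond_expectation {dE} {E : measurableType dE} (X : T -> E)
    (Y Z : T -> R) : Prop := CondExpectation {
  cond_expectation_measurable : forall B : set R, measurable B ->
    preimage_set_system setT X measurable (Z @^-1` B);
  cond_expectation_integrable : P.-integrable setT (EFin \o Z);
  cond_expectation_integral : forall A : set T,
    preimage_set_system setT X measurable A ->
    (\int[P]_(w in A) (Z w)%:E = \int[P]_(w in A) (Y w)%:E)%E
}.

(* A sample [(z i, y i)], i < n, with covariates in R^k, noise [eps] and test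
   covariate [z0].  The law [mu] of the covariate entries is a parameter of the
   model so that it can be shared by models of different sizes; the law of the
   noise is constrained by its first two moments only.
   [z0] is an independent copy of the covariates: it has their law and is
   independent of the whole training sample. *)
Record iid_sample (n k : nat) (mu : probability R R) (sigma : R)
    (z : 'I_n -> T -> k.-tuple R) (eps y : 'I_n -> T -> R)
    (z0 : T -> k.-tuple R) : Prop := IidSample {
  sample_independent : mutually_independent (fun i w => (z i w, y i w));
  sample_same_law : forall i i',
    same_law (fun w => (z i w, y i w)) (fun w => (z i' w, y i' w));
  entries_independent : forall i,
    mutually_independent (fun j w => tnth (z i w) j);
  entries_law : forall i j (A : set R), measurable A ->
    P ((fun w => tnth (z i w) j) @^-1` A) = mu A;
  noise_independent : forall i, independent (eps i) (z i);
  noise_mean : forall i, ('E_P[eps i] = 0)%E;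
  noise_variance : forall i, ('V_P[eps i] = (sigma ^+ 2)%:E)%E;
  test_independent : independent z0 (fun w => [tuple (z i w, y i w) | i < n]);
  test_same_law : forall i, same_law z0 (z i)
}.

End Probability.

Section Entries.
Context {R : realType}.

Definition standardized_law (mu : probability R R) : Prop :=
  ('E_mu[fun u : R => u] = 0)%E /\ ('V_mu[fun u : R => u] = 1)%E.

Definition finite_moment_above (mu : probability R R) (s : R) : Prop :=
  exists2 eta : R, 0 < eta & ('E_mu[fun u : R => (`|u| `^ (s + eta))%R] < +oo)%E.

End Entries.

Section Ridge.
Context {R : realType}.

Definition dotp {k} (u : k.-tuple R) (b : 'cV[R]_k) : R :=
  \sum_(j < k) tnth u j * b j 0.

(* The squared Euclidean norm; the norm that the library puts on matrices is
   the sup norm. *)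
Definition sqnorm2 {k} (b : 'cV[R]_k) : R := \sum_(j < k) b j 0 ^+ 2.

Definition design {n p} (x : 'I_n -> p.-tuple R) : 'M[R]_(n, p) :=
  \matrix_(i, j) tnth (x i) j.

Definition ridge {n p} (lambda : R) (X : 'M[R]_(n, p)) (y : 'cV[R]_n) :
    'cV[R]_p :=
  invmx (X^T *m X + (n%:R * lambda)%:M) *m X^T *m y.

Definition ridge_fit {n p} (lambda : R) (x : 'I_n -> p.-tuple R)
    (y : 'I_n -> R) : 'cV[R]_p :=
  ridge lambda (design x) (\col_i y i).

(* Used at negative [z] only, where the radicand is positive. *)
Definition mp_stieltjes (gamma z : R) : R :=
  (1 - gamma - z - Num.sqrt ((1 - gamma - z) ^+ 2 - 4 * gamma * z))
  / (2 * gamma * z).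

(* Here [r2] is the squared signal norm and [s2] the noise variance. *)
Definition ridge_limit_risk (gamma r2 s2 lambda : R) : R :=
  r2 * lambda ^+ 2 * derive1 (mp_stieltjes gamma) (- lambda)
  + s2 * gamma * (mp_stieltjes gamma (- lambda)
                  - lambda * derive1 (mp_stieltjes gamma) (- lambda)).

Definition minimized_over_pos_at (f : R -> R) (x : R) : Prop :=
  0 < x /\ forall lambda, 0 < lambda -> f x <= f lambda.

End Ridge.

(* Main.v *)
(** Conditionally on the covariates the ridge error is a bias plus a linear image
    of the residual noise, so the risk is [lam^2 |G b|^2 + s2 (T - lam T2)] with
    [G = (X^T X / n + lam)^-1], [T = tr G / n] and [T2 = tr G^2 / n]; in the
    misspecified model [w_i^T theta] is part of the noise and of the test error.
    It remains to find the almost sure limits of [b^T G b] and [T], the squared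
    resolvents being reached from these by monotone difference quotients in [lam].
    Sherman-Morrison makes both quantities functions of independent rows with small
    oscillations; truncated sixth moments [s^3 / (L + s)] of the row projections,
    controlled by a moment of order [4 + eta], give summable fourth central moments,
    hence concentration by Borel-Cantelli.  Leaving one row out gives, up
    to vanishing errors, [lam h + h / (1 + g) = 1] for the means [h] of [b^T G b] and
    [g] of [T]; averaging over coordinates [b] makes this a quadratic equation for
    [g], solved by [gamma m] with [m] the Marchenko-Pastur transform, so no spectral
    distribution is needed.  The optimal [lam] is read
    off from the algebraic formula for [m'] given by the same quadratic equation. *)
Require Import Defs.
From HB Require Import structures.
From mathcomp Require Import all_boot all_order all_algebra.
From mathcomp Require Import all_classical all_reals all_analysis.
From mathcomp Require Import measurable_realfun ring lra.

Set Implicit Arguments.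
Unset Strict Implicit.
Unset Printing Implicit Defensive.

Import Order.TTheory GRing.Theory Num.Theory.
Import numFieldNormedType.Exports.

Local Open Scope classical_set_scope.
Local Open Scope ring_scope.

(** * Product laws and independence *)

(** The obstacle is the weak moment assumption. Deleting a row [x] changes [b^T G b] by some
    [D <= Z = (x.c)^2 / n], with [c] the leave-one-out resolvent applied to [b], and the
    fourth-moment Efron-Stein bound contains [n E D^4]. Eighth moments would make this [n^-3];
    fourth moments with [D <= 1/lam] only give [n E Z^2], of order [1/n], which is not summable.
    Both bounds on [D] together give [D^4 <= C Z^3 / (1 + Z)], a sixth moment truncated at level
    [n], and a moment slightly above four makes its mean [O(n^(-2-del))]. This smallness, known for
    single entries, has to pass to [x.c] without loss in the dimension; a second-order expansion of
    the truncation achieves it one coordinate at a time.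

    The averaged equation needs no rate: Young's inequality with a free weight [t] leaves an error
    [O(t) + O(1/(t n))], and [t] is fixed before [n] grows. Approximate solutions are close to the
    exact one because [x -> lam x + x / (1 + x)] expands distances on [x >= 0] by at least [lam]. *)

Section PiSystems.
Context {R : realType}.

Lemma prob_unique d (T : measurableType d) (G : set (set T))
    (m1 m2 : {measure set T -> \bar R}) :
  measurable = <<s G >> -> setI_closed G -> G setT -> (m1 setT < +oo)%E ->
  (forall A, G A -> m1 A = m2 A) -> forall A, measurable A -> m1 A = m2 A.
Proof.
move=> mG GI GT m1T m12 A mA.
apply: (measure_unique G (fun=> setT)) => //.
by apply/seteqP; split=> // x _; exists 0%N.
Qed.

Definition box {E : Type} n (A : 'I_n -> set E) : set (n.-tuple E) :=
  [set s | forall i, A i (tnth s i)].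

Lemma boxE {E : Type} n (A : 'I_n -> set E) :
  box A = \big[setI/setT]_(i < n) ((fun s => tnth s i) @^-1` A i).
Proof.
apply/seteqP; split=> s /=.
  by move=> sA; elim/big_ind: _ => // i _; exact: sA.
by rewrite -bigcap_seq => sA i; apply: sA => /=; rewrite mem_index_enum.
Qed.

Lemma measurable_box d (E : measurableType d) n (A : 'I_n -> set E) :
  (forall i, measurable (A i)) -> measurable (box A).
Proof.
move=> mA; rewrite boxE; apply: bigsetI_measurable => i _.
by rewrite -[X in measurable X]setTI; exact: measurable_tnth.
Qed.

Definition boxes d (E : measurableType d) n : set (set (n.-tuple E)) :=
  [set box A | A in [set A : 'I_n -> set E | forall i, measurable (A i)]].

Arguments boxes {d} E n.

(** The sigma-algebra of tuples is defined from preimages under single coordinates. Boxes generate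
    the same one and are in addition stable under intersection, which uniqueness of measures
    requires. *)
Lemma measurable_boxesE d (E : measurableType d) n :
  measurable = <<s boxes E n >>.
Proof.
apply/seteqP; split.
  apply: smallest_sub; first exact: smallest_sigma_algebra.
  rewrite -bigcup_seq => B [i _ [A mA <-]].
  rewrite setTI; apply: sub_sigma_algebra.
  exists (fun j => if j == i then A else setT) => /=.
    by move=> j; case: ifP.
  apply/seteqP; split => s /=; first by move=> /(_ i); rewrite eqxx.
  by move=> sA j; case: eqP => [->|].
apply: smallest_sub; first exact: sigma_algebra_measurable.
by move=> _ [A mA <-]; exact: measurable_box.
Qed.

Lemma boxes_setI d (E : measurableType d) n : setI_closed (boxes E n).
Proof.
move=> _ _ [A mA <-] [B mB <-]; exists (fun i => A i `&` B i).
  by move=> i; exact: measurableI.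
by apply/seteqP; split=> s /= sAB; [split=> i; have [] := sAB i|move=> i; split; apply sAB].
Qed.

Lemma boxes_setT d (E : measurableType d) n : boxes E n setT.
Proof. by exists (fun=> setT) => //; apply/seteqP; split. Qed.

Lemma rectangles_setI d1 d2 (E : measurableType d1) (F : measurableType d2) :
  setI_closed [set A `*` B | A in @measurable d1 E & B in @measurable d2 F].
Proof.
move=> _ _ [A mA [B mB <-]] [A' mA' [B' mB' <-]].
rewrite -setXI; exists (A `&` A'); first exact: measurableI.
by exists (B `&` B') => //; exact: measurableI.
Qed.

End PiSystems.

Definition image_measure {R : realType} d1 d2 (T1 : measurableType d1)
  (T2 : measurableType d2) (m : {measure set T1 -> \bar R}) (f : T1 -> T2)
  (mf : measurable_fun setT f) : {measure set T2 -> \bar R}.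
Proof. by unshelve refine (pushforward m f : {measure set T2 -> \bar R}). Defined.

Section Independence.
Context {d : measure_display} {T : measurableType d} {R : realType}.
Variable P : probability T R.

Lemma independent_comp dE dF dE' dF' (E : measurableType dE)
    (F : measurableType dF) (E' : measurableType dE') (F' : measurableType dF')
    (f : T -> E) (g : T -> F) (u : E -> E') (v : F -> F') :
  measurable_fun setT u -> measurable_fun setT v ->
  independent P f g -> independent P (u \o f) (v \o g).
Proof.
move=> mu mv fg A B mA mB; apply: (fg (u @^-1` A) (v @^-1` B)).
- by rewrite -[X in measurable X]setTI; exact: mu.
- by rewrite -[X in measurable X]setTI; exact: mv.
Qed.

(** For fixed [B] both sides are finite measures in [A]: the restriction of [P] to the event of [B],
    pushed forward by [f], and the law of [f] scaled by a constant. They agree on the pi-system [G],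
    hence everywhere. *)
Lemma independent_pi_l dE dF (E : measurableType dE) (F : measurableType dF)
    (f : T -> E) (g : T -> F) (G : set (set E)) :
  measurable_fun setT f -> measurable_fun setT g ->
  measurable = <<s G >> -> setI_closed G -> G setT ->
  (forall A B, G A -> measurable B ->
    P (f @^-1` A `&` g @^-1` B) = (P (f @^-1` A) * P (g @^-1` B))%E) ->
  independent P f g.
Proof.
move=> mf mg mG GI GT GP A B mA mB.
have mgB : measurable (g @^-1` B).
  by rewrite -[X in measurable X]setTI; exact: mg.
pose F0 : {mfun T >-> E} := HB.pack f (isMeasurableFun.Build _ _ _ _ f mf).
have PgB : P (g @^-1` B) \is a fin_num by exact: fin_num_measure.
have PgB0 : 0 <= fine (P (g @^-1` B)) by rewrite fine_ge0.
pose m1 := image_measure (mrestr P mgB) mf.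
pose m2 : {measure set _ -> \bar R} := mscale (NngNum PgB0) (distribution P F0).
have E1 C : m1 C = P (f @^-1` C `&` g @^-1` B) by [].
have E2 C : m2 C = (P (f @^-1` C) * P (g @^-1` B))%E.
  transitivity ((fine (P (g @^-1` B)))%:E * P (f @^-1` C))%E; first by [].
  by rewrite fineK// muleC.
rewrite -E1 -E2; apply: (prob_unique mG) => //.
  rewrite E1 /= preimage_setT setTI.
  by rewrite (le_lt_trans (probability_le1 P mgB))// ltry.
by move=> C GC; rewrite E1 E2 GP.
Qed.

Lemma independent_pi dE dF (E : measurableType dE) (F : measurableType dF)
    (f : T -> E) (g : T -> F) (G : set (set E)) (H : set (set F)) :
  measurable_fun setT f -> measurable_fun setT g ->
  measurable = <<s G >> -> setI_closed G -> G setT ->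
  measurable = <<s H >> -> setI_closed H -> H setT ->
  (forall A B, G A -> H B ->
    P (f @^-1` A `&` g @^-1` B) = (P (f @^-1` A) * P (g @^-1` B))%E) ->
  independent P f g.
Proof.
move=> mf mg mG GI GT mH HI HT GP.
apply: (independent_pi_l mf mg mG GI GT) => A B GA mB.
have mA : measurable A by rewrite mG; exact: sub_sigma_algebra.
have mfA : measurable (f @^-1` A).
  by rewrite -[X in measurable X]setTI; exact: mf.
pose G0 : {mfun T >-> F} := HB.pack g (isMeasurableFun.Build _ _ _ _ g mg).
have PfA : P (f @^-1` A) \is a fin_num by exact: fin_num_measure.
have PfA0 : 0 <= fine (P (f @^-1` A)) by rewrite fine_ge0.
pose m1 := image_measure (mrestr P mfA) mg.
pose m2 : {measure set _ -> \bar R} := mscale (NngNum PfA0) (distribution P G0).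
have E1 C : m1 C = P (f @^-1` A `&` g @^-1` C) by rewrite setIC.
have E2 C : m2 C = (P (f @^-1` A) * P (g @^-1` C))%E.
  transitivity ((fine (P (f @^-1` A)))%:E * P (g @^-1` C))%E; first by [].
  by rewrite fineK.
rewrite -E1 -E2; apply: (prob_unique mH) => //.
  rewrite E1 /= preimage_setT setIT.
  by rewrite (le_lt_trans (probability_le1 P mfA))// ltry.
by move=> C HC; rewrite E1 E2 GP.
Qed.

(** Independence says that the joint law and the product of the marginals agree on rectangles, so
    they are equal and Tonelli applies. This replaces conditioning throughout: [V] is frozen while
    [U] is averaged. *)
Lemma decoupling dE dF (E : measurableType dE) (F : measurableType dF)
    (U : T -> E) (V : T -> F) (psi : E * F -> \bar R) :
  measurable_fun setT U -> measurable_fun setT V -> independent P U V ->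
  measurable_fun [set: E * F] psi -> (forall z, (0 <= psi z)%E) ->
  (\int[P]_w psi (U w, V w) = \int[P]_w \int[P]_w' psi (U w', V w))%E.
Proof.
move=> mU mV UV mpsi psi0.
pose U0 : {mfun T >-> E} := HB.pack U (isMeasurableFun.Build _ _ _ _ U mU).
pose V0 : {mfun T >-> F} := HB.pack V (isMeasurableFun.Build _ _ _ _ V mV).
have mW : measurable_fun setT (fun w => (U w, V w)) by exact: measurable_fun_pair.
pose W0 : {mfun T >-> (E * F)%type} :=
  HB.pack (fun w => (U w, V w)) (isMeasurableFun.Build _ _ _ _ _ mW).
have -> : (\int[P]_w psi (U w, V w) = \int[distribution P W0]_z psi z)%E.
  by rewrite ge0_integral_distribution.
have -> : (\int[distribution P W0]_z psi z =
    \int[distribution P U0 \x distribution P V0]_z psi z)%E.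
  apply: eq_measure_integral => A mA _.
  exact/esym/(product_measure_unique (m' := distribution P W0)).
rewrite fubini_tonelli2// ge0_integral_distribution//; last 2 first.
- exact: measurable_fun_fubini_tonelli_G.
- by move=> v; exact: integral_ge0.
apply: eq_integral => w _ /=; rewrite /fubini_G ge0_integral_distribution//.
by apply: measurableT_comp => //; exact: measurable_fun_pair.
Qed.

End Independence.

Section Update.
Context {E : Type} {n : nat}.
Implicit Types (s : n.-tuple E) (k i : 'I_n) (u v : E).

Definition upd s k u : n.-tuple E :=
  [tuple if i == k then u else tnth s i | i < n].

Lemma tnth_upd s k u i : tnth (upd s k u) i = if i == k then u else tnth s i.
Proof. exact: tnth_mktuple. Qed.

Lemma upd_upd s k u v : upd (upd s k u) k v = upd s k v.
Proof. by apply: eq_from_tnth => i; rewrite !tnth_upd; case: eqP. Qed.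

Lemma updC s k i u v : k != i -> upd (upd s k u) i v = upd (upd s i v) k u.
Proof.
move=> ki; apply: eq_from_tnth => j; rewrite !tnth_upd.
by case: (eqVneq j i) => [->|//]; rewrite eq_sym (negbTE ki).
Qed.

End Update.

Lemma measurable_upd d d' (T : measurableType d) (E : measurableType d') n
    (k : 'I_n) (f : T -> n.-tuple E) (g : T -> E) :
  measurable_fun setT f -> measurable_fun setT g ->
  measurable_fun setT (fun w => upd (f w) k (g w)).
Proof.
move=> mf mg; apply/measurable_fun_tnthP => i.
have [->|ik] := eqVneq i k.
  by rewrite (_ : _ \o _ = g)//; apply/funext => w /=; rewrite tnth_upd eqxx.
rewrite (_ : _ \o _ = (fun s => tnth s i) \o f).
  by apply: measurableT_comp => //; exact: measurable_tnth.
by apply/funext => w /=; rewrite tnth_upd (negbTE ik).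
Qed.

(** Used at two levels: a row of entries with law [mu], and a sample of rows with law [nu]. Stating
    the product law on boxes lets both be read off directly from mutual independence. *)
Definition iid_law {R : realType} d (E : measurableType d) n
    (Pi : probability (n.-tuple E) R) (nu : probability E R) : Prop :=
  forall A : 'I_n -> set E, (forall i, measurable (A i)) ->
    (Pi (box A) = \prod_(i < n) nu (A i))%E.

Section Resampling.
Context {R : realType} {d : measure_display} {E : measurableType d} {n : nat}.
Variables (Pi : probability (n.-tuple E) R) (nu : probability E R).
Hypothesis Pi_iid : iid_law Pi nu.
Variable k : 'I_n.

Let upd1 (z : n.-tuple E * E) := upd z.1 k z.2.

Let mupd1 : measurable_fun setT upd1.
Proof. exact: measurable_upd. Qed.

(** Replacing coordinate [k] by a fresh draw leaves the law unchanged. On a box the old coordinate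
    becomes free, contributing a factor [1], and the fresh one supplies [nu (B k)]. *)
Lemma iid_law_upd A : measurable A -> Pi A = (Pi \x nu)%E (upd1 @^-1` A).
Proof.
pose m2 := image_measure (Pi \x nu)%E mupd1.
apply: (prob_unique (m1 := Pi) (m2 := m2) (@measurable_boxesE _ E n)).
- exact: boxes_setI.
- exact: boxes_setT.
- by rewrite [X in (X < _)%E](probability_setT Pi) ltry.
move=> _ [B mB <-].
transitivity ((Pi \x nu)%E (upd1 @^-1` (box B))); last by [].
pose B' i := if i == k then setT else B i.
have mB' i : measurable (B' i) by rewrite /B'; case: ifP.
rewrite (_ : upd1 @^-1` _ = box B' `*` B k).
  rewrite product_measure1E//; last exact: measurable_box.
  transitivity (\prod_(i < n) nu (B i))%E; first exact: Pi_iid.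
  transitivity ((\prod_(i < n) nu (B' i)) * nu (B k))%E; last first.
    by congr (_ * _)%E; exact/esym/Pi_iid.
  rewrite (bigD1 k)//= [in RHS](bigD1 k)//=.
  have -> : B' k = setT by rewrite /B' eqxx.
  rewrite [X in ((X * _) * _)%E](probability_setT nu) mul1e muleC.
  congr (_ * _)%E.
  by apply: eq_bigr => i ik; rewrite /B' (negbTE ik).
apply/seteqP; split=> -[s u] /=.
  move=> H; split; last by have := H k; rewrite tnth_upd eqxx.
  move=> i; rewrite /B'; case: eqP => // /eqP ik.
  by have := H i; rewrite tnth_upd (negbTE ik).
move=> [H Hu] i; rewrite tnth_upd; case: eqP => [->//|/eqP ik].
by have := H i; rewrite /B' (negbTE ik).
Qed.

Lemma resampling_ge0 (psi : n.-tuple E -> \bar R) :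
  measurable_fun setT psi -> (forall s, 0 <= psi s)%E ->
  (\int[Pi]_s psi s = \int[Pi]_s \int[nu]_u psi (upd s k u))%E.
Proof.
move=> mpsi psi0.
have -> : (\int[Pi]_s psi s = \int[image_measure (Pi \x nu)%E mupd1]_s psi s)%E.
  by apply: eq_measure_integral => A mA _; exact: iid_law_upd.
rewrite ge0_integral_pushforward// preimage_setT fubini_tonelli1//.
  exact: measurableT_comp.
by move=> z; exact: psi0.
Qed.

(** The signed version. Integrability of every section, not just of almost every one, makes the
    real-valued inner integral coincide everywhere with the one in Fubini's theorem. *)
Lemma resampling_integrable (psi : n.-tuple E -> R) :
  Pi.-integrable setT (EFin \o psi) ->
  (forall s, nu.-integrable setT (EFin \o (fun u => psi (upd s k u)))) ->
  Pi.-integrable setT (EFin \o (fun s => \int[nu]_u psi (upd s k u))) /\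
  \int[Pi]_s psi s = \int[Pi]_s \int[nu]_u psi (upd s k u).
Proof.
move=> ipsi inu.
have mpsi := measurable_int _ ipsi.
have mpsi2 : measurable_fun setT ((EFin \o psi) \o upd1).
  exact: measurableT_comp.
have i2 : (Pi \x nu)%E.-integrable setT ((EFin \o psi) \o upd1).
  apply: (proj2 (integrable12ltyP Pi nu mpsi2)).
  have /integrableP[_] := ipsi.
  rewrite (resampling_ge0 (psi := fun s => `|(EFin \o psi) s|%E))//.
  exact: measurableT_comp.
have FE : fubini_F nu ((EFin \o psi) \o upd1) =
    EFin \o (fun s => \int[nu]_u psi (upd s k u)).
  apply/funext => s; rewrite /fubini_F /= /Rintegral fineK//.
  exact: (integrable_fin_num _ (inu s)).
split; first by rewrite -FE; exact: integrable_fubini_F.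
rewrite /Rintegral; congr fine.
have -> : (\int[Pi]_s (psi s)%:E =
    \int[image_measure (Pi \x nu)%E mupd1]_s (psi s)%:E)%E.
  by apply: eq_measure_integral => A mA _; exact: iid_law_upd.
rewrite (integral_pushforward mupd1)//.
rewrite preimage_setT -(integral12_prod_meas1 i2).
by apply: eq_integral => s _; rewrite -/(fubini_F _ _ _) FE.
Qed.

End Resampling.

Section BoundedFunctions.
Context {R : realType}.

(** Resolvent functionals are bounded, and this class is closed under the products, powers and
    partial integrals of the concentration argument, so integrability is automatic there. *)
Definition bounded_measurable d (T : measurableType d) (f : T -> R) : Prop :=
  measurable_fun setT f /\ exists M, forall x, `|f x| <= M.

Context {d : measure_display} {T : measurableType d}.
Implicit Types f g : T -> R.

Lemma bounded_measurableD f g : bounded_measurable f -> bounded_measurable g ->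
  bounded_measurable (fun x => f x + g x).
Proof.
move=> [mf [M fM]] [mg [N gN]]; split; first exact: measurable_funD.
by exists (M + N) => x; rewrite (le_trans (ler_normD _ _))// lerD.
Qed.

Lemma bounded_measurableM f g : bounded_measurable f -> bounded_measurable g ->
  bounded_measurable (fun x => f x * g x).
Proof.
move=> [mf [M fM]] [mg [N gN]]; split; first exact: measurable_funM.
by exists (M * N) => x; rewrite normrM ler_pM.
Qed.

Lemma bounded_measurable_cst c : bounded_measurable (fun _ : T => c).
Proof. by split => //; exists `|c|. Qed.

Lemma bounded_measurableB f g : bounded_measurable f -> bounded_measurable g ->
  bounded_measurable (fun x => f x - g x).
Proof.
move=> mf [mg [N gN]]; apply: bounded_measurableD => //; split.
  exact: measurableT_comp.
by exists N => x; rewrite normrN.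
Qed.

Lemma bounded_measurableX f k : bounded_measurable f ->
  bounded_measurable (fun x => f x ^+ k).
Proof.
move=> mf; elim: k => [|k IH].
  by under eq_fun do rewrite expr0; exact: bounded_measurable_cst.
by under eq_fun do rewrite exprS; exact: bounded_measurableM.
Qed.

Lemma bounded_measurable_comp d' (T' : measurableType d') f (g : T' -> T) :
  bounded_measurable f -> measurable_fun setT g -> bounded_measurable (f \o g).
Proof.
move=> [mf [M fM]] mg; split; first exact: measurableT_comp.
by exists M => x /=.
Qed.

Lemma bounded_integrable (P : probability T R) f :
  bounded_measurable f -> P.-integrable setT (EFin \o f).
Proof.
move=> [mf [M fM]]; apply: measurable_bounded_integrable => //.
  by rewrite [X in (X < _)%E](probability_setT P) ltry.
exists M; split; first exact: num_real.
by move=> N MN x _; exact: (le_trans (fM x) (ltW MN)).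
Qed.

Lemma Rintegral_prob_cst (P : probability T R) (c : R) : \int[P]_x c = c.
Proof. rewrite Rintegral_cst// [X in fine X](probability_setT P).
by rewrite mulr1. Qed.

Lemma jensen2 (P : probability T R) f : P.-integrable setT (EFin \o f) ->
  P.-integrable setT (EFin \o (fun x => f x ^+ 2)) ->
  (\int[P]_x f x) ^+ 2 <= \int[P]_x (f x ^+ 2).
Proof.
move=> if1 if2; set c := \int[P]_x f x.
have ic : P.-integrable setT (EFin \o (fun=> c)).
  by apply: bounded_integrable; exact: bounded_measurable_cst.
have icf : P.-integrable setT (EFin \o (fun x => (2 * c) * f x)).
  by apply: (integrableZl measurableT (2 * c) if1).
have : 0 <= \int[P]_x (f x ^+ 2 - (2 * c) * f x + c ^+ 2).
  apply: Rintegral_ge0 => x _.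
  by rewrite (_ : _ + _ = (f x - c) ^+ 2) ?sqr_ge0//; ring.
rewrite RintegralD//; last 2 first.
- by apply: (integrableB measurableT if2 icf).
- by apply: bounded_integrable; exact: bounded_measurable_cst.
rewrite RintegralB// RintegralZl// Rintegral_prob_cst -/c; lra.
Qed.

Lemma jensen4 (P : probability T R) f : P.-integrable setT (EFin \o f) ->
  P.-integrable setT (EFin \o (fun x => f x ^+ 2)) ->
  P.-integrable setT (EFin \o (fun x => f x ^+ 4)) ->
  (\int[P]_x f x) ^+ 4 <= \int[P]_x (f x ^+ 4).
Proof.
move=> if1 if2 if4.
have -> : (\int[P]_x f x) ^+ 4 = ((\int[P]_x f x) ^+ 2) ^+ 2.
  by rewrite -exprM.
have f4E : (fun x => f x ^+ 4) = (fun x => (f x ^+ 2) ^+ 2).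
  by apply/funext => x; rewrite -exprM.
apply: (@le_trans _ _ ((\int[P]_x (f x ^+ 2)) ^+ 2)).
  rewrite ler_sqr ?nnegrE ?sqr_ge0//; first exact: jensen2.
  by apply: Rintegral_ge0 => x _; exact: sqr_ge0.
under [leRHS]eq_Rintegral do rewrite (_ : 4 = 2 * 2)%N// exprM.
by apply: jensen2; rewrite // -f4E.
Qed.

End BoundedFunctions.

Lemma bounded_partial_integral {R : realType} d d' (T : measurableType d)
    (E : measurableType d') (nu : probability E R) (f : T * E -> R) :
  bounded_measurable f ->
  bounded_measurable (fun x => \int[nu]_u f (x, u)).
Proof.
move=> bf; have [mf [M fM]] := bf.
have fb x : bounded_measurable (fun u => f (x, u)).
  split; last by exists M.
  exact: measurableT_comp.
split.
  (* Adding [M] makes the integrand nonnegative, so that Tonelli gives measurability of the partial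
     integral; [M] is subtracted again afterwards. *)
  pose h x := (\int[nu]_u (f (x, u) + M)%:E)%E.
  have mh : measurable_fun setT h.
    apply: (measurable_fun_fubini_tonelli_F (fun z => (f z + M)%:E)).
      by apply/measurable_EFinP; exact: measurable_funD.
    move=> z; rewrite lee_fin -lerBlDr sub0r.
    by have := fM z; rewrite ler_norml => /andP[].
  rewrite (_ : (fun x => _) = (fun x => fine (h x) - M)).
    by apply: measurable_funB => //; exact: measurableT_comp.
  apply/funext => x; rewrite /h -/(Rintegral _ _ _) RintegralD//.
  - by rewrite Rintegral_prob_cst addrK.
  - exact: bounded_integrable.
  - by apply: bounded_integrable; exact: bounded_measurable_cst.
exists M => x; apply: le_trans (le_normr_Rintegral _ _) _ => //.
  exact: bounded_integrable.
rewrite -[leRHS](Rintegral_prob_cst nu); apply: le_Rintegral => //.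
- apply: bounded_integrable; split; last by exists M => u; rewrite normr_id.
  by apply: measurableT_comp => //; case: (fb x).
- by apply: bounded_integrable; exact: bounded_measurable_cst.
Qed.

Lemma le_eq disp (T : porderType disp) (x y : T) : x = y -> (x <= y)%O.
Proof. by move=> ->. Qed.

Lemma le_Rintegral_bounded {R : realType} d (T : measurableType d)
    (P : probability T R) (f g : T -> R) :
  bounded_measurable f -> bounded_measurable g -> (forall x, f x <= g x) ->
  \int[P]_x f x <= \int[P]_x g x.
Proof.
by move=> bf bg fg; apply: le_Rintegral => //; exact: bounded_integrable.
Qed.

Lemma RintegralD_bounded {R : realType} d (T : measurableType d)
    (P : probability T R) (f g : T -> R) :
  bounded_measurable f -> bounded_measurable g ->
  \int[P]_x (f x + g x) = \int[P]_x f x + \int[P]_x g x.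
Proof. by move=> bf bg; rewrite RintegralD//; exact: bounded_integrable. Qed.

Lemma RintegralB_bounded {R : realType} d (T : measurableType d)
    (P : probability T R) (f g : T -> R) :
  bounded_measurable f -> bounded_measurable g ->
  \int[P]_x (f x - g x) = \int[P]_x f x - \int[P]_x g x.
Proof. by move=> bf bg; rewrite RintegralB//; exact: bounded_integrable. Qed.

Lemma RintegralZl_bounded {R : realType} d (T : measurableType d)
    (P : probability T R) (c : R) (f : T -> R) :
  bounded_measurable f -> \int[P]_x (c * f x) = c * \int[P]_x f x.
Proof. by move=> bf; rewrite RintegralZl//; exact: bounded_integrable. Qed.

Lemma Rintegral_bounded_le_cst {R : realType} d (T : measurableType d)
    (P : probability T R) (f : T -> R) (M : R) :
  bounded_measurable f -> (forall x, f x <= M) -> \int[P]_x f x <= M.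
Proof.
move=> bf fM; rewrite -[leRHS](Rintegral_prob_cst P).
by apply: le_Rintegral_bounded => //; exact: bounded_measurable_cst.
Qed.

Lemma Fubini_bounded {R : realType} d d' (T : measurableType d)
    (U : measurableType d') (P : probability T R) (Q : probability U R)
    (f : T * U -> R) : bounded_measurable f ->
  \int[P]_x \int[Q]_y f (x, y) = \int[Q]_y \int[P]_x f (x, y).
Proof.
move=> bf; have [mf [M fM]] := bf.
have PQ1 : (P \x Q)%E setT = 1%E.
  rewrite -setXTT product_measure1E// -[RHS]mule1.
  by congr (_ * _)%E; exact: probability_setT.
have i2 : (P \x Q)%E.-integrable setT (EFin \o f).
  apply: measurable_bounded_integrable => //.
    exact: (le_lt_trans (le_eq PQ1) (ltry 1)).
  exists M; split; first exact: num_real.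
  by move=> N MN x _; exact: (le_trans (fM x) (ltW MN)).
have iQ x : Q.-integrable setT (EFin \o (fun y => f (x, y))).
  apply: bounded_integrable; split; last by exists M.
  exact: measurableT_comp.
have iP y : P.-integrable setT (EFin \o (fun x => f (x, y))).
  apply: bounded_integrable; split; last by exists M.
  exact: measurableT_comp.
rewrite /Rintegral; congr fine.
transitivity (\int[P]_x \int[Q]_y (EFin \o f) (x, y))%E.
  apply: eq_integral => x _; rewrite fineK//.
  exact: (integrable_fin_num _ (iQ x)).
rewrite (Fubini i2); apply: eq_integral => y _; rewrite fineK//.
exact: (integrable_fin_num _ (iP y)).
Qed.

(** * Fourth-moment Efron-Stein inequality *)

Section Concentration.
Context {R : realType} {d : measure_display} {E : measurableType d} {n : nat}.
Variables (Pi : probability (n.-tuple E) R) (nu : probability E R).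
Hypothesis Pi_iid : iid_law Pi nu.
Variable e0 : E.
Implicit Types (Q : n.-tuple E -> R) (k i : 'I_n).

Lemma bounded_measurable_upd Q k s : bounded_measurable Q ->
  bounded_measurable (fun u => Q (upd s k u)).
Proof.
move=> bQ; apply: (bounded_measurable_comp bQ).
exact: measurable_upd.
Qed.

Lemma resampling_bounded Q k : bounded_measurable Q ->
  \int[Pi]_s Q s = \int[Pi]_s \int[nu]_u Q (upd s k u).
Proof.
move=> bQ; have [|//] := resampling_integrable Pi_iid (k := k)
  (bounded_integrable Pi bQ).
by move=> s; apply: bounded_integrable; exact: bounded_measurable_upd.
Qed.

Definition averaged k Q s := \int[nu]_u Q (upd s k u).

(** The oscillation is measured against a fixed reference value [e0] of the coordinate, uniformly in
    the other coordinates. For samples [e0] will be the zero row, so that the reference is the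
    leave-one-out quantity. *)
Definition oscillation_le (p : nat) Q k (V : R) : Prop :=
  forall s, \int[nu]_u ((Q (upd s k u) - Q (upd s k e0)) ^+ p) <= V.

Lemma bounded_averaged k Q : bounded_measurable Q ->
  bounded_measurable (averaged k Q).
Proof.
move=> bQ; apply: (bounded_partial_integral nu (f := fun z => Q (upd z.1 k z.2))).
apply: (bounded_measurable_comp bQ).
exact: measurable_upd.
Qed.

Lemma averaged_upd k Q s u : averaged k Q (upd s k u) = averaged k Q s.
Proof. by apply: eq_Rintegral => v _; rewrite upd_upd. Qed.

Lemma averaged_upd_neq k i Q :
  (forall s u, Q (upd s i u) = Q s) -> i != k ->
  forall s u, averaged k Q (upd s i u) = averaged k Q s.
Proof.
by move=> Qi ik s u; apply: eq_Rintegral => v _; rewrite updC.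
Qed.

(** Jensen moves the power inside the average over coordinate [i]; after exchanging the integrals,
    the bound [V] holds for each value of that coordinate. *)
Lemma averaged_oscillation (p : nat) Q k i (V : R) :
  (forall f : E -> R, bounded_measurable f ->
    (\int[nu]_u f u) ^+ p <= \int[nu]_u (f u ^+ p)) ->
  bounded_measurable Q -> i != k ->
  oscillation_le p Q k V -> oscillation_le p (averaged i Q) k V.
Proof.
move=> jensen bQ ik QV s; set e := e0.
pose f (z : E * E) := (Q (upd (upd s k z.1) i z.2) - Q (upd (upd s k e) i z.2)) ^+ p.
have bf : bounded_measurable f.
  apply: bounded_measurableX; apply: bounded_measurableB.
    apply: (bounded_measurable_comp bQ).
    by apply: measurable_upd => //; exact: measurable_upd.
  apply: (bounded_measurable_comp bQ).
  exact: measurable_upd.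
apply: (@le_trans _ _ (\int[nu]_u \int[nu]_v f (u, v))).
  apply: le_Rintegral_bounded.
  - apply: bounded_measurableX; apply: bounded_measurableB.
      by apply: bounded_measurable_upd; exact: bounded_averaged.
    exact: bounded_measurable_cst.
  - exact: bounded_partial_integral.
  move=> u; rewrite /averaged -RintegralB_bounded; last 2 first.
  - exact: bounded_measurable_upd.
  - exact: bounded_measurable_upd.
  by apply: jensen; apply: bounded_measurableB; exact: bounded_measurable_upd.
rewrite (Fubini_bounded _ _ bf); apply: Rintegral_bounded_le_cst.
  apply: (bounded_partial_integral nu (f := fun z => f (z.2, z.1))).
  apply: (bounded_measurable_comp bf).
  exact: measurable_fun_pair.
move=> v; apply: le_trans (QV (upd s i v)).
by apply/le_eq; apply: eq_Rintegral => u _; rewrite /f /= !(updC _ _ _ ik).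
Qed.

Section Step.
Variables (Q : n.-tuple E -> R) (k : 'I_n).
Hypothesis bQ : bounded_measurable Q.
Let Q' := averaged k Q.
Let D s := Q s - Q' s.
Let bQ' : bounded_measurable Q' := bounded_averaged k bQ.
Let bD : bounded_measurable D := bounded_measurableB bQ bQ'.

Lemma averaged_diff_mean s : \int[nu]_u D (upd s k u) = 0.
Proof.
rewrite /D RintegralB_bounded; last 2 first.
- exact: bounded_measurable_upd.
- exact: bounded_measurable_upd.
under [X in _ - X]eq_Rintegral do rewrite /Q' averaged_upd.
by rewrite Rintegral_prob_cst subrr.
Qed.

Let f s u := Q (upd s k u) - Q (upd s k e0).

Let bf s : bounded_measurable (f s).
Proof.
apply: bounded_measurableB; first exact: bounded_measurable_upd.
exact: bounded_measurable_cst.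
Qed.

Let DE s u : D (upd s k u) = f s u - \int[nu]_v f s v.
Proof.
rewrite /D /Q' averaged_upd /f RintegralB_bounded; last 2 first.
- exact: bounded_measurable_upd.
- exact: bounded_measurable_cst.
rewrite Rintegral_prob_cst /averaged; ring.
Qed.

(** A variance is at most the second moment about any point, here about the value at [e0]. *)
Lemma averaged_diff2 V s : oscillation_le 2 Q k V ->
  \int[nu]_u (D (upd s k u) ^+ 2) <= V.
Proof.
move=> QV; set c := \int[nu]_v f s v.
have -> : \int[nu]_u (D (upd s k u) ^+ 2) = \int[nu]_u (f s u ^+ 2) - c ^+ 2.
  transitivity (\int[nu]_u ((f s u ^+ 2 - (2 * c) * f s u) + c ^+ 2)).
    by apply: eq_Rintegral => u _; rewrite DE -/c; ring.
  have bfc : bounded_measurable (fun u => (2 * c) * f s u).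
    by apply: bounded_measurableM => //; exact: bounded_measurable_cst.
  rewrite RintegralD_bounded; last 2 first.
  - by apply: bounded_measurableB => //; exact: bounded_measurableX.
  - exact: bounded_measurable_cst.
  rewrite RintegralB_bounded//; last exact: bounded_measurableX.
  by rewrite RintegralZl_bounded// Rintegral_prob_cst -/c; ring.
by have := QV s; have := sqr_ge0 c; rewrite -/f; lra.
Qed.

(** The constant is [8 + 8], from [(a - c)^4 <= 8 a^4 + 8 c^4] with [c] the mean of [a], whose
    fourth power is controlled by Jensen. *)
Lemma averaged_diff4 W s : oscillation_le 4 Q k W ->
  \int[nu]_u (D (upd s k u) ^+ 4) <= 16 * W.
Proof.
move=> QW; set c := \int[nu]_v f s v.
have c4 : c ^+ 4 <= W.
  apply: le_trans (QW s); apply: jensen4; apply: bounded_integrable => //;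
  exact: bounded_measurableX.
apply: (@le_trans _ _ (\int[nu]_u (8 * f s u ^+ 4 + 8 * c ^+ 4))).
  apply: le_Rintegral_bounded.
  - by apply: bounded_measurableX; exact: bounded_measurable_upd.
  - apply: bounded_measurableD; last exact: bounded_measurable_cst.
    apply: bounded_measurableM; first exact: bounded_measurable_cst.
    exact: bounded_measurableX.
  move=> u; rewrite DE -/c.
  set a := f s u.
  suff : 0 <= 8 * a ^+ 4 + 8 * c ^+ 4 - (a - c) ^+ 4 by lra.
  have -> : 8 * a ^+ 4 + 8 * c ^+ 4 - (a - c) ^+ 4 =
     (a + c) ^+ 2 * (7 * a ^+ 2 - 10 * (a * c) + 7 * c ^+ 2). by ring.
  apply: mulr_ge0; first exact: sqr_ge0.
  have -> : 7 * a ^+ 2 - 10 * (a * c) + 7 * c ^+ 2 =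
    5 * (a - c) ^+ 2 + 2 * a ^+ 2 + 2 * c ^+ 2 by ring.
  by have := sqr_ge0 (a - c); have := sqr_ge0 a; have := sqr_ge0 c; lra.
rewrite RintegralD_bounded; last 2 first.
- apply: bounded_measurableM; first exact: bounded_measurable_cst.
  exact: bounded_measurableX.
- exact: bounded_measurable_cst.
rewrite RintegralZl_bounded; last exact: bounded_measurableX.
by rewrite Rintegral_prob_cst; have := QW s; rewrite -/f; lra.
Qed.

End Step.

(** Induction on the number [j] of leading coordinates on which [Q] may depend. Averaging out the
    last of them splits [Q - c] into [S + D], with [S] free of that coordinate and [D] of mean zero
    in it. Second moments then add, and the fourth moment grows by at most [8 V (j V) + 48 W] per
    step; the increments sum to less than the stated bound. *)
Lemma concentration_rec (V W : R) (j : nat) : (j <= n)%N -> 0 <= V -> 0 <= W ->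
  forall Q, bounded_measurable Q ->
  (forall k, oscillation_le 2 Q k V) -> (forall k, oscillation_le 4 Q k W) ->
  (forall i, (j <= i)%N -> forall s u, Q (upd s i u) = Q s) ->
  let c := \int[Pi]_s Q s in
  \int[Pi]_s ((Q s - c) ^+ 2) <= j%:R * V /\
  \int[Pi]_s ((Q s - c) ^+ 4) <= 8 * j%:R ^+ 2 * V ^+ 2 + 48 * j%:R * W.
Proof.
move=> + V0 W0; elim: j => [_|j IH jn] Q bQ Q2 Q4 Qdep c.
  have Qc s s' : Q s = Q s'.
    (* A function that ignores each coordinate is constant: pass from [s] to [s'] by changing one
       coordinate at a time. *)
    pose s_ (m : nat) := [tuple if (i < m)%N then tnth s' i else tnth s i | i < n].
    suff H m : (m <= n)%N -> Q (s_ m) = Q s.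
      rewrite -(H n)//; congr Q; apply: eq_from_tnth => i.
      by rewrite tnth_mktuple ltn_ord.
    elim: m => [_|m IH mn].
      by congr Q; apply: eq_from_tnth => i; rewrite tnth_mktuple.
    rewrite -IH; last exact: ltnW.
    rewrite -(Qdep (Ordinal mn) _ (s_ m) (tnth s' (Ordinal mn)))//.
    congr Q; apply: eq_from_tnth => i; rewrite tnth_upd !tnth_mktuple.
    case: (eqVneq i (Ordinal mn)) => [->|im] /=; first by rewrite ltnSn.
    by rewrite ltnS leq_eqVlt (negbTE (im : nat_of_ord i != m)).
  have QE s : Q s = c.
    rewrite /c; under eq_Rintegral => s' _ do rewrite (Qc s' s).
    by rewrite Rintegral_prob_cst.
  split; under eq_Rintegral do rewrite QE subrr expr0n/=;
    rewrite Rintegral_prob_cst; first by rewrite mul0r.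
  by rewrite expr0n /= mulr0 !mul0r mulr0 mul0r addr0.
pose k := Ordinal jn.
pose Q' := averaged k Q; pose D s := Q s - Q' s.
have bQ' : bounded_measurable Q' := bounded_averaged k bQ.
have bD : bounded_measurable D := bounded_measurableB bQ bQ'.
have cE : \int[Pi]_s Q' s = c by rewrite /c (resampling_bounded k bQ).
have Q'2 i : oscillation_le 2 Q' i V.
  have [->|ik] := eqVneq i k.
    move=> s; under eq_Rintegral do rewrite /Q' !averaged_upd subrr expr0n.
    by rewrite Rintegral_prob_cst.
  apply: averaged_oscillation => //; last by rewrite eq_sym.
  move=> f bf; apply: jensen2; apply: bounded_integrable => //.
  exact: bounded_measurableX.
have Q'4 i : oscillation_le 4 Q' i W.
  have [->|ik] := eqVneq i k.
    move=> s; under eq_Rintegral do rewrite /Q' !averaged_upd subrr expr0n.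
    by rewrite Rintegral_prob_cst.
  apply: averaged_oscillation => //; last by rewrite eq_sym.
  by move=> f bf; apply: jensen4; apply: bounded_integrable => //;
    exact: bounded_measurableX.
have Q'dep i : (j <= i)%N -> forall s u, Q' (upd s i u) = Q' s.
  rewrite leq_eqVlt => /orP[/eqP ji|ji] s u.
    by rewrite (_ : i = k) /Q' ?averaged_upd//; exact/val_inj/esym.
  apply: averaged_upd_neq; first by move=> *; exact: Qdep.
  by rewrite -val_eqE /= neq_ltn ji orbT.
have [H2 H4] := IH (ltnW jn) Q' bQ' Q'2 Q'4 Q'dep; rewrite cE in H2 H4.
pose S s := Q' s - c.
have bS : bounded_measurable S.
  by apply: bounded_measurableB => //; exact: bounded_measurable_cst.
have Su s u : S (upd s k u) = S s by rewrite /S /Q' averaged_upd.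
have bSX m : bounded_measurable (fun s => S s ^+ m) by exact: bounded_measurableX.
have bDX m : bounded_measurable (fun s => D s ^+ m) by exact: bounded_measurableX.
(* Resampling coordinate [k] leaves [S] fixed and averages [D] to zero. *)
have orth m : \int[Pi]_s (S s ^+ m * D s) = 0.
  rewrite (resampling_bounded k); last exact: bounded_measurableM.
  under eq_Rintegral => s _.
    under eq_Rintegral do rewrite Su.
    rewrite RintegralZl_bounded; last exact: bounded_measurable_upd.
    rewrite averaged_diff_mean// mulr0; over.
  by rewrite Rintegral_prob_cst.
have quad m : ~~ odd m ->
    \int[Pi]_s (S s ^+ m * D s ^+ 2) <= V * \int[Pi]_s (S s ^+ m).
  move=> mo; rewrite (resampling_bounded k); last exact: bounded_measurableM.
  rewrite -RintegralZl_bounded//; apply: le_Rintegral_bounded.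
  - apply: (bounded_averaged k (Q := fun s => S s ^+ m * D s ^+ 2)).
    exact: bounded_measurableM.
  - by apply: bounded_measurableM => //; exact: bounded_measurable_cst.
  move=> s; under eq_Rintegral do rewrite Su.
  rewrite RintegralZl_bounded; last exact: (bounded_measurable_upd _ _ (bDX 2%N)).
  rewrite mulrC ler_wpM2r//; first exact: exprn_even_ge0.
  exact: averaged_diff2.
have D4 : \int[Pi]_s (D s ^+ 4) <= 16 * W.
  rewrite (resampling_bounded k)//; apply: Rintegral_bounded_le_cst.
    exact: (bounded_averaged k (bDX 4%N)).
  by move=> s; exact: averaged_diff4.
have QS s : Q s - c = S s + D s by rewrite /S /D; ring.
split.
  under eq_Rintegral do rewrite QS.
  have -> : \int[Pi]_s ((S s + D s) ^+ 2) = \int[Pi]_s (S s ^+ 2) +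
      2 * \int[Pi]_s (S s ^+ 1 * D s) + \int[Pi]_s (S s ^+ 0 * D s ^+ 2).
    rewrite -RintegralZl_bounded; last exact: bounded_measurableM.
    rewrite -RintegralD_bounded//; last first.
      apply: bounded_measurableM; first exact: bounded_measurable_cst.
      exact: bounded_measurableM.
    rewrite -RintegralD_bounded; last 2 first.
    - apply: bounded_measurableD => //.
      apply: bounded_measurableM; first exact: bounded_measurable_cst.
      exact: bounded_measurableM.
    - exact: bounded_measurableM.
    by apply: eq_Rintegral => s _; ring.
  rewrite orth mulr0 addr0 -natr1 mulrDl mul1r; apply: lerD => //.
  apply: le_trans (quad 0%N isT) _.
  under eq_Rintegral do rewrite expr0.
  by rewrite Rintegral_prob_cst mulr1.
(* The term [4 S D^3] has no sign and no vanishing mean; it is absorbed by raising the coefficients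
   of [S^2 D^2] from 6 to 8 and of [D^4] from 1 to 3, the difference being the square
   [2 (D (S - D))^2]. *)
apply: (@le_trans _ _ (\int[Pi]_s (S s ^+ 4) + 4 * \int[Pi]_s (S s ^+ 3 * D s)
   + 8 * \int[Pi]_s (S s ^+ 2 * D s ^+ 2) + 3 * \int[Pi]_s (D s ^+ 4))).
  have b3 : bounded_measurable (fun s => 4 * (S s ^+ 3 * D s)).
    apply: bounded_measurableM; first exact: bounded_measurable_cst.
    exact: bounded_measurableM.
  have b2 : bounded_measurable (fun s => 8 * (S s ^+ 2 * D s ^+ 2)).
    apply: bounded_measurableM; first exact: bounded_measurable_cst.
    exact: bounded_measurableM.
  have b4 : bounded_measurable (fun s => 3 * (D s ^+ 4)).
    apply: bounded_measurableM; first exact: bounded_measurable_cst.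
    exact: bDX.
  rewrite -RintegralZl_bounded; last exact: bounded_measurableM.
  rewrite -RintegralZl_bounded; last exact: bounded_measurableM.
  rewrite -RintegralZl_bounded; last exact: bDX.
  rewrite -RintegralD_bounded//.
  rewrite -RintegralD_bounded//; last exact: bounded_measurableD.
  rewrite -RintegralD_bounded//; last first.
    by apply: bounded_measurableD => //; exact: bounded_measurableD.
  apply: le_Rintegral_bounded.
  - apply: bounded_measurableX; apply: bounded_measurableB => //.
    exact: bounded_measurable_cst.
  - apply: bounded_measurableD => //; apply: bounded_measurableD => //.
    exact: bounded_measurableD.
  move=> s; rewrite QS; set a := S s; set b := D s.
  rewrite -subr_ge0 (_ : _ - _ = 2 * (b * (a - b)) ^+ 2); last by ring.
  by rewrite mulr_ge0// sqr_ge0.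
rewrite orth mulr0 addr0.
have q2 := quad 2%N isT.
have : V * \int[Pi]_s (S s ^+ 2) <= j%:R * V ^+ 2.
  by rewrite expr2 mulrA mulrC; apply: ler_wpM2r.
have := mulr_ge0 (ler0n R j) (sqr_ge0 V).
have := sqr_ge0 V.
have -> : j.+1%:R = j%:R + 1 :> R by rewrite natr1.
move=> A B C; move: H4; rewrite -/S.
have -> : 8 * (j%:R + 1) ^+ 2 * V ^+ 2 + 48 * (j%:R + 1) * W =
  (8 * j%:R ^+ 2 * V ^+ 2 + 48 * j%:R * W) + 16 * (j%:R * V ^+ 2) + 8 * V ^+ 2
  + 48 * W :> R by ring.
by move=> H4; lra.
Qed.

Lemma concentration (V W : R) Q : 0 <= V -> 0 <= W -> bounded_measurable Q ->
  (forall k, oscillation_le 2 Q k V) -> (forall k, oscillation_le 4 Q k W) ->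
  let c := \int[Pi]_s Q s in
  \int[Pi]_s ((Q s - c) ^+ 2) <= n%:R * V /\
  \int[Pi]_s ((Q s - c) ^+ 4) <= 8 * n%:R ^+ 2 * V ^+ 2 + 48 * n%:R * W.
Proof.
move=> V0 W0 bQ Q2 Q4; apply: concentration_rec => //.
by move=> i; rewrite leqNgt ltn_ord.
Qed.

End Concentration.

Lemma measurable_fun_inv {R : realType} d (T : measurableType d) (f : T -> R) :
  (forall x, 0 <= f x) -> measurable_fun setT f ->
  measurable_fun setT (fun x => (f x)^-1).
Proof.
move=> f0 mf; rewrite (_ : (fun x => _) = (@powR R ^~ (-1)) \o f).
  by apply: measurableT_comp => //; exact: measurable_powR.
by apply/funext => x; rewrite /= powR_inv1.
Qed.

Section RealIntegrable.
Context {R : realType} {d : measure_display} {T : measurableType d}.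
Variable m : {measure set T -> \bar R}.
Implicit Types f g : T -> R.

Lemma integrableZl_real f (c : R) : m.-integrable setT (EFin \o f) ->
  m.-integrable setT (EFin \o (fun x => c * f x)).
Proof. exact: (integrableZl measurableT c). Qed.

Lemma integrableD_real f g : m.-integrable setT (EFin \o f) ->
  m.-integrable setT (EFin \o g) ->
  m.-integrable setT (EFin \o (fun x => f x + g x)).
Proof. exact: (integrableD measurableT). Qed.

Lemma integrableB_real f g : m.-integrable setT (EFin \o f) ->
  m.-integrable setT (EFin \o g) ->
  m.-integrable setT (EFin \o (fun x => f x - g x)).
Proof. exact: (integrableB measurableT). Qed.

End RealIntegrable.

(** * Moments of linear and quadratic forms *)

Section DominatedFunctions.
Context {R : realType} {p : nat}.
Implicit Types (u s : p.-tuple R) (f g : p.-tuple R -> R).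

Definition weight u : R := 1 + \sum_(j < p) tnth u j ^+ 2.

(* [dominated 1] functions have quadratic growth and [dominated 2] functions
   quartic growth, which fourth moments integrate. *)
Definition dominated (k : nat) f : Prop :=
  measurable_fun setT f /\ exists2 C, 0 <= C & forall u, `|f u| <= C * weight u ^+ k.

Lemma weight_ge1 u : 1 <= weight u.
Proof. by rewrite lerDl sumr_ge0// => i _; exact: sqr_ge0. Qed.

Lemma weight_ge0 u : 0 <= weight u.
Proof. exact: le_trans (weight_ge1 u). Qed.

Lemma measurable_weight : measurable_fun setT weight.
Proof.
apply: measurable_funD => //; apply: measurable_sum => i.
by apply: measurable_funX; exact: measurable_tnth.
Qed.

Lemma dominatedD k f g : dominated k f -> dominated k g ->
  dominated k (fun u => f u + g u).
Proof.
move=> [mf [C C0 fC]] [mg [D D0 gD]]; split; first exact: measurable_funD.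
exists (C + D); first exact: addr_ge0.
by move=> u; rewrite mulrDl (le_trans (ler_normD _ _))// lerD.
Qed.

Lemma dominatedM f g : dominated 1 f -> dominated 1 g ->
  dominated 2 (fun u => f u * g u).
Proof.
move=> [mf [C C0 fC]] [mg [D D0 gD]]; split; first exact: measurable_funM.
exists (C * D); first exact: mulr_ge0.
move=> u; rewrite normrM (_ : C * D * _ = (C * weight u ^+ 1) * (D * weight u ^+ 1)).
  exact: ler_pM.
by rewrite expr1; ring.
Qed.

Lemma dominated_cst k (c : R) : dominated k (fun=> c).
Proof.
split => //; exists `|c| => // u; rewrite ler_peMr//.
by apply: exprn_ege1; exact: weight_ge1.
Qed.

Lemma dominatedZ k f (c : R) : dominated k f -> dominated k (fun u => c * f u).
Proof.
move=> [mf [C C0 fC]]; split; first exact: measurable_funM.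
exists (`|c| * C); first exact: mulr_ge0.
by move=> u; rewrite normrM -mulrA ler_wpM2l.
Qed.

Lemma dominatedB k f g : dominated k f -> dominated k g ->
  dominated k (fun u => f u - g u).
Proof.
move=> df dg; under eq_fun do rewrite -[X in _ + X]mulN1r.
by apply: dominatedD => //; exact: dominatedZ.
Qed.

Lemma dominated_sum k I (r : seq I) (P : pred I) (F : I -> p.-tuple R -> R) :
  (forall i, dominated k (F i)) -> dominated k (fun u => \sum_(i <- r | P i) F i u).
Proof.
move=> dF; elim: r => [|i r IH].
  by under eq_fun do rewrite big_nil; exact: dominated_cst.
under eq_fun do rewrite big_cons.
by case: (P i) => //; exact: dominatedD.
Qed.

Lemma dominatedW f : dominated 1 f -> dominated 2 f.
Proof.
move=> df; rewrite (_ : f = fun u => 1 * f u); last first.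
  by apply/funext => u; rewrite mul1r.
exact: (dominatedM (dominated_cst 1 1) df).
Qed.

Lemma dominated_le k f g : measurable_fun setT f -> dominated k g ->
  (forall u, `|f u| <= g u) -> dominated k f.
Proof.
move=> mf [_ [C C0 gC]] fg; split=> //; exists C => // u.
by rewrite (le_trans (fg u))// (le_trans (ler_norm _)).
Qed.

Lemma dominated_coordM i j : dominated 1 (fun u => tnth u i * tnth u j).
Proof.
split; first by apply: measurable_funM; exact: measurable_tnth.
exists 1 => // u; rewrite mul1r expr1.
have le1 k : tnth u k ^+ 2 <= weight u.
  rewrite /weight (bigD1 k)//= addrCA lerDl addr_ge0// sumr_ge0// => l _.
  exact: sqr_ge0.
have := le1 i; have := le1 j; rewrite ler_norml.
have := sqr_ge0 (tnth u i - tnth u j); have := sqr_ge0 (tnth u i + tnth u j).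
by rewrite !expr2; set a := tnth u i; set b := tnth u j; move=> *; apply/andP; split; lra.
Qed.

Lemma dominated_coord i : dominated 1 (fun u => tnth u i).
Proof.
split; first exact: measurable_tnth.
exists 1 => // u; rewrite mul1r expr1.
have : tnth u i ^+ 2 + 1 <= weight u.
  rewrite /weight [leLHS]addrC lerD2l (bigD1 i)//= lerDl.
  by apply: sumr_ge0 => l _; exact: sqr_ge0.
set a := tnth u i; rewrite ler_norml => H.
have := sqr_ge0 (a - 1); have := sqr_ge0 (a + 1); rewrite !expr2 in H *.
by move=> *; apply/andP; split; lra.
Qed.

Context {mu : probability R R} {nu : probability (p.-tuple R) R}.
Hypothesis nu_iid : iid_law nu mu.
Hypothesis mu4 : mu.-integrable setT (EFin \o (fun t : R => t ^+ 4)).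

Lemma mu_poly_integrable (f : R -> R) (C : R) : measurable_fun setT f ->
  (forall t, `|f t| <= C * (1 + t ^+ 4)) -> mu.-integrable setT (EFin \o f).
Proof.
move=> mf fC.
have i4 : mu.-integrable setT (EFin \o (fun t => C * (1 + t ^+ 4))).
  apply: integrableZl_real; apply: integrableD_real mu4.
  by apply: bounded_integrable; exact: bounded_measurable_cst.
apply: le_integrable i4 => //; first exact/measurable_EFinP.
by move=> t _; rewrite /= lee_fin (le_trans (fC t))// ler_norm.
Qed.

Lemma coord4_integrable j :
  nu.-integrable setT (EFin \o (fun u => tnth u j ^+ 4)).
Proof.
have m4 : measurable_fun setT (fun u : p.-tuple R => tnth u j ^+ 4).
  by apply: measurable_funX; exact: measurable_tnth.
apply/integrableP; split; first exact/measurable_EFinP.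
rewrite (resampling_ge0 nu_iid j); last 2 first.
- by apply: measurableT_comp => //; exact/measurable_EFinP.
- by [].
have [_ H] := integrableP _ _ _ mu4.
under eq_integral do under eq_integral do rewrite /= tnth_upd eqxx.
rewrite integral_cst//.
rewrite [X in (_ * X)%E](probability_setT nu) mule1.
exact: H.
Qed.

Lemma dominated_integrable f : dominated 2 f -> nu.-integrable setT (EFin \o f).
Proof.
move=> [mf [C C0 fC]].
(* Cauchy-Schwarz over the [p + 1] terms of [weight u]; the constant term is treated below as one
   more coordinate. *)
pose g u := (C * p.+1%:R) * (1 + \sum_(j < p) tnth u j ^+ 4).
have ig : nu.-integrable setT (EFin \o g).
  apply: integrableZl_real; apply: integrableD_real.
    by apply: bounded_integrable; exact: bounded_measurable_cst.
  rewrite (_ : _ \o _ = (fun x => \sum_(j < p) (tnth x j ^+ 4)%:E)%E).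
    by apply: (integrable_sum measurableT) => j _; exact: coord4_integrable.
  by apply/funext => x; rewrite /= sumEFin.
apply: le_integrable ig => //; first exact/measurable_EFinP.
move=> u _; rewrite /= lee_fin (le_trans (fC u))// (le_trans _ (ler_norm _))//.
rewrite /g -mulrA ler_wpM2l//.
pose F (i : 'I_p.+1) : R := if unlift ord0 i is Some j then tnth u j ^+ 2 else 1.
have -> : weight u = \sum_(i < p.+1) F i.
  rewrite big_ord_recl /F unlift_none; congr (_ + _).
  by apply: eq_bigr => j _; rewrite liftK.
have -> : 1 + \sum_(j < p) tnth u j ^+ 4 = \sum_(i < p.+1) F i ^+ 2.
  rewrite big_ord_recl /F unlift_none expr1n; congr (_ + _).
  by apply: eq_bigr => j _; rewrite liftK -exprM.
set m := \sum_(i < p.+1) F i.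
have : 0 <= \sum_(i < p.+1) (p.+1%:R * F i - m) ^+ 2.
  by apply: sumr_ge0 => i _; exact: sqr_ge0.
have -> : \sum_(i < p.+1) (p.+1%:R * F i - m) ^+ 2 =
   p.+1%:R * (p.+1%:R * \sum_(i < p.+1) F i ^+ 2 - m ^+ 2).
  transitivity (\sum_(i < p.+1) (p.+1%:R ^+ 2 * F i ^+ 2 - (2 * p.+1%:R * m) * F i
     + m ^+ 2)).
    by apply: eq_bigr => i _; ring.
  rewrite big_split /= sumrB -!mulr_sumr sumr_const card_ord -/m -[m *+ _]mulr_natl.
  by ring.
by rewrite pmulr_rge0 ?ltr0n// subr_ge0.
Qed.

Lemma weight_upd s k t : weight (upd s k t) <= weight s + t ^+ 2.
Proof.
rewrite /weight -addrA lerD2l (bigD1 k)//= [leRHS](_ : _ =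
   tnth s k ^+ 2 + (t ^+ 2 + \sum_(i < p | i != k) tnth s i ^+ 2)); last first.
  by rewrite (bigD1 k)//=; ring.
rewrite tnth_upd eqxx; apply: ler_wpDl; first exact: sqr_ge0.
rewrite lerD2l; apply: ler_sum => i ik.
by rewrite tnth_upd (negbTE ik).
Qed.

Lemma dominated_upd_integrable f s k : dominated 2 f ->
  mu.-integrable setT (EFin \o (fun t => f (upd s k t))).
Proof.
move=> [mf [C C0 fC]].
apply: (@mu_poly_integrable _ (C * (2 * weight s ^+ 2 + 2))).
  by apply: (measurableT_comp mf); exact: measurable_upd.
move=> t; apply: le_trans (fC _) _; rewrite -!mulrA ler_wpM2l//.
have w0 := weight_ge0 (upd s k t).
have := weight_upd s k t; set x := weight (upd s k t); set y := weight s => xy.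
have : x ^+ 2 <= (y + t ^+ 2) ^+ 2.
  by rewrite ler_sqr// ?nnegrE// (le_trans w0).
have -> : t ^+ 4 = (t ^+ 2) ^+ 2 by rewrite -exprM.
have := sqr_ge0 (y - t ^+ 2); have := sqr_ge0 (y * t ^+ 2).
have := sqr_ge0 t; set z := t ^+ 2; rewrite !expr2; nra.
Qed.

Lemma resampling_dominated f k : dominated 2 f ->
  nu.-integrable setT (EFin \o (fun s => \int[mu]_t f (upd s k t))) /\
  \int[nu]_s f s = \int[nu]_s \int[mu]_t f (upd s k t).
Proof.
move=> df; apply: resampling_integrable => //.
- exact: dominated_integrable.
- by move=> s; exact: dominated_upd_integrable.
Qed.

End DominatedFunctions.

(** * A smooth truncation of the sixth power *)

Section TwoPoint.
Context {R : realFieldType}.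
Implicit Types (L a d t : R).

(** Comparable to [t^4 min(1, t^2 / L)], and [psi] to [t^2 min(1, t^2 / L)]: integrable with fourth
    moments, yet of small mean when [L] is large. *)
Definition phi L t : R := t ^+ 6 / (L + t ^+ 2).
Definition psi L t : R := t ^+ 4 / (L + t ^+ 2).

Lemma denom_gt0 L t : 0 < L -> 0 < L + t ^+ 2.
Proof. by move=> L0; rewrite ltr_pwDl// sqr_ge0. Qed.

Lemma phi_ge0 L t : 0 < L -> 0 <= phi L t.
Proof.
move=> L0; rewrite divr_ge0//; first exact: exprn_even_ge0.
exact/ltW/denom_gt0.
Qed.

Lemma psi_ge0 L t : 0 < L -> 0 <= psi L t.
Proof.
move=> L0; rewrite divr_ge0//; first exact: exprn_even_ge0.
exact/ltW/denom_gt0.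
Qed.

Lemma phi_le L t : 0 < L -> phi L t <= t ^+ 4.
Proof.
move=> L0; rewrite /phi ler_pdivrMr; last exact: denom_gt0.
rewrite mulrDr -exprD lerDr mulr_ge0 ?exprn_even_ge0//; exact: ltW.
Qed.

Lemma psi_le L t : 0 < L -> psi L t <= t ^+ 2.
Proof.
move=> L0; rewrite /psi ler_pdivrMr; last exact: denom_gt0.
rewrite mulrDr -exprD lerDr mulr_ge0 ?sqr_ge0//; exact: ltW.
Qed.


(* With [s = a^2] and [s' = (a + d)^2], the map [s^3 / (L + s)] has the exact
   second-order remainder [(s' - s)^2 (1 - L^3 / ((L + s)^2 (L + s')))]. *)
Lemma phi_two_point L a d : 0 < L ->
  phi L (a + d) <= phi L a
    + 2 * a * (2 * a ^+ 2 - L + L ^+ 3 / (L + a ^+ 2) ^+ 2) * d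
    + 59 * d ^+ 2 * psi L a + 28 * phi L d.
Proof.
move=> L0.
have La := denom_gt0 a L0; have Ld := denom_gt0 d L0.
have Lad := denom_gt0 (a + d) L0.
set s := a ^+ 2 in La *; set v := d ^+ 2 in Ld *; set s' := (a + d) ^+ 2 in Lad *.
have s0 : 0 <= s by exact: sqr_ge0.
have v0 : 0 <= v by exact: sqr_ge0.
have s'0 : 0 <= s' by exact: sqr_ge0.
pose r := s / (L + s); pose rv := v / (L + v); pose r' := s' / (L + s').
have r0 : 0 <= r by rewrite divr_ge0// ltW.
have rv0 : 0 <= rv by rewrite divr_ge0// ltW.
have r'0 : 0 <= r' by rewrite divr_ge0// ltW.
have phia : phi L a = s ^+ 2 * r by rewrite /phi /r -/s /s; field; exact: lt0r_neq0.
have phid : phi L d = v ^+ 2 * rv by rewrite /phi /rv -/v /v; field; exact: lt0r_neq0.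
have psia : psi L a = s * r by rewrite /psi /r -/s /s; field; exact: lt0r_neq0.
(* Since [s^3 / (L + s) = s^2 - L s + L^2 - L^3 / (L + s)], [th] is the derivative in [s], and [kap]
   is the second divided difference that makes the expansion exact. *)
pose th := 2 * s - L + L ^+ 3 / (L + s) ^+ 2.
pose kap := 1 - L ^+ 3 / ((L + s) ^+ 2 * (L + s')).
have e1 : s' - s = 2 * a * d + v by rewrite /s' /s /v; ring.
have exact_ : phi L (a + d) = phi L a + th * (s' - s) + (s' - s) ^+ 2 * kap.
  have -> : phi L (a + d) = s' ^+ 3 / (L + s') by rewrite /phi /s' -exprM.
  have -> : phi L a = s ^+ 3 / (L + s) by rewrite /phi /s -exprM.
  rewrite /th /kap; field.
  by apply/andP; split; exact: lt0r_neq0.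
have th_le : th <= 3 * (s * r).
  rewrite -subr_ge0 (_ : _ - _ = s ^+ 3 / (L + s) ^+ 2).
    by rewrite divr_ge0 ?sqr_ge0// exprn_ge0.
  by rewrite /th /r; field; exact: lt0r_neq0.
have kap_le : kap <= 2 * r + r'.
  pose x := L / (L + s); pose z := L / (L + s').
  have -> : r = 1 - x by rewrite /r /x; field; exact: lt0r_neq0.
  have -> : r' = 1 - z by rewrite /r' /z; field; exact: lt0r_neq0.
  have -> : kap = 1 - x ^+ 2 * z.
    by rewrite /kap /x /z; field; apply/andP; split; exact: lt0r_neq0.
  have x0 : 0 <= x by rewrite divr_ge0// ltW.
  have z0 : 0 <= z by rewrite divr_ge0// ltW.
  have x1 : x <= 1 by rewrite ler_pdivrMr// mul1r lerDl.
  have z1 : z <= 1 by rewrite ler_pdivrMr// mul1r lerDl.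
  rewrite -subr_ge0 (_ : _ - _ = (1 - x) * ((1 - z) + (1 - x * z))); last by ring.
  rewrite mulr_ge0 ?subr_ge0//= addr_ge0 ?subr_ge0//.
  by rewrite mulr_ile1.
have s'_le : s' <= 2 * s + 2 * v.
  rewrite -subr_ge0 (_ : _ - _ = (a - d) ^+ 2) ?sqr_ge0//.
  by rewrite /s' /s /v; ring.
have r'_le : r' <= 2 * r + 2 * rv.
  apply: (@le_trans _ _ ((2 * s + 2 * v) / (L + (2 * s + 2 * v)))).
    rewrite /r' ler_pdivrMr// mulrAC ler_pdivlMr; nra.
  rewrite mulrDl; apply: lerD.
    rewrite /r mulrA ler_pdivrMr; last lra.
    rewrite mulrAC ler_pdivlMr//; nra.
  rewrite /rv mulrA ler_pdivrMr; last lra.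
  rewrite mulrAC ler_pdivlMr//; nra.
have e2 : (s' - s) ^+ 2 <= 8 * (s * v) + 2 * v ^+ 2.
  rewrite e1 -subr_ge0 (_ : _ - _ = (2 * a * d - v) ^+ 2) ?sqr_ge0//.
  by rewrite /s /v; ring.
(* Mixed products are bounded by pure ones according to which of [s] and [v] is larger, because
   [s / (L + s)] increases in [s]. *)
have cross1 : v * (s * rv) <= v * (s * r) + v * (v * rv).
  have [sv|vs] := leP s v.
    apply: ler_wpDl; first by apply: mulr_ge0 => //; exact: mulr_ge0.
    by apply: ler_wpM2l => //; apply: ler_wpM2r.
  apply: ler_wpDr; first by apply: mulr_ge0 => //; exact: mulr_ge0.
  apply: ler_wpM2l => //; apply: ler_wpM2l => //.
  rewrite /rv ler_pdivrMr// /r mulrAC ler_pdivlMr//; nra.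
have cross2 : v * (v * r) <= v * (s * r) + v * (v * rv).
  have [sv|vs] := leP v s.
    apply: ler_wpDr; first by apply: mulr_ge0 => //; exact: mulr_ge0.
    by apply: ler_wpM2l => //; apply: ler_wpM2r.
  apply: ler_wpDl; first by apply: mulr_ge0 => //; exact: mulr_ge0.
  apply: ler_wpM2l => //; apply: ler_wpM2l => //.
  rewrite /r ler_pdivrMr// /rv mulrAC ler_pdivlMr//; nra.
have kap_le2 : kap <= 4 * r + 2 * rv by lra.
have main : (s' - s) ^+ 2 * kap <= (8 * (s * v) + 2 * v ^+ 2) * (4 * r + 2 * rv).
  apply: (@le_trans _ _ ((s' - s) ^+ 2 * (4 * r + 2 * rv))).
    by apply: ler_wpM2l; rewrite ?sqr_ge0.
  by apply: ler_wpM2r; rewrite // addr_ge0// mulr_ge0.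
have thv : th * v <= 3 * (s * r) * v by apply: ler_wpM2r.
rewrite exact_ psia phid e1 mulrDr -/th -e1.
have -> : 2 * a * th * d = th * (2 * a * d) by ring.
have -> : 59 * v * (s * r) = 59 * (v * (s * r)) by ring.
have -> : 28 * (v ^+ 2 * rv) = 28 * (v * (v * rv)) by ring.
(* Origin of the constants: [59 = 32 + 16 + 8 + 3], the last from [th * v], and [28 = 4 + 16 + 8],
   with 16 and 8 coming from the two cross terms. *)
have E : (8 * (s * v) + 2 * v ^+ 2) * (4 * r + 2 * rv) =
  32 * (v * (s * r)) + 16 * (v * (s * rv)) + 8 * (v * (v * r)) + 4 * (v * (v * rv)).
  by ring.
have E2 : 3 * (s * r) * v = 3 * (v * (s * r)) by ring.
lra.
Qed.

(** One factor [c^2] is kept outside so that the bounds for single coordinates add up to a squared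
    norm; the remaining homogeneity is absorbed in [B]. *)
Lemma phi_scale L B c t : 0 < L -> 1 <= B -> c ^+ 2 <= B ^+ 2 ->
  phi L (c * t) <= c ^+ 2 * B ^+ 4 * phi L t.
Proof.
move=> L0 B1 cB; have B0 : 0 <= B by exact: le_trans B1.
have Lt := denom_gt0 t L0; have Lct := denom_gt0 (c * t) L0.
have B2 : 1 <= B ^+ 2 by exact: exprn_ege1.
rewrite /phi ler_pdivrMr// [leRHS](_ : _ =
  c ^+ 2 * t ^+ 6 * ((B ^+ 2) ^+ 2 * (L + (c * t) ^+ 2)) / (L + t ^+ 2)); last by ring.
rewrite ler_pdivlMr// [leLHS](_ : _ =
  c ^+ 2 * t ^+ 6 * ((c ^+ 2) ^+ 2 * (L + t ^+ 2))); last by ring.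
apply: ler_wpM2l; first by rewrite mulr_ge0 ?sqr_ge0// exprn_even_ge0.
rewrite exprMn; move: cB B2; set x := c ^+ 2; set y := B ^+ 2; set s := t ^+ 2.
have x0 : 0 <= x by exact: sqr_ge0.
have s0 : 0 <= s by exact: sqr_ge0.
move=> xy y1; have y0 : 0 <= y by lra.
have A1 : x ^+ 2 <= y ^+ 2 by rewrite ler_sqr.
have A2 : x ^+ 2 <= y ^+ 2 * x.
  rewrite expr2 ler_wpM2r//; nra.
rewrite !mulrDr; apply: lerD; first by rewrite ler_wpM2r// ltW.
by apply: (le_trans (ler_wpM2r s0 A2)); rewrite -mulrA [(c * t) ^+ 2]exprMn.
Qed.

End TwoPoint.

Section RowMoments.
Context {R : realType} {p : nat}.
Variables (mu : probability R R) (nu : probability (p.-tuple R) R).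
Hypothesis nu_iid : iid_law nu mu.
Hypothesis mu4 : mu.-integrable setT (EFin \o (fun t : R => t ^+ 4)).
Hypothesis mu_mean : \int[mu]_t t = 0.
Hypothesis mu_var : \int[mu]_t (t ^+ 2) = 1.
Implicit Types (u s : p.-tuple R) (c : 'cV[R]_p) (j k : 'I_p).

Definition m4 : R := \int[mu]_t (t ^+ 4).

Lemma m4_ge0 : 0 <= m4.
Proof. by apply: Rintegral_ge0 => t _; exact: exprn_even_ge0. Qed.

Lemma mu1_integrable : mu.-integrable setT (EFin \o (fun t : R => t)).
Proof.
apply: (mu_poly_integrable mu4 (C := 1)) => // t.
have := sqr_ge0 (t ^+ 2 - 1); have := sqr_ge0 (t - 1); have := sqr_ge0 (t + 1).
rewrite ler_norml (_ : t ^+ 4 = (t ^+ 2) ^+ 2); last by rewrite -exprM.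
by rewrite !expr2 => *; apply/andP; split; nra.
Qed.

Lemma mu2_integrable : mu.-integrable setT (EFin \o (fun t : R => t ^+ 2)).
Proof.
apply: (mu_poly_integrable mu4 (C := 1)) => [|t]; first exact: measurable_funX.
have := sqr_ge0 (t ^+ 2 - 1).
rewrite ger0_norm ?sqr_ge0// (_ : t ^+ 4 = (t ^+ 2) ^+ 2); last by rewrite -exprM.
have := sqr_ge0 (t ^+ 2); rewrite !expr2; nra.
Qed.

(** Integrating out one entry: mean zero removes the linear term for each fixed [u], so [B] leaves
    no trace, and unit variance turns [t^2] into [1]. All moment bounds for linear and quadratic
    forms are iterations of this step. *)
Lemma row_step_le (F A C : p.-tuple R -> R) (B : p.-tuple R -> R) (h : R -> R) k :
  dominated 2 F -> dominated 2 A -> dominated 2 C ->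
  mu.-integrable setT (EFin \o h) ->
  (forall u t, F (upd u k t) <= A u + B u * t + C u * t ^+ 2 + h t) ->
  \int[nu]_u F u <= \int[nu]_u A u + \int[nu]_u C u + \int[mu]_t h t.
Proof.
move=> dF dA dC ih FABC.
have [iF ->] := resampling_dominated nu_iid mu4 k dF.
have iA := dominated_integrable nu_iid mu4 dA.
have iC := dominated_integrable nu_iid mu4 dC.
set H := \int[mu]_t h t.
have icH : nu.-integrable setT (EFin \o (fun=> H)).
  by apply: bounded_integrable; exact: bounded_measurable_cst.
rewrite -[H](Rintegral_prob_cst nu) -RintegralD// -RintegralD//; last first.
  exact: integrableD_real.
apply: le_Rintegral => //.
  by do 2 apply: integrableD_real => //.
move=> u _.
have i1 (b : R) : mu.-integrable setT (EFin \o (fun t => b * t)).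
  by apply: integrableZl_real; exact: mu1_integrable.
have i2 (b : R) : mu.-integrable setT (EFin \o (fun t => b * t ^+ 2)).
  by apply: integrableZl_real; exact: mu2_integrable.
have i0 (b : R) : mu.-integrable setT (EFin \o (fun=> b)).
  by apply: bounded_integrable; exact: bounded_measurable_cst.
apply: (@le_trans _ _ (\int[mu]_t (A u + B u * t + C u * t ^+ 2 + h t))).
  apply: le_Rintegral => //; first exact: dominated_upd_integrable.
  by do 3 (apply: integrableD_real => //).
rewrite RintegralD//; last by do 2 (apply: integrableD_real => //).
rewrite RintegralD//; last exact: integrableD_real.
rewrite RintegralD// !RintegralZl//; [|exact: mu2_integrable|exact: mu1_integrable].
by rewrite mu_mean mu_var mulr0 mulr1 addr0 Rintegral_prob_cst.
Qed.

Lemma row_step_eq (F A C : p.-tuple R -> R) (B : p.-tuple R -> R) k :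
  dominated 2 F -> dominated 2 A -> dominated 2 C ->
  (forall u t, F (upd u k t) = A u + B u * t + C u * t ^+ 2) ->
  \int[nu]_u F u = \int[nu]_u A u + \int[nu]_u C u.
Proof.
move=> dF dA dC FABC.
have i0 : mu.-integrable setT (EFin \o (fun=> 0)).
  by apply: bounded_integrable; exact: bounded_measurable_cst.
have int_opp G : dominated 2 G -> \int[nu]_u (-1 * G u) = - (\int[nu]_u G u).
  by move=> dG; rewrite RintegralZl ?mulN1r//; exact: (dominated_integrable nu_iid).
have le1 : \int[nu]_u F u <= \int[nu]_u A u + \int[nu]_u C u + \int[mu]_t 0.
  by apply: (@row_step_le F A C B (fun=> 0) k) => // u t; rewrite FABC addr0.
have := @row_step_le (fun u => -1 * F u) (fun u => -1 * A u) (fun u => -1 * C u)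
  (fun u => -1 * B u) (fun=> 0) k (dominatedZ _ dF) (dominatedZ _ dA)
  (dominatedZ _ dC) i0.
rewrite !int_opp// !Rintegral_prob_cst in le1 * => le2.
apply/eqP; rewrite eq_le -{1}[leRHS]addr0 le1/=.
suff : - (\int[nu]_u F u) <= - (\int[nu]_u A u) + - (\int[nu]_u C u) + 0 by lra.
by apply: le2 => u t; rewrite FABC addr0 le_eqVlt; apply/orP; left; apply/eqP; ring.
Qed.

(** Truncating to the first [m] coordinates lets moments be computed by induction on [m], one entry
    being integrated out at a time. *)
Definition lin (m : nat) c u : R := \sum_(i < p | (i < m)%N) tnth u i * c i 0.
Definition sqsum (m : nat) c : R := \sum_(i < p | (i < m)%N) c i 0 ^+ 2.

Lemma sum_ltnS (F : 'I_p -> R) k :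
  \sum_(i < p | (i < k.+1)%N) F i = \sum_(i < p | (i < k)%N) F i + F k.
Proof.
rewrite (bigD1 k)//= addrC; congr (_ + _); apply: eq_bigl => i.
by rewrite ltnS -val_eqE /=; case: ltngtP.
Qed.

Lemma sum_ltn_full (F : 'I_p -> R) : \sum_(i < p | (i < p)%N) F i = \sum_i F i.
Proof. by apply: eq_bigl => i; rewrite ltn_ord. Qed.

Lemma lin_dotp c u : lin p c u = dotp u c.
Proof. exact: sum_ltn_full. Qed.

Lemma sqsum_sqnorm2 c : sqsum p c = sqnorm2 c.
Proof. exact: sum_ltn_full. Qed.

Lemma sqsum_ge0 m c : 0 <= sqsum m c.
Proof. by apply: sumr_ge0 => i _; exact: sqr_ge0. Qed.

Lemma lin_upd k c u t : lin k c (upd u k t) = lin k c u.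
Proof.
apply: eq_bigr => i ik; rewrite tnth_upd; case: eqP => // ik'.
by rewrite ik' ltnn in ik.
Qed.

Lemma lin_updS k c u t : lin k.+1 c (upd u k t) = lin k c u + c k 0 * t.
Proof.
rewrite {1}/lin sum_ltnS tnth_upd eqxx [X in _ + X]mulrC; congr (_ + _).
exact: lin_upd.
Qed.

Lemma dominated_lin m c : dominated 1 (lin m c).
Proof.
apply: dominated_sum => i; under eq_fun do rewrite mulrC.
by apply: dominatedZ; exact: dominated_coord.
Qed.

Lemma dominated_lin_sqr m c : dominated 1 (fun u => lin m c u ^+ 2).
Proof.
rewrite (_ : (fun u => _) = (fun u => \sum_(i < p | (i < m)%N)
    \sum_(j < p | (j < m)%N) (c i 0 * c j 0) * (tnth u i * tnth u j))).
  do 2 (apply: dominated_sum => ?); apply: dominatedZ.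
  exact: dominated_coordM.
apply/funext => u; rewrite expr2 /lin mulr_suml; apply: eq_bigr => i _.
by rewrite mulr_sumr; apply: eq_bigr => j _; ring.
Qed.

Lemma lin_moment2 m c : (m <= p)%N -> \int[nu]_u (lin m c u ^+ 2) = sqsum m c.
Proof.
elim: m => [_|m IH mp].
  rewrite /sqsum big_pred0// -[RHS](Rintegral_prob_cst nu).
  by apply: eq_Rintegral => u _; rewrite /lin big_pred0// expr0n.
pose k := Ordinal mp.
rewrite (row_step_eq (k := k) (A := fun u => lin k c u ^+ 2)
    (B := fun u => 2 * lin k c u * c k 0) (C := fun=> c k 0 ^+ 2)).
- rewrite [lin k]/lin /= -/(lin m c) IH; last exact: ltnW.
  rewrite Rintegral_prob_cst [RHS](sum_ltnS (fun i => c i 0 ^+ 2) k).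
  by [].
- by apply: dominatedW; exact: dominated_lin_sqr.
- by apply: dominatedW; exact: dominated_lin_sqr.
- exact: dominated_cst.
by move=> u t; rewrite (lin_updS k); ring.
Qed.

(** The same completion of squares as in the concentration step removes the term in [t^3], hence
    third moments of the entries. A new coordinate with [e = c_k^2] adds [8 e q + 3 m4 e^2], less
    than the growth of [(4 + 3 m4) q^2] when [q] becomes [q + e]. *)
Lemma lin_moment4 m c : (m <= p)%N ->
  \int[nu]_u (lin m c u ^+ 4) <= (4 + 3 * m4) * sqsum m c ^+ 2.
Proof.
have d4 m' : dominated 2 (fun u => lin m' c u ^+ 4).
  under eq_fun do rewrite (exprM _ 2 2) expr2.
  by apply: dominatedM; exact: dominated_lin_sqr.
elim: m => [_|m IH mp].
  rewrite (_ : \int[nu]_u _ = 0).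
    by rewrite mulr_ge0 ?sqr_ge0// addr_ge0// mulr_ge0// m4_ge0.
  rewrite -[RHS](Rintegral_prob_cst nu).
  by apply: eq_Rintegral => u _; rewrite /lin big_pred0// expr0n.
pose k := Ordinal mp.
have := @row_step_le (fun u => lin k.+1 c u ^+ 4) (fun u => lin k c u ^+ 4)
  (fun u => (8 * c k 0 ^+ 2) * lin k c u ^+ 2)
  (fun u => 4 * lin k c u ^+ 3 * c k 0) (fun t => (3 * c k 0 ^+ 4) * t ^+ 4) k
  (d4 _) (d4 _) (dominatedZ _ (dominatedW (dominated_lin_sqr _ _)))
  (integrableZl_real _ mu4).
have point u t : lin k.+1 c (upd u k t) ^+ 4 <= lin k c u ^+ 4
    + 4 * lin k c u ^+ 3 * c k 0 * t + 8 * c k 0 ^+ 2 * lin k c u ^+ 2 * t ^+ 2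
    + 3 * c k 0 ^+ 4 * t ^+ 4.
  rewrite lin_updS; set a := lin k c u; set b := c k 0.
  rewrite -subr_ge0 (_ : _ - _ = 2 * (b * t * (a - b * t)) ^+ 2); last by ring.
  by rewrite mulr_ge0// sqr_ge0.
move=> /(_ point) H; apply: le_trans H _.
rewrite RintegralZl//; last first.
  apply: (dominated_integrable nu_iid mu4).
  by apply: dominatedW; exact: dominated_lin_sqr.
rewrite RintegralZl// (lin_moment2 _ (ltnW mp)) -/m4.
have := IH (ltnW mp).
have -> : sqsum m.+1 c = sqsum m c + c k 0 ^+ 2.
  exact: (sum_ltnS (fun i => c i 0 ^+ 2) k).
rewrite (_ : c k 0 ^+ 4 = (c k 0 ^+ 2) ^+ 2); last by rewrite -exprM.
have := sqsum_ge0 m c; have := sqr_ge0 (c k 0); have := m4_ge0.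
set q := sqsum m c; set e := c k 0 ^+ 2; set K := m4 => K0 e0 q0 H.
have -> : (4 + 3 * K) * (q + e) ^+ 2 = (4 + 3 * K) * q ^+ 2 + 8 * (e * q) +
  6 * (K * (e * q)) + 4 * e ^+ 2 + 3 * (e ^+ 2 * K) by ring.
have : 0 <= K * (e * q) by apply: mulr_ge0 => //; exact: mulr_ge0.
have := sqr_ge0 e.
have -> : 3 * e ^+ 2 * K = 3 * (e ^+ 2 * K) by ring.
have -> : 8 * e * q = 8 * (e * q) by ring.
rewrite [lin k]/lin /= -/(lin m c).
by move=> *; lra.
Qed.

Lemma measurable_phi L (f : p.-tuple R -> R) : 0 < L ->
  measurable_fun setT f -> measurable_fun setT (fun u => phi L (f u)).
Proof.
move=> L0 mf; apply: measurable_funM; first exact: measurable_funX.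
apply: measurable_fun_inv; first by move=> u; exact/ltW/denom_gt0.
by apply: measurable_funD => //; exact: measurable_funX.
Qed.

Lemma dominated_phi_lin L m c : 0 < L -> dominated 2 (fun u => phi L (lin m c u)).
Proof.
move=> L0; have ml : measurable_fun setT (lin m c) by case: (dominated_lin m c).
apply: (@dominated_le _ _ 2 _ (fun u => lin m c u ^+ 2 * lin m c u ^+ 2)).
- exact: measurable_phi.
- by apply: dominatedM; exact: dominated_lin_sqr.
by move=> u; rewrite ger0_norm ?phi_ge0// -exprD phi_le.
Qed.

Lemma dominated_psi_lin L m c : 0 < L -> dominated 2 (fun u => psi L (lin m c u)).
Proof.
move=> L0; have ml : measurable_fun setT (lin m c) by case: (dominated_lin m c).
apply: (@dominated_le _ _ 2 _ (fun u => lin m c u ^+ 2)).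
- apply: measurable_funM; first exact: measurable_funX.
  apply: measurable_fun_inv; first by move=> u; exact/ltW/denom_gt0.
  by apply: measurable_funD => //; exact: measurable_funX.
- by apply: dominatedW; exact: dominated_lin_sqr.
by move=> u; rewrite ger0_norm ?psi_ge0// psi_le.
Qed.

Lemma mu_phi_integrable L : 0 < L -> mu.-integrable setT (EFin \o phi L).
Proof.
move=> L0; apply: (mu_poly_integrable mu4 (C := 1)) => [|t].
  apply: measurable_funM; first exact: measurable_funX.
  apply: measurable_fun_inv; first by move=> u; exact/ltW/denom_gt0.
  by apply: measurable_funD => //; exact: measurable_funX.
by rewrite ger0_norm ?phi_ge0// mul1r (le_trans (phi_le _ L0))// lerDr.
Qed.

(** The bound is free of the dimension. By [phi_two_point], coordinate [k] adds [c_k^2] times a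
    fixed amount: the mean of [psi] of the earlier partial sum, at most a fourth moment divided by
    [L], and the mean of [phi] of a single entry. *)
Lemma lin_phi_moment L B m c : 0 < L -> 1 <= B -> sqnorm2 c <= B ^+ 2 ->
  (m <= p)%N ->
  \int[nu]_u phi L (lin m c u) <=
  sqsum m c * (59 * ((4 + 3 * m4) * B ^+ 4 / L) + 28 * B ^+ 4 * \int[mu]_t phi L t).
Proof.
move=> L0 B1 cB; have B0 : 0 <= B by exact: le_trans B1.
set I := \int[mu]_t phi L t.
have sq_le m' : sqsum m' c <= B ^+ 2.
  apply: le_trans cB; rewrite -sqsum_sqnorm2 /sqsum [leRHS]sum_ltn_full.
  rewrite [leRHS](bigID (fun i : 'I_p => (i < m')%N))/= lerDl.
  by apply: sumr_ge0 => i _; exact: sqr_ge0.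
elim: m => [_|m IH mp].
  rewrite {1}/sqsum big_pred0// mul0r le_eqVlt; apply/orP; left; apply/eqP.
  rewrite -[RHS](Rintegral_prob_cst nu); apply: eq_Rintegral => u _.
  by rewrite /lin big_pred0// /phi expr0n mul0r.
pose k := Ordinal mp.
have := @row_step_le (fun u => phi L (lin k.+1 c u)) (fun u => phi L (lin k c u))
  (fun u => (59 * c k 0 ^+ 2) * psi L (lin k c u))
  (fun u => 2 * lin k c u * (2 * lin k c u ^+ 2 - L
     + L ^+ 3 / (L + lin k c u ^+ 2) ^+ 2) * c k 0)
  (fun t => (28 * (c k 0 ^+ 2 * B ^+ 4)) * phi L t) k
  (dominated_phi_lin _ _ L0) (dominated_phi_lin _ _ L0)
  (dominatedZ _ (dominated_psi_lin _ _ L0))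
  (integrableZl_real _ (mu_phi_integrable L0)).
have point u t : phi L (lin k.+1 c (upd u k t)) <= phi L (lin k c u)
    + 2 * lin k c u * (2 * lin k c u ^+ 2 - L
     + L ^+ 3 / (L + lin k c u ^+ 2) ^+ 2) * c k 0 * t
    + 59 * c k 0 ^+ 2 * psi L (lin k c u) * t ^+ 2
    + 28 * (c k 0 ^+ 2 * B ^+ 4) * phi L t.
  rewrite lin_updS; apply: le_trans (phi_two_point _ _ L0) _.
  have -> : 59 * (c k 0 * t) ^+ 2 * psi L (lin k c u) =
    59 * c k 0 ^+ 2 * psi L (lin k c u) * t ^+ 2 by ring.
  apply: lerD; first by rewrite lerD2r lerD2l mulrA.
  rewrite -[leRHS]mulrA ler_wpM2l//.
  apply: phi_scale => //; apply: le_trans (sq_le k.+1).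
  rewrite /sqsum sum_ltnS lerDr.
  by apply: sumr_ge0 => i _; exact: sqr_ge0.
move=> /(_ point) H; apply: le_trans H _.
have ip : nu.-integrable setT (EFin \o (fun u => psi L (lin k c u))).
  by apply: (dominated_integrable nu_iid mu4); exact: dominated_psi_lin.
rewrite RintegralZl// RintegralZl//; last exact: mu_phi_integrable.
rewrite -/I.
have psi_int : \int[nu]_u psi L (lin k c u) <= (4 + 3 * m4) * B ^+ 4 / L.
  have d4 : dominated 2 (fun u => lin k c u ^+ 4).
    under eq_fun do rewrite (exprM _ 2 2) expr2.
    by apply: dominatedM; exact: dominated_lin_sqr.
  apply: (@le_trans _ _ (\int[nu]_u (L^-1 * lin k c u ^+ 4))).
    apply: le_Rintegral => //.
      by apply: integrableZl_real; exact: (dominated_integrable nu_iid mu4).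
    move=> u _; rewrite /psi mulrC ler_wpM2r ?exprn_even_ge0//.
    by rewrite lef_pV2 ?posrE ?denom_gt0// lerDl sqr_ge0.
  rewrite RintegralZl//; last exact: (dominated_integrable nu_iid mu4).
  rewrite mulrC ler_wpM2r ?invr_ge0 ?(ltW L0)//.
  apply: le_trans (lin_moment4 _ (ltnW mp)) _.
  apply: ler_wpM2l; first by rewrite addr_ge0// mulr_ge0// m4_ge0.
  rewrite (_ : B ^+ 4 = (B ^+ 2) ^+ 2); last by rewrite -exprM.
  by rewrite ler_sqr ?nnegrE ?sqsum_ge0 ?sqr_ge0.
have -> : sqsum m.+1 c = sqsum m c + c k 0 ^+ 2.
  exact: (sum_ltnS (fun i => c i 0 ^+ 2) k).
have := IH (ltnW mp).
have := ler_wpM2l (sqr_ge0 (c k 0)) psi_int.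
rewrite [lin k]/lin /= -/(lin m c).
set Q := sqsum m c; set e := c k 0 ^+ 2; set X := (4 + 3 * m4) * B ^+ 4 / L.
set Y := B ^+ 4; set J := Rintegral _ _ _; set J2 := Rintegral _ _ _ => H1 H2.
have -> : (Q + e) * (59 * X + 28 * Y * I) =
  Q * (59 * X + 28 * Y * I) + 59 * (e * X) + 28 * (e * Y) * I by ring.
have -> : 59 * e * J = 59 * (e * J) by ring.
by lra.
Qed.

End RowMoments.

Section QuadraticForms.
Context {R : realType} {p : nat}.
Variables (mu : probability R R) (nu : probability (p.-tuple R) R).
Hypothesis nu_iid : iid_law nu mu.
Hypothesis mu4 : mu.-integrable setT (EFin \o (fun t : R => t ^+ 4)).
Hypothesis mu_mean : \int[mu]_t t = 0.
Hypothesis mu_var : \int[mu]_t (t ^+ 2) = 1.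
Implicit Types (u s : p.-tuple R) (b c : 'cV[R]_p) (A : 'M[R]_p).

Lemma dominated_dotp c : dominated 1 (fun u => dotp u c).
Proof.
rewrite (_ : (fun u => _) = lin p c); first exact: dominated_lin.
by apply/funext => u; rewrite lin_dotp.
Qed.

Lemma dominated_dotp_sqr c : dominated 1 (fun u => dotp u c ^+ 2).
Proof.
rewrite (_ : (fun u => _) = fun u => lin p c u ^+ 2); first exact: dominated_lin_sqr.
by apply/funext => u; rewrite lin_dotp.
Qed.

Lemma dotp_moment2 c : \int[nu]_u (dotp u c ^+ 2) = sqnorm2 c.
Proof.
rewrite -sqsum_sqnorm2 -(lin_moment2 nu_iid mu4 mu_mean mu_var)//.
by apply: eq_Rintegral => u _; rewrite lin_dotp.
Qed.

Lemma dotp_moment4 c :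
  \int[nu]_u (dotp u c ^+ 4) <= (4 + 3 * m4 mu) * sqnorm2 c ^+ 2.
Proof.
rewrite -sqsum_sqnorm2.
apply: le_trans (lin_moment4 nu_iid mu4 mu_mean mu_var _ (leqnn p)).
by apply/le_eq/eq_Rintegral => u _; rewrite lin_dotp.
Qed.

Lemma dotp_phi_moment L B c : 0 < L -> 1 <= B -> sqnorm2 c <= B ^+ 2 ->
  \int[nu]_u phi L (dotp u c) <=
  B ^+ 2 * (59 * ((4 + 3 * m4 mu) * B ^+ 4 / L) + 28 * B ^+ 4 * \int[mu]_t phi L t).
Proof.
move=> L0 B1 cB.
have := lin_phi_moment nu_iid mu4 mu_mean mu_var L0 B1 cB (leqnn p).
under eq_Rintegral do rewrite lin_dotp.
move=> H; apply: le_trans H _; rewrite sqsum_sqnorm2 ler_wpM2r//.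
have B0 : 0 <= B by exact: le_trans B1.
have m0 := m4_ge0 mu.
apply: addr_ge0; apply: mulr_ge0 => //.
- by rewrite divr_ge0 ?(ltW L0)// mulr_ge0 ?exprn_ge0// addr_ge0// mulr_ge0.
- by rewrite mulr_ge0// exprn_ge0.
- by apply: Rintegral_ge0 => t _; exact: phi_ge0.
Qed.

Lemma dotpD u b c : dotp u (b + c) = dotp u b + dotp u c.
Proof. by rewrite /dotp -big_split; apply: eq_bigr => j _; rewrite mxE mulrDr. Qed.

Lemma dotpN u c : dotp u (- c) = - dotp u c.
Proof. by rewrite /dotp -sumrN; apply: eq_bigr => j _; rewrite mxE mulrN. Qed.

Lemma dotp_bilin b c :
  \int[nu]_u (dotp u b * dotp u c) = \sum_j b j 0 * c j 0.
Proof.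
have i2 e : nu.-integrable setT (EFin \o (fun u => dotp u e ^+ 2)).
  by apply: (dominated_integrable nu_iid mu4); apply: dominatedW; exact: dominated_dotp_sqr.
transitivity (\int[nu]_u (4^-1 * (dotp u (b + c) ^+ 2 - dotp u (b - c) ^+ 2))).
  by apply: eq_Rintegral => u _; rewrite !dotpD dotpN; field.
rewrite RintegralZl//; last exact: integrableB_real.
rewrite RintegralB// !dotp_moment2 /sqnorm2 -sumrB mulr_sumr.
by apply: eq_bigr => j _; rewrite !mxE; field.
Qed.

Definition quadp A u : R := \sum_i \sum_j tnth u i * A i j * tnth u j.

(** The centred quadratic form in martingale shape: the diagonal with its mean removed, plus twice
    the strictly lower triangle, each entry multiplying a linear form in the preceding ones. *)
Let qpart A (m : nat) u : R := \sum_(i < p | (i < m)%N)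
  (A i i * (tnth u i ^+ 2 - 1) + 2 * tnth u i * lin i (col i A) u).

Lemma dominated_qpart A m : dominated 1 (qpart A m).
Proof.
apply: dominated_sum => i; apply: dominatedD.
  apply: dominatedZ; apply: dominatedB; last exact: dominated_cst.
  exact: (dominated_coordM i i).
rewrite (_ : (fun u => _) = (fun u => \sum_(l < p | (l < i)%N)
    (2 * col i A l 0) * (tnth u i * tnth u l))).
  by apply: dominated_sum => l; apply: dominatedZ; exact: dominated_coordM.
apply/funext => u; rewrite /lin mulr_sumr; apply: eq_bigr => l _; ring.
Qed.

(** Coordinate [k] adds [a (t^2 - 1) + 2 t l], where [l] depends only on earlier entries. Its square
    is bounded by twice the sum of the two squares, which avoids third moments; the terms [-2 a S]
    and [2 a S] come from the cross product with the earlier sum and cancel after integration. *)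
Lemma qpart_moment2 A m : (m <= p)%N ->
  \int[nu]_u (qpart A m u ^+ 2) <=
  (10 + 2 * m4 mu) * \sum_(i < p | (i < m)%N) \sum_j A j i ^+ 2.
Proof.
elim: m => [_|m IH mp].
  rewrite big_pred0// mulr0; apply/le_eq.
  rewrite -[RHS](Rintegral_prob_cst nu); apply: eq_Rintegral => u _.
  by rewrite /qpart big_pred0// expr0n.
pose k := Ordinal mp.
have dS := dominated_qpart A.
pose a := A k k; pose S := qpart A k; pose Lk := lin k (col k A).
have dL : dominated 2 (fun u => Lk u ^+ 2).
  by apply: dominatedW; exact: dominated_lin_sqr.
have dSS m' : dominated 2 (fun u => qpart A m' u ^+ 2).
  exact: dominatedM (dS m') (dS m').
have dS2 : dominated 2 S by exact: dominatedW (dS k).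
have qS u t : qpart A k.+1 (upd u k t) = S u + a * (t ^+ 2 - 1) + 2 * t * Lk u.
  rewrite /qpart sum_ltnS tnth_upd eqxx -addrA; congr (_ + (_ + _)).
    apply: eq_bigr => i ik; have ik' : (i == k) = false.
      by apply/eqP => ik'; rewrite ik' ltnn in ik.
    rewrite !tnth_upd ik'; congr (_ + _ * _); apply: eq_bigr => l li.
    rewrite tnth_upd; case: eqP => // lk.
    by rewrite lk in li; have := ltn_trans ik li; rewrite ltnn.
  by rewrite lin_upd.
have := @row_step_le _ _ mu nu nu_iid mu4 mu_mean mu_var
  (fun u => qpart A k.+1 u ^+ 2)
  (fun u => S u ^+ 2 + (-2 * a) * S u + 2 * a ^+ 2)
  (fun u => 8 * Lk u ^+ 2 + (2 * a) * S u)
  (fun u => 4 * S u * Lk u) (fun t => (2 * a ^+ 2) * t ^+ 4) k (dSS _)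
  (dominatedD (dominatedD (dSS _) (dominatedZ _ dS2)) (dominated_cst 2 _))
  (dominatedD (dominatedZ _ dL) (dominatedZ _ dS2)) (integrableZl_real _ mu4).
have point u t : qpart A k.+1 (upd u k t) ^+ 2 <=
    S u ^+ 2 + -2 * a * S u + 2 * a ^+ 2 + 4 * S u * Lk u * t
    + (8 * Lk u ^+ 2 + 2 * a * S u) * t ^+ 2 + 2 * a ^+ 2 * t ^+ 4.
  rewrite qS; set x := S u; set l := Lk u.
  rewrite -subr_ge0 (_ : _ - _ = (2 * t * l - a * (t ^+ 2 - 1)) ^+ 2
     + 4 * (a * t) ^+ 2); last by ring.
  by apply: addr_ge0; [exact: sqr_ge0|rewrite mulr_ge0// sqr_ge0].
move=> /(_ point) H; apply: le_trans H _.
have intd f : dominated 2 f -> nu.-integrable setT (EFin \o f).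
  exact: (dominated_integrable nu_iid mu4).
have iSS : nu.-integrable setT (EFin \o (fun u => S u ^+ 2)) by apply: intd; exact: dSS.
have iS : nu.-integrable setT (EFin \o S) by exact: intd.
have iL : nu.-integrable setT (EFin \o (fun u => Lk u ^+ 2)) by exact: intd.
have ic (e : R) : nu.-integrable setT (EFin \o (fun=> e)).
  by apply: intd; exact: dominated_cst.
rewrite RintegralD//; last by apply: integrableD_real => //; exact: integrableZl_real.
rewrite RintegralD//; last exact: integrableZl_real.
rewrite RintegralD//; [|exact: integrableZl_real|exact: integrableZl_real].
rewrite !RintegralZl// Rintegral_prob_cst (lin_moment2 nu_iid mu4 mu_mean mu_var _ (ltnW mp)).
rewrite (sum_ltnS (fun i => \sum_j A j i ^+ 2) k) mulrDr -/(m4 mu).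
have := IH (ltnW mp); rewrite -/S.
have : a ^+ 2 + sqsum k (col k A) <= \sum_j A j k ^+ 2.
  rewrite addrC -[a ^+ 2]/((fun j : 'I_p => A j k ^+ 2) k).
  rewrite /sqsum (eq_bigr (fun j => A j k ^+ 2)); last by move=> j _; rewrite mxE.
  rewrite -sum_ltnS [leRHS](bigID (fun i : 'I_p => (i < k.+1)%N))/= lerDl.
  by apply: sumr_ge0 => i _; exact: sqr_ge0.
have := m4_ge0 mu; have := sqr_ge0 a; have := sqsum_ge0 k (col k A).
set q := sqsum _ _; set a2 := a ^+ 2; set K := m4 mu; set N := \sum_j _.
set X := Rintegral nu setT S; set Y := Rintegral nu setT _.
move=> q0 a0 K0 H H2.
have KN : K * (a2 + q) <= K * N by exact: ler_wpM2l.
have Kq : 0 <= K * q by exact: mulr_ge0.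
have -> : 2 * a2 * K = 2 * (K * a2) by ring.
have -> : (10 + 2 * K) * N = 10 * N + 2 * (K * N) by ring.
rewrite mulrDr in KN; rewrite -[a * a]/a2.
rewrite -[\sum_(i < p | (i < k)%N) _]/(\sum_(i < p | (i < m)%N) _).
by lra.
Qed.

Lemma quadp_variance A : A^T = A ->
  \int[nu]_u ((quadp A u - \tr A) ^+ 2) <=
  (10 + 2 * m4 mu) * \sum_i \sum_j A i j ^+ 2.
Proof.
move=> As; have Asym i j : A i j = A j i by rewrite -{1}As mxE.
have := qpart_moment2 A (leqnn p); rewrite sum_ltn_full exchange_big/=.
move=> H; apply: le_trans H; apply/le_eq/eq_Rintegral => u _; congr (_ ^+ 2).
rewrite /qpart sum_ltn_full big_split/=.
pose F i j := tnth u i * A i j * tnth u j.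
have E1 i : \sum_j F i j = F i i + \sum_(j < p | (j < i)%N) F i j
    + \sum_(j < p | (i < j)%N) F i j.
  rewrite (bigD1 i)//= -addrA; congr (_ + _).
  rewrite (bigID (fun j : 'I_p => (j < i)%N))/=; congr (_ + _).
    by apply: eq_bigl => j; rewrite -val_eqE /=; case: ltngtP.
  by apply: eq_bigl => j; rewrite -val_eqE /=; case: ltngtP.
rewrite /quadp (eq_bigr _ (fun i _ => E1 i)) !big_split/=.
have -> : \sum_(i < p) \sum_(j < p | (i < j)%N) F i j =
    \sum_(i < p) \sum_(j < p | (j < i)%N) F i j.
  rewrite (exchange_big_dep xpredT)//=; apply: eq_bigr => i _.
  by apply: eq_bigr => j _; rewrite /F (Asym j i); ring.
have -> : \sum_(i < p) 2 * tnth u i * lin i (col i A) u =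
   2 * \sum_(i < p) \sum_(j < p | (j < i)%N) F i j.
  rewrite mulr_sumr; apply: eq_bigr => i _; rewrite /lin !mulr_sumr.
  by apply: eq_bigr => j _; rewrite mxE /F (Asym j i); ring.
have -> : \sum_i A i i * (tnth u i ^+ 2 - 1) = \sum_i F i i - \tr A.
  by rewrite /mxtrace -sumrB; apply: eq_bigr => i _; rewrite /F; ring.
ring.
Qed.

End QuadraticForms.

(** * Resolvents and rank-one perturbations *)

Section InnerProduct.
Context {R : realFieldType} {p : nat}.
Implicit Types u v w b x : 'cV[R]_p.

Definition ip u v : R := \sum_j u j 0 * v j 0.

Lemma ipC u v : ip u v = ip v u.
Proof. by apply: eq_bigr => j _; rewrite mulrC. Qed.

Lemma ipDr u v w : ip u (v + w) = ip u v + ip u w.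
Proof. by rewrite /ip -big_split; apply: eq_bigr => j _; rewrite mxE mulrDr. Qed.

Lemma ipZr a u v : ip u (a *: v) = a * ip u v.
Proof. by rewrite /ip mulr_sumr; apply: eq_bigr => j _; rewrite mxE mulrCA. Qed.

Lemma ipBr u v w : ip u (v - w) = ip u v - ip u w.
Proof. by rewrite -scaleN1r ipDr ipZr mulN1r. Qed.

Lemma ipBl u v w : ip (u - v) w = ip u w - ip v w.
Proof. by rewrite !(ipC _ w) ipBr. Qed.

Lemma ipZl a u v : ip (a *: u) v = a * ip u v.
Proof. by rewrite !(ipC _ v) ipZr. Qed.

Lemma ip_adj (A : 'M[R]_p) u v : ip u (A *m v) = ip (A^T *m u) v.
Proof.
rewrite /ip; under eq_bigr do rewrite mxE mulr_sumr.
rewrite exchange_big/=; apply: eq_bigr => j _; rewrite mxE mulr_suml.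
by apply: eq_bigr => i _; rewrite mxE; ring.
Qed.

Lemma ip_ge0 u : 0 <= ip u u.
Proof. by apply: sumr_ge0 => j _; rewrite -expr2 sqr_ge0. Qed.

Lemma ip_eq0 u : ip u u = 0 -> u = 0.
Proof.
move=> u0; apply/colP => j; rewrite mxE; apply/eqP; rewrite -sqrf_eq0 eq_le sqr_ge0 andbT.
rewrite -u0 /ip (bigD1 j)//= -expr2 lerDl.
by apply: sumr_ge0 => i _; rewrite -expr2 sqr_ge0.
Qed.

Lemma ip_young a u v : 0 < a -> 2 * ip u v <= a * ip u u + ip v v / a.
Proof.
move=> a0; have := ip_ge0 (a *: u - v).
rewrite !ipBr !ipBl !ipZr !ipZl (ipC v u) => H.
have : 0 <= (a * (a * ip u u) - a * ip u v - (a * ip u v - ip v v)) / a.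
  by rewrite divr_ge0// ltW.
have -> : (a * (a * ip u u) - a * ip u v - (a * ip u v - ip v v)) / a =
  a * ip u u + ip v v / a - 2 * ip u v by field; exact: lt0r_neq0.
by rewrite subr_ge0.
Qed.

Lemma mulmx_outer x v : (x *m x^T) *m v = ip x v *: x.
Proof.
apply/colP => i; rewrite -mulmxA !mxE big_ord1 mxE mulrC; congr (_ * _).
by apply: eq_bigr => j _; rewrite mxE.
Qed.

End InnerProduct.

Section Coercive.
Context {R : realFieldType} {p : nat} (lam : R) (lam_gt0 : 0 < lam).
Implicit Types (M : 'M[R]_p) (u v w b x : 'cV[R]_p).

(** Symmetry and this quadratic lower bound stand in for a spectral gap: invertibility and all norm
    bounds on the resolvent follow from them without eigenvalues. *)
Definition coercive M : Prop :=
  M^T = M /\ forall v, lam * ip v v <= ip v (M *m v).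

Lemma coercive_unit M : coercive M -> M \in unitmx.
Proof.
move=> [Ms Mc]; rewrite -row_free_unit -kermx_eq0; apply/eqP/row_matrixP => i.
rewrite row0; set r := row i (kermx M).
have rM : r *m M = 0 by rewrite /r -row_mul mulmx_ker row0.
have : M *m r^T = 0 by rewrite -{1}Ms -trmx_mul rM trmx0.
move=> Mr; have := Mc r^T; rewrite Mr (_ : ip _ 0 = 0); last first.
  by rewrite /ip big1// => j _; rewrite [X in _ * X]mxE mulr0.
rewrite pmulr_rle0// => r0.
have /ip_eq0 : ip r^T r^T = 0 by apply/eqP; rewrite eq_le r0 ip_ge0.
by move=> /(congr1 trmx); rewrite trmxK trmx0.
Qed.

Lemma coercive_sym M u v : coercive M -> ip u (invmx M *m v) = ip (invmx M *m u) v.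
Proof. by move=> [Ms _]; rewrite ip_adj trmx_inv Ms. Qed.

Lemma coercive_mulK M v : coercive M -> M *m (invmx M *m v) = v.
Proof. by move=> cM; rewrite mulmxA mulmxV ?mul1mx//; exact: coercive_unit. Qed.

Lemma coercive_solve M u v : coercive M -> M *m u = v -> invmx M *m v = u.
Proof. by move=> cM <-; rewrite mulmxA mulVmx ?mul1mx//; exact: coercive_unit. Qed.

Lemma coercive_inv_norm M v : coercive M ->
  ip (invmx M *m v) (invmx M *m v) <= ip v v / lam ^+ 2.
Proof.
move=> cM; set w := invmx M *m v.
have := cM.2 w; rewrite /w coercive_mulK// -/w => H.
have := ip_young w v lam_gt0 => H2.
rewrite ler_pdivlMr ?exprn_gt0//.
have : lam * (lam * ip w w) <= lam * (ip v v / lam).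
  apply: ler_wpM2l; [exact: ltW|lra].
have -> : lam * (ip v v / lam) = ip v v by field; exact: lt0r_neq0.
by move=> H3; rewrite (_ : _ * _ = lam * (lam * ip w w))//; ring.
Qed.

Lemma coercive_inv_ge0 M v : coercive M -> 0 <= ip v (invmx M *m v).
Proof.
move=> cM; have := cM.2 (invmx M *m v); rewrite coercive_mulK// ipC.
by apply: le_trans; apply: mulr_ge0; [exact: ltW|exact: ip_ge0].
Qed.

Lemma coercive_inv_le M v : coercive M -> ip v (invmx M *m v) <= ip v v / lam.
Proof.
move=> cM; set w := invmx M *m v.
have := cM.2 w; rewrite /w coercive_mulK// -/w => H.
have := ip_young w v lam_gt0; have := ipC w v; have := ip_ge0 w; lra.
Qed.

Lemma coercive_outer M s x : 0 <= s -> coercive M ->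
  coercive (M + s *: (x *m x^T)).
Proof.
move=> s0 [Ms Mc]; split.
  by rewrite linearD/= linearZ/= trmx_mul trmxK Ms.
move=> v; rewrite mulmxDl -scalemxAl mulmx_outer ipDr !ipZr (ipC v x).
apply: ler_wpDr => //; apply: mulr_ge0 => //.
by rewrite -expr2 sqr_ge0.
Qed.

Section RankOne.
Variables (M : 'M[R]_p) (s : R) (x : 'cV[R]_p).
Hypotheses (s_ge0 : 0 <= s) (cM : coercive M).
Let M' := M + s *: (x *m x^T).
Let a := s * ip x (invmx M *m x).

Let a1 : 0 < 1 + a.
Proof. by rewrite ltr_pwDl// mulr_ge0// coercive_inv_ge0. Qed.

Lemma sherman_morrison b : invmx M' *m b =
  invmx M *m b - (s * ip x (invmx M *m b) / (1 + a)) *: (invmx M *m x).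
Proof.
apply: coercive_solve; first exact: coercive_outer.
rewrite /M' mulmxDl -scalemxAl mulmx_outer mulmxBr -scalemxAr !coercive_mulK//.
rewrite ipBr ipZr -scalerA scalerBl scalerBr !scalerA -addrA; apply/eqP.
rewrite -subr_eq0 -addrA addrC subrK.
rewrite -scalerBl -scaleNr -scalerDl scaler_eq0; apply/orP; left.
apply/eqP; rewrite -/a.
have : 1 + a != 0 by exact: lt0r_neq0.
rewrite /a => na; field.
exact: na.
Qed.

Lemma rank_one_quadratic b : ip b (invmx M' *m b) =
  ip b (invmx M *m b) - s * ip x (invmx M *m b) ^+ 2 / (1 + a).
Proof.
rewrite sherman_morrison ipBr ipZr (coercive_sym b x cM) (ipC _ x); congr (_ - _).
by rewrite expr2 mulrA mulrAC.
Qed.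

Lemma rank_one_form b : ip x (invmx M' *m b) = ip x (invmx M *m b) / (1 + a).
Proof.
rewrite sherman_morrison ipBr ipZr.
have : 1 + a != 0 by exact: lt0r_neq0.
rewrite /a => na; field.
exact: na.
Qed.

End RankOne.

Lemma coercive_shift M h : 0 <= h -> coercive M -> coercive (M + h%:M).
Proof.
move=> h0 [Ms Mc]; split; first by rewrite linearD/= tr_scalar_mx Ms.
move=> v; rewrite mulmxDl mul_scalar_mx ipDr ipZr.
by apply: ler_wpDr => //; apply: mulr_ge0 => //; exact: ip_ge0.
Qed.

(** With [G] and [G_h] the two inverses, the resolvent identity [G = G_h + h G_h G], used twice,
    shows the error to be exactly [h] times the form of [G_h] at [G b]. It is nonnegative and
    bounded independently of the matrix, which later permits passing from [b^T G b] to [|G b|^2]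
    uniformly in the sample. *)
Lemma resolvent_derivative M h b : 0 < h -> coercive M ->
  0 <= ip (invmx M *m b) (invmx M *m b)
       - (ip b (invmx M *m b) - ip b (invmx (M + h%:M) *m b)) / h
    <= h * (ip b b / lam ^+ 3).
Proof.
move=> h0 cM.
pose Q1 := ip b (invmx M *m b); pose Q2 := ip b (invmx (M + h%:M) *m b).
pose N := ip (invmx M *m b) (invmx M *m b); rewrite -/Q1 -/Q2 -/N.
have cM2 := coercive_shift (ltW h0) cM.
pose M2 := M + h%:M; rewrite -/M2 in cM2.
have E (c : 'cV[R]_p) : invmx M2 *m c = invmx M *m c - h *: (invmx M2 *m (invmx M *m c)).
  apply: coercive_solve => //.
  rewrite mulmxBr -scalemxAr (coercive_mulK _ cM2) /M2 mulmxDl mul_scalar_mx.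
  by rewrite coercive_mulK// addrK.
have Q2E : Q2 = Q1 - h * ip (invmx M2 *m b) (invmx M *m b).
  by rewrite /Q2 -/M2 [in LHS]E ipBr ipZr (coercive_sym b _ cM2).
have -> : (Q1 - Q2) / h = ip (invmx M2 *m b) (invmx M *m b).
  by rewrite Q2E; field; exact: lt0r_neq0.
have -> : N - ip (invmx M2 *m b) (invmx M *m b) =
    h * ip (invmx M *m b) (invmx M2 *m (invmx M *m b)).
  by rewrite E ipBl ipZl (ipC _ (invmx M *m b)) /N; ring.
rewrite mulr_ge0 ?(ltW h0) ?coercive_inv_ge0//= ler_wpM2l ?(ltW h0)//.
apply: le_trans (coercive_inv_le _ cM2) _.
rewrite ler_pdivrMr//; apply: le_trans (coercive_inv_norm b cM) _.
rewrite le_eqVlt; apply/orP; left; apply/eqP; field; exact: lt0r_neq0.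
Qed.

End Coercive.

Section MeasurableMatrices.
Context {R : realType} {d : measure_display} {T : measurableType d}.

Definition mx_measurable m n (A : T -> 'M[R]_(m, n)) : Prop :=
  forall i j, measurable_fun setT (fun w => A w i j).

Lemma mx_measurable_det n (A : T -> 'M[R]_n) : mx_measurable A ->
  measurable_fun setT (fun w => \det (A w)).
Proof.
move=> mA; apply: measurable_sum => s; apply: measurable_funM => //.
by apply: measurable_prod => i _; exact: mA.
Qed.

Lemma mx_measurableM m n k (A : T -> 'M[R]_(m, n)) (B : T -> 'M[R]_(n, k)) :
  mx_measurable A -> mx_measurable B -> mx_measurable (fun w => A w *m B w).
Proof.
move=> mA mB i j; under eq_fun do rewrite mxE.
by apply: measurable_sum => l; exact: measurable_funM.
Qed.

Lemma mx_measurable_cst m n (A : 'M[R]_(m, n)) : mx_measurable (fun=> A).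
Proof. by move=> i j. Qed.

Lemma mx_measurable_inv n (A : T -> 'M[R]_n) : mx_measurable A ->
  (forall w, A w \in unitmx) -> mx_measurable (fun w => invmx (A w)).
Proof.
move=> mA uA i j.
(* The adjugate formula, with the inverse determinant written as [det / det^2] because inversion was
   shown measurable for nonnegative functions. *)
rewrite (_ : (fun w => _) = (fun w => (\det (A w) * (\det (A w) ^+ 2)^-1) *
   ((-1) ^+ (j + i) * \det (row' j (col' i (A w)))))).
  have md := mx_measurable_det mA.
  apply: measurable_funM.
    apply: measurable_funM => //.
    apply: measurable_fun_inv; first by move=> w; exact: sqr_ge0.
    exact: measurable_funX.
  apply: measurable_funM => //; apply: mx_measurable_det => k l.
  by under eq_fun do rewrite !mxE; exact: mA.
apply/funext => w; rewrite /invmx uA !mxE; congr (_ * _).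
have := uA w; rewrite unitmxE unitfE => d0.
by field.
Qed.

Lemma mx_measurable_ip n (u v : T -> 'cV[R]_n) : mx_measurable u ->
  mx_measurable v -> measurable_fun setT (fun w => ip (u w) (v w)).
Proof.
by move=> mu mv; apply: measurable_sum => j; apply: measurable_funM.
Qed.

End MeasurableMatrices.

Section PowerMean.
Context {R : realFieldType} {p : nat}.
Implicit Types x : 'I_p -> R.

Lemma sum_sqr_le x : (\sum_j x j) ^+ 2 <= p%:R * \sum_j x j ^+ 2.
Proof.
case: p x => [|q] x; first by rewrite !big_ord0 mulr0 expr0n.
set m := \sum_j x j.
have : 0 <= \sum_(i < q.+1) (q.+1%:R * x i - m) ^+ 2.
  by apply: sumr_ge0 => i _; exact: sqr_ge0.
have -> : \sum_(i < q.+1) (q.+1%:R * x i - m) ^+ 2 =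
   q.+1%:R * (q.+1%:R * \sum_(i < q.+1) x i ^+ 2 - m ^+ 2).
  transitivity (\sum_(i < q.+1) (q.+1%:R ^+ 2 * x i ^+ 2 - (2 * q.+1%:R * m) * x i
     + m ^+ 2)).
    by apply: eq_bigr => i _; ring.
  rewrite big_split /= sumrB -!mulr_sumr sumr_const card_ord -/m -[m *+ _]mulr_natl.
  by ring.
by rewrite pmulr_rge0 ?ltr0n// subr_ge0.
Qed.

Lemma sum_pow4_le x : (\sum_j x j) ^+ 4 <= p%:R ^+ 3 * \sum_j x j ^+ 4.
Proof.
have -> : (\sum_j x j) ^+ 4 = ((\sum_j x j) ^+ 2) ^+ 2 by rewrite -exprM.
have S0 : 0 <= \sum_j x j ^+ 2 by apply: sumr_ge0 => j _; exact: sqr_ge0.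
apply: (@le_trans _ _ ((p%:R * \sum_j x j ^+ 2) ^+ 2)).
  by rewrite ler_sqr ?nnegrE ?sqr_ge0 ?mulr_ge0//; exact: sum_sqr_le.
rewrite exprMn [p%:R ^+ 3]exprSr -mulrA ler_wpM2l ?sqr_ge0//.
apply: le_trans (sum_sqr_le (fun j => x j ^+ 2)) _.
rewrite ler_wpM2l//; apply: ler_sum => j _; by rewrite -exprM.
Qed.

End PowerMean.

(** * Concentration of resolvent functionals *)

Section SampleGram.
Context {R : realType} {n p : nat}.
Implicit Types (s : n.-tuple (p.-tuple R)) (u : p.-tuple R) (b c : 'cV[R]_p).

Definition cvec u : 'cV[R]_p := \col_j tnth u j.

(** The reference value for oscillations: a zero row in place [k] deletes that observation from the
    Gram matrix while the shape and the factor [1/n] stay the same. *)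
Definition zrow : p.-tuple R := [tuple 0 | _ < p].

Definition sgram (lam : R) s : 'M[R]_p :=
  n%:R^-1 *: ((design (tnth s))^T *m design (tnth s)) + lam%:M.

Definition Qform (lam : R) b s : R := ip b (invmx (sgram lam s) *m b).

Lemma dotp_ip u b : dotp u b = ip (cvec u) b.
Proof. by apply: eq_bigr => j _; rewrite mxE. Qed.

Lemma sqnorm2_ip b : sqnorm2 b = ip b b.
Proof. by apply: eq_bigr => j _; rewrite expr2. Qed.

Lemma quadp_ip (A : 'M[R]_p) u : quadp A u = ip (cvec u) (A *m cvec u).
Proof.
apply: eq_bigr => i _; rewrite !mxE mulr_sumr; apply: eq_bigr => j _.
by rewrite !mxE mulrA.
Qed.

Lemma outer_sum s : (design (tnth s))^T *m design (tnth s) =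
  \sum_i cvec (tnth s i) *m (cvec (tnth s i))^T.
Proof.
apply/matrixP => a b; rewrite !mxE summxE; apply: eq_bigr => i _.
by rewrite !mxE big_ord1 !mxE.
Qed.

Lemma sgram_coercive lam s : coercive lam (sgram lam s).
Proof.
split.
  by rewrite /sgram linearD/= linearZ/= trmx_mul trmxK tr_scalar_mx.
move=> v; rewrite mulmxDl mul_scalar_mx ipDr ipZr lerDr.
rewrite -scalemxAl ipZr mulr_ge0 ?invr_ge0//.
rewrite (_ : ip _ _ = \sum_i (design (tnth s) *m v) i 0 ^+ 2); last first.
  rewrite outer_sum mulmx_suml /ip (eq_bigr (fun j => \sum_i v j 0 *
      (ip (cvec (tnth s i)) v * cvec (tnth s i) j 0))); last first.
    move=> j _; rewrite summxE mulr_sumr; apply: eq_bigr => i _.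
    by rewrite mulmx_outer mxE.
  rewrite exchange_big/=; apply: eq_bigr => i _.
  rewrite (_ : (_ *m v) i 0 = ip (cvec (tnth s i)) v); last first.
    by rewrite mxE; apply: eq_bigr => j _; rewrite !mxE.
  rewrite expr2 {3}/ip mulr_sumr; apply: eq_bigr => j _.
  by rewrite mulrCA [v j 0 * _]mulrC.
by apply: sumr_ge0 => i _; exact: sqr_ge0.
Qed.

Lemma sgram_shift lam h s : sgram (lam + h) s = sgram lam s + h%:M.
Proof. by rewrite /sgram -addrA -raddfD. Qed.

Lemma sgram_upd lam s k u : sgram lam (upd s k u) =
  sgram lam (upd s k zrow) + n%:R^-1 *: (cvec u *m (cvec u)^T).
Proof.
rewrite /sgram addrAC -scalerDr; congr (_ *: _ + _).
rewrite !outer_sum (bigD1 k)//= [in RHS](bigD1 k)//= !tnth_upd eqxx.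
have -> : cvec zrow = 0 by apply/colP => j; rewrite !mxE tnth_mktuple.
rewrite mul0mx add0r addrC; congr (_ + _); apply: eq_bigr => i ik.
by rewrite !tnth_upd (negbTE ik).
Qed.

Lemma Qform_ge0 lam b s : 0 < lam -> 0 <= Qform lam b s.
Proof. by move=> l0; apply: (coercive_inv_ge0 l0); exact: sgram_coercive. Qed.

Lemma Qform_le lam b s : 0 < lam -> Qform lam b s <= sqnorm2 b / lam.
Proof.
move=> l0; rewrite sqnorm2_ip; apply: (coercive_inv_le l0).
exact: sgram_coercive.
Qed.

Lemma mx_measurable_sgram lam d (T : measurableType d)
    (f : T -> n.-tuple (p.-tuple R)) : measurable_fun setT f ->
  mx_measurable (fun w => sgram lam (f w)).
Proof.
move=> mf i j; under eq_fun do rewrite !mxE.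
apply: measurable_funD => //; apply: measurable_funM => //.
apply: measurable_sum => l; under eq_fun do rewrite !mxE.
have m1 k : measurable_fun setT (fun w => tnth (tnth (f w) l) k).
  apply: (measurableT_comp (measurable_tnth k)).
  by apply: (measurableT_comp (measurable_tnth l)).
exact: measurable_funM.
Qed.

Lemma mx_measurable_resolvent lam d (T : measurableType d)
    (f : T -> n.-tuple (p.-tuple R)) b : 0 < lam -> measurable_fun setT f ->
  mx_measurable (fun w => invmx (sgram lam (f w)) *m b).
Proof.
move=> l0 mf; apply: mx_measurableM; last exact: mx_measurable_cst.
apply: mx_measurable_inv; first exact: mx_measurable_sgram.
by move=> w; apply: (coercive_unit l0); exact: sgram_coercive.
Qed.

Lemma bounded_Qform lam b : 0 < lam -> bounded_measurable (Qform lam b).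
Proof.
move=> l0; split.
  apply: mx_measurable_ip; first exact: mx_measurable_cst.
  exact: (mx_measurable_resolvent (f := id)).
exists (sqnorm2 b / lam) => s.
by rewrite ger0_norm ?Qform_ge0// Qform_le.
Qed.

End SampleGram.

Section Oscillation.
Context {R : realType} {n p : nat}.
Variables (mu : probability R R) (nu : probability (p.-tuple R) R).
Hypothesis nu_iid : iid_law nu mu.
Hypothesis mu4 : mu.-integrable setT (EFin \o (fun t : R => t ^+ 4)).
Hypothesis mu_mean : \int[mu]_t t = 0.
Hypothesis mu_var : \int[mu]_t (t ^+ 2) = 1.
Hypothesis n_gt0 : (0 < n)%N.
Variables (lam : R) (lam_gt0 : 0 < lam).
Implicit Types (s : n.-tuple (p.-tuple R)) (u : p.-tuple R) (b c : 'cV[R]_p).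

Let N : R := n%:R.
Let N_gt0 : 0 < N. Proof. by rewrite ltr0n. Qed.
Let K4 : R := 4 + 3 * m4 mu.

Definition phi_tail (L : R) : R := \int[mu]_t phi L t.

Definition osc2 : R := K4 / lam ^+ 4 / N ^+ 2.

Let Kw : R := (2 + 2 * lam^-1 ^+ 4) *
  ((1 + lam^-1) ^+ 2 * (59 * (K4 * (1 + lam^-1) ^+ 4) + 28 * (1 + lam^-1) ^+ 4)).

(** After the factor [n] in [concentration], this is of order [(1/n) (1/n + phi_tail n)], summable
    once [phi_tail] decays like a power; the companion term [n^2 osc2^2] is of order [n^-2]. *)
Definition osc4 : R := Kw * ((N^-1 + phi_tail N) / N ^+ 2).

Let K4_ge0 : 0 <= K4.
Proof. by rewrite /K4 addr_ge0// mulr_ge0// m4_ge0. Qed.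

Lemma phi_tail_ge0 L : 0 < L -> 0 <= phi_tail L.
Proof. by move=> L0; apply: Rintegral_ge0 => t _; exact: phi_ge0. Qed.

Lemma osc2_ge0 : 0 <= osc2.
Proof. by rewrite !divr_ge0// exprn_ge0// ltW. Qed.

Let li0 : 0 <= lam^-1. Proof. by rewrite invr_ge0 ltW. Qed.
Let B0 : 0 <= 1 + lam^-1. Proof. exact: addr_ge0. Qed.

Let Kw_ge0 : 0 <= Kw.
Proof.
rewrite mulr_ge0//; first by rewrite addr_ge0// mulr_ge0// exprn_ge0.
by rewrite mulr_ge0 ?sqr_ge0// addr_ge0// ?mulr_ge0// exprn_ge0.
Qed.

Lemma osc4_ge0 : 0 <= osc4.
Proof.
rewrite mulr_ge0// divr_ge0 ?sqr_ge0// addr_ge0 ?phi_tail_ge0//.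
by rewrite invr_ge0 ltW.
Qed.

Lemma Qform_decrement b s k u :
  Qform lam b (upd s k zrow) - Qform lam b (upd s k u) =
  N^-1 * dotp u (invmx (sgram lam (upd s k zrow)) *m b) ^+ 2 /
   (1 + N^-1 * quadp (invmx (sgram lam (upd s k zrow))) u).
Proof.
rewrite /Qform (sgram_upd lam s k u) (rank_one_quadratic lam_gt0)//.
- by rewrite opprB addrC subrK dotp_ip quadp_ip.
- exact: sgram_coercive.
Qed.

Lemma Qform_decrement_bounds b s k u : sqnorm2 b = 1 ->
  let D := Qform lam b (upd s k zrow) - Qform lam b (upd s k u) in
  [/\ 0 <= D, D <= lam^-1 &
   D <= N^-1 * dotp u (invmx (sgram lam (upd s k zrow)) *m b) ^+ 2].
Proof.
move=> b1 D; have q0 : 0 <= quadp (invmx (sgram lam (upd s k zrow))) u.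
  rewrite quadp_ip; apply: (coercive_inv_ge0 lam_gt0); exact: sgram_coercive.
have Nq0 : 0 <= N^-1 * quadp (invmx (sgram lam (upd s k zrow))) u.
  by rewrite mulr_ge0// invr_ge0 ltW.
have num0 : 0 <= N^-1 * dotp u (invmx (sgram lam (upd s k zrow)) *m b) ^+ 2.
  by rewrite mulr_ge0 ?sqr_ge0// invr_ge0 ltW.
split.
- by rewrite /D Qform_decrement divr_ge0// addr_ge0.
- rewrite /D; have := Qform_le b (upd s k zrow) lam_gt0.
  by rewrite b1 mul1r; have := Qform_ge0 b (upd s k u) lam_gt0; lra.
rewrite /D Qform_decrement ler_pdivrMr; last by rewrite ltr_pwDl.
by rewrite ler_peMr// lerDl.
Qed.

Lemma resolvent_norm b s : sqnorm2 b = 1 ->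
  sqnorm2 (invmx (sgram lam s) *m b) <= lam^-1 ^+ 2.
Proof.
move=> b1; have := coercive_inv_norm lam_gt0 b (sgram_coercive lam s).
by rewrite -!sqnorm2_ip b1 div1r exprVn.
Qed.

Lemma Qform_osc2 b (k : 'I_n) : sqnorm2 b = 1 ->
  oscillation_le nu zrow 2 (Qform lam b) k osc2.
Proof.
move=> b1 s; set c := invmx (sgram lam (upd s k zrow)) *m b.
have dc : dominated 2 (fun u => dotp u c ^+ 4).
  under eq_fun do rewrite (exprM _ 2 2) expr2.
  by apply: dominatedM; exact: dominated_dotp_sqr.
apply: (@le_trans _ _ (\int[nu]_u (N^-1 ^+ 2 * dotp u c ^+ 4))).
  apply: le_Rintegral => //.
  - apply: bounded_integrable; apply: bounded_measurableX.
    apply: bounded_measurableB; last exact: bounded_measurable_cst.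
    by apply: bounded_measurable_upd; exact: bounded_Qform.
  - by apply: integrableZl_real; exact: (dominated_integrable nu_iid mu4).
  move=> u _; have [D0 _ D2] := Qform_decrement_bounds s k u b1.
  rewrite -sqrrN opprB (_ : _ * _ ^+ 4 = (N^-1 * dotp u c ^+ 2) ^+ 2); last by ring.
  by rewrite ler_sqr ?nnegrE ?(le_trans D0 D2).
rewrite RintegralZl//; last exact: (dominated_integrable nu_iid mu4).
rewrite /osc2 [leRHS]mulrC exprVn ler_wpM2l ?invr_ge0 ?sqr_ge0//.
apply: le_trans (dotp_moment4 nu_iid mu4 mu_mean mu_var c) _.
rewrite -/K4 ler_wpM2l//.
have -> : (lam ^+ 4)^-1 = (lam^-1 ^+ 2) ^+ 2 by rewrite -exprM exprVn.
rewrite ler_sqr ?nnegrE ?sqr_ge0//; first exact: resolvent_norm.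
by rewrite sqnorm2_ip ip_ge0.
Qed.

(* A number below both [M] and [Z] has fourth power of order [Z^3 / (1 + Z)]. *)
Lemma pow4_le_min (D M Z : R) : 0 <= D -> D <= M -> D <= Z ->
  D ^+ 4 <= (2 + 2 * M ^+ 4) * (Z ^+ 3 / (1 + Z)).
Proof.
move=> D0 DM DZ; have Z0 : 0 <= Z by exact: le_trans DZ.
have M0 : 0 <= M by exact: le_trans DM.
have Z1 : 0 < 1 + Z by rewrite ltr_pwDl.
have M4 : 0 <= M ^+ 4 by exact: exprn_ge0.
have X0 : 0 <= Z ^+ 3 / (1 + Z) by rewrite divr_ge0 ?exprn_ge0// ltW.
have [Zle1|Zgt1] := leP Z 1.
  apply: (@le_trans _ _ (2 * (Z ^+ 3 / (1 + Z)))); last first.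
    by rewrite ler_wpM2r// lerDl mulr_ge0.
  apply: (@le_trans _ _ (Z ^+ 4)).
    by rewrite lerXn2r ?nnegrE.
  rewrite mulrA ler_pdivlMr// exprS mulrAC ler_wpM2r ?exprn_ge0//.
  have := mulr_ge0 Z0 Z0; nra.
apply: (@le_trans _ _ (2 * M ^+ 4 * (Z ^+ 3 / (1 + Z)))); last first.
  by rewrite ler_wpM2r// lerDr.
apply: (@le_trans _ _ (M ^+ 4)); first by rewrite lerXn2r ?nnegrE.
rewrite -mulrA [2 * _]mulrCA ler_peMr// mulrA ler_pdivlMr// mul1r.
have Z3 : Z <= Z ^+ 3 by rewrite exprS ler_peMr// exprn_ege1// ltW.
by lra.
Qed.

Lemma Qform_osc4 b (k : 'I_n) : sqnorm2 b = 1 ->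
  oscillation_le nu zrow 4 (Qform lam b) k osc4.
Proof.
move=> b1 s; set c := invmx (sgram lam (upd s k zrow)) *m b.
pose K := 2 + 2 * lam^-1 ^+ 4.
have K0 : 0 <= K by rewrite addr_ge0// mulr_ge0// exprn_ge0.
have iphi : nu.-integrable setT (EFin \o (fun u => phi N (dotp u c))).
  rewrite (_ : _ \o _ = EFin \o (fun u => phi N (lin p c u))); last first.
    by apply/funext => u; rewrite /= lin_dotp.
  by apply: (dominated_integrable nu_iid mu4); exact: dominated_phi_lin.
apply: (@le_trans _ _ (\int[nu]_u (K * (N^-1 ^+ 2) * phi N (dotp u c)))).
  apply: le_Rintegral => //.
  - apply: bounded_integrable; apply: bounded_measurableX.
    apply: bounded_measurableB; last exact: bounded_measurable_cst.
    by apply: bounded_measurable_upd; exact: bounded_Qform.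
  - exact: integrableZl_real.
  move=> u _; have [D0 D1 D2] := Qform_decrement_bounds s k u b1.
  have -> : forall x : R, x ^+ 4 = (- x) ^+ 4 by move=> x; ring.
  rewrite opprB; apply: le_trans (pow4_le_min D0 D1 D2) _.
  (* For [Z = y^2 / N], the quantity [Z^3 / (1 + Z)] is exactly [phi N y / N^2]: the truncation
     level is the sample size. *)
  rewrite -mulrA ler_wpM2l// -/c /phi; apply/le_eq.
  have : N + dotp u c ^+ 2 != 0 by rewrite lt0r_neq0// denom_gt0.
  set y := dotp u c => y0; field.
  by rewrite y0 lt0r_neq0.
rewrite RintegralZl// /osc4 /Kw -/K -!mulrA ler_wpM2l//.
have cB : sqnorm2 c <= (1 + lam^-1) ^+ 2.
  apply: le_trans (resolvent_norm _ b1) _.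
  by rewrite ler_sqr ?nnegrE// lerDr.
have B1 : 1 <= 1 + lam^-1 by rewrite lerDl.
have := dotp_phi_moment nu_iid mu4 mu_mean mu_var N_gt0 B1 cB.
rewrite -/K4 -/(phi_tail N); set I := Rintegral _ _ _; set B := 1 + lam^-1 => H.
apply: (@le_trans _ _ (N^-1 ^+ 2 * (B ^+ 2 *
    (59 * (K4 * B ^+ 4 / N) + 28 * B ^+ 4 * phi_tail N)))).
  by rewrite mulrA -expr2; apply: ler_wpM2l => //; exact: sqr_ge0.
have pt0 := phi_tail_ge0 N_gt0.
(* A product of two sums dominates the sum of the matching products; the difference consists of the
   two mixed terms. *)
rewrite -subr_ge0 (_ : _ - _ = N^-1 ^+ 2 * (B ^+ 2 *
  (59 * (K4 * B ^+ 4 * phi_tail N) + 28 * (B ^+ 4 * N^-1)))); last first.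
  by field; exact: lt0r_neq0.
have B40 : 0 <= B ^+ 4 by rewrite exprn_ge0.
have Ni0 : 0 <= N^-1 by rewrite invr_ge0 ltW.
by rewrite !mulr_ge0 ?sqr_ge0// addr_ge0// !mulr_ge0.
Qed.

End Oscillation.

Lemma Rintegral_dist_le {R : realType} d (T : measurableType d)
    (P : probability T R) (F H U : T -> R) :
  P.-integrable setT (EFin \o F) -> P.-integrable setT (EFin \o H) ->
  P.-integrable setT (EFin \o U) -> (forall x, `|F x - H x| <= U x) ->
  `|\int[P]_x F x - \int[P]_x H x| <= \int[P]_x U x.
Proof.
move=> iF iH iU FHU.
rewrite -RintegralB//; apply: le_trans (le_normr_Rintegral _ _) _ => //.
  exact: integrableB_real.
apply: le_Rintegral => //.
have := integrable_norm (integrableB_real iF iH).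
by [].
Qed.

Lemma young_abs {R : realFieldType} (t x : R) : 0 < t -> `|x| <= (t + x ^+ 2 / t) / 2.
Proof.
move=> t0; rewrite -[x ^+ 2]real_normK ?num_real//; set a := `|x|.
have H : 0 <= (t - a) ^+ 2 / t by rewrite divr_ge0 ?sqr_ge0// ltW.
rewrite -subr_ge0 (_ : _ - _ = (t - a) ^+ 2 / t / 2); first exact: divr_ge0.
by field; exact: lt0r_neq0.
Qed.

Section DeltaVectors.
Context {R : realFieldType} {p : nat}.

Definition unitv (j : 'I_p) : 'cV[R]_p := delta_mx j 0.

Lemma ip_unitv j v : ip (unitv j) v = v j 0.
Proof.
rewrite /ip (bigD1 j)//= mxE !eqxx mul1r big1 ?addr0// => i ij.
by rewrite mxE (negbTE ij) mul0r.
Qed.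

Lemma sqnorm2_unitv (j : 'I_p) : ip (unitv j) (unitv j) = 1.
Proof. by rewrite ip_unitv mxE !eqxx. Qed.

Lemma mulmx_unitv (A : 'M[R]_p) i j : (A *m unitv j) i 0 = A i j.
Proof. by rewrite -colE mxE. Qed.

Lemma trace_unitv (A : 'M[R]_p) : \tr A = \sum_j ip (unitv j) (A *m unitv j).
Proof. by apply: eq_bigr => j _; rewrite ip_unitv mulmx_unitv. Qed.

End DeltaVectors.

(** * The leave-one-out equation *)

Section Mean.
Context {R : realType} {n p : nat}.
Variables (mu : probability R R) (nu : probability (p.-tuple R) R).
Variable Pi : probability (n.-tuple (p.-tuple R)) R.
Hypothesis nu_iid : iid_law nu mu.
Hypothesis Pi_iid : iid_law Pi nu.
Hypothesis mu4 : mu.-integrable setT (EFin \o (fun t : R => t ^+ 4)).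
Hypothesis mu_mean : \int[mu]_t t = 0.
Hypothesis mu_var : \int[mu]_t (t ^+ 2) = 1.
Hypothesis n_gt0 : (0 < n)%N.
Variables (lam : R) (lam_gt0 : 0 < lam).
Implicit Types (s : n.-tuple (p.-tuple R)) (u : p.-tuple R) (b c : 'cV[R]_p)
  (k : 'I_n).

Let N : R := n%:R.
Let N_gt0 : 0 < N. Proof. by rewrite ltr0n. Qed.
Let K4 : R := 4 + 3 * m4 mu.
Let K2 : R := 10 + 2 * m4 mu.
Let y : R := p%:R / N.
Let V := osc2 (n := n) mu lam.
Let W := osc4 (n := n) mu lam.
Let V_ge0 : 0 <= V. Proof. exact: osc2_ge0. Qed.
Let W_ge0 : 0 <= W. Proof. exact: osc4_ge0. Qed.
Let z0 : p.-tuple R := zrow.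

Lemma Qform_concentration b : sqnorm2 b = 1 ->
  let c := \int[Pi]_s Qform lam b s in
  \int[Pi]_s ((Qform lam b s - c) ^+ 2) <= N * V /\
  \int[Pi]_s ((Qform lam b s - c) ^+ 4) <= 8 * N ^+ 2 * V ^+ 2 + 48 * N * W.
Proof.
move=> b1; apply: (concentration Pi_iid (e0 := z0)) => //.
- exact: bounded_Qform.
- by move=> k; exact: Qform_osc2.
- by move=> k; exact: Qform_osc4.
Qed.

(** Normalised by [n] and not by [p], because it has to match [x^T G x / n] in the Sherman-Morrison
    denominator; hence the factor [gamma] in its limit [gamma m]. *)
Definition mean_resolvent s : R := N^-1 * \sum_j Qform lam (unitv j) s.

Let tau := mean_resolvent.

Lemma mean_resolvent_trace s : tau s = N^-1 * \tr (invmx (sgram lam s)).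
Proof. by rewrite trace_unitv. Qed.


Lemma bounded_mean_resolvent : bounded_measurable tau.
Proof.
split.
  apply: measurable_funM => //; apply: measurable_sum => j.
  by case: (bounded_Qform (n := n) (unitv j) lam_gt0).
exists (N^-1 * \sum_(j < p) (sqnorm2 (unitv j) / lam)) => s.
have Q0 j : 0 <= Qform lam (unitv j) s by exact: Qform_ge0.
rewrite ger0_norm; last by rewrite mulr_ge0 ?invr_ge0 ?(ltW N_gt0)// sumr_ge0.
rewrite ler_wpM2l ?invr_ge0 ?(ltW N_gt0)//; apply: ler_sum => j _.
exact: Qform_le.
Qed.

Let btau := bounded_mean_resolvent.

Lemma mean_resolvent_ge0 s : 0 <= tau s.
Proof.
rewrite mulr_ge0 ?invr_ge0 ?(ltW N_gt0)// sumr_ge0// => j _.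
exact: Qform_ge0.
Qed.

Lemma unitv1 (j : 'I_p) : sqnorm2 (unitv j) = 1 :> R.
Proof. by rewrite sqnorm2_ip sqnorm2_unitv. Qed.

(** The power mean inequality turns the power of a sum over [p] coordinates into [p^m] times a sum
    of powers; together with the division by [n] this produces [y^(m+1)]. *)
Lemma mean_resolvent_osc (m : nat) (X : R) k :
  (forall x : 'I_p -> R, (\sum_j x j) ^+ m.+1 <= p%:R ^+ m * \sum_j x j ^+ m.+1) ->
  (forall j, oscillation_le nu z0 m.+1 (Qform lam (unitv j)) k X) ->
  oscillation_le nu z0 m.+1 tau k (y ^+ m.+1 * X).
Proof.
move=> pow HX s.
pose D j u := Qform lam (unitv j) (upd s k u) - Qform lam (unitv j) (upd s k z0).
have bD j : bounded_measurable (fun u => D j u ^+ m.+1).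
  apply: bounded_measurableX; apply: bounded_measurableB.
    by apply: bounded_measurable_upd; exact: bounded_Qform.
  exact: bounded_measurable_cst.
pose c := N^-1 ^+ m.+1 * p%:R ^+ m.
have iD : nu.-integrable setT (EFin \o (fun u => \sum_j D j u ^+ m.+1)).
  rewrite (_ : _ \o _ = (fun u => \sum_(j < p) (D j u ^+ m.+1)%:E)%E); last first.
    by apply/funext => u; rewrite /= sumEFin.
  by apply: (integrable_sum measurableT) => j _; exact: bounded_integrable.
apply: (@le_trans _ _ (\int[nu]_u (c * \sum_j D j u ^+ m.+1))).
  apply: le_Rintegral => //.
  - apply: bounded_integrable; apply: bounded_measurableX.
    apply: bounded_measurableB; first exact: bounded_measurable_upd.
    exact: bounded_measurable_cst.
  - exact: integrableZl_real.
  move=> u _; rewrite /tau /mean_resolvent -mulrBr -sumrB exprMn /c -mulrA.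
  by rewrite ler_wpM2l ?exprn_ge0 ?invr_ge0 ?(ltW N_gt0).
rewrite RintegralZl//.
have -> : \int[nu]_u (\sum_j D j u ^+ m.+1) = \sum_j \int[nu]_u (D j u ^+ m.+1).
  rewrite /Rintegral; under eq_integral do rewrite -sumEFin.
  rewrite integral_sum//; last by move=> j; exact: bounded_integrable.
  rewrite sum_fine// => j _.
  by apply: integrable_fin_num => //; exact: bounded_integrable.
have N0 : N != 0 by exact: lt0r_neq0.
rewrite [leRHS](_ : _ = c * (p%:R * X)); last first.
  by rewrite /y /c exprMn [p%:R ^+ m.+1]exprSr; ring.
rewrite ler_wpM2l ?mulr_ge0 ?exprn_ge0 ?invr_ge0 ?(ltW N_gt0)//.
rewrite mulr_natl -[in leRHS](card_ord p) -sumr_const; apply: ler_sum => j _.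
exact: HX.
Qed.

Let osc2tau k : oscillation_le nu z0 2 tau k (y ^+ 2 * V).
Proof.
apply: (@mean_resolvent_osc 1); first by move=> x; exact: sum_sqr_le.
by move=> j; apply: Qform_osc2 => //; exact: unitv1.
Qed.

Let osc4tau k : oscillation_le nu z0 4 tau k (y ^+ 4 * W).
Proof.
apply: (@mean_resolvent_osc 3); first by move=> x; exact: sum_pow4_le.
by move=> j; apply: Qform_osc4 => //; exact: unitv1.
Qed.

Let y_ge0 : 0 <= y. Proof. by rewrite divr_ge0// ltW. Qed.

Lemma mean_resolvent_concentration :
  let c := \int[Pi]_s tau s in
  \int[Pi]_s ((tau s - c) ^+ 2) <= N * (y ^+ 2 * V) /\
  \int[Pi]_s ((tau s - c) ^+ 4) <=
    8 * N ^+ 2 * (y ^+ 2 * V) ^+ 2 + 48 * N * (y ^+ 4 * W).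
Proof.
apply: (concentration Pi_iid (e0 := z0)) => //.
- by rewrite mulr_ge0 ?sqr_ge0.
- by rewrite mulr_ge0 ?exprn_ge0.
Qed.

(** Concentration is known for the full sample, whereas the leave-one-out argument needs it with row
    [k] deleted. The two differ by one oscillation after row [k] is resampled. *)
Lemma oscillation_shift (F : n.-tuple (p.-tuple R) -> R) k (X c : R) :
  bounded_measurable F -> oscillation_le nu z0 2 F k X ->
  \int[Pi]_s ((F (upd s k z0) - c) ^+ 2) <=
    2 * \int[Pi]_s ((F s - c) ^+ 2) + 2 * X.
Proof.
move=> bF FX.
have bc d (T : measurableType d) (a : R) : bounded_measurable (fun _ : T => a).
  exact: bounded_measurable_cst.
have bF0 : bounded_measurable (fun s => F (upd s k z0)).
  by apply: (bounded_measurable_comp bF); exact: measurable_upd.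
have bFc : bounded_measurable (fun s => (F s - c) ^+ 2).
  by apply: bounded_measurableX; exact: bounded_measurableB.
rewrite (resampling_bounded Pi_iid k bFc) -RintegralZl_bounded; last first.
  exact: (bounded_averaged _ k bFc).
rewrite -[2 * X](Rintegral_prob_cst Pi) -RintegralD_bounded//; last first.
  by apply: bounded_measurableM => //; exact: (bounded_averaged _ k bFc).
apply: le_Rintegral_bounded.
- by apply: bounded_measurableX; exact: bounded_measurableB.
- apply: bounded_measurableD => //; apply: bounded_measurableM => //.
  exact: (bounded_averaged _ k bFc).
move=> s.
have b1 : bounded_measurable (fun u => (F (upd s k u) - c) ^+ 2).
  exact: (bounded_measurable_upd _ _ bFc).
have b2 : bounded_measurable (fun u => (F (upd s k u) - F (upd s k z0)) ^+ 2).
  apply: bounded_measurableX; apply: bounded_measurableB => //.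
  exact: bounded_measurable_upd.
apply: (@le_trans _ _ (\int[nu]_u (2 * (F (upd s k u) - c) ^+ 2
   + 2 * (F (upd s k u) - F (upd s k z0)) ^+ 2))).
  rewrite -[leLHS](Rintegral_prob_cst nu); apply: le_Rintegral_bounded => //.
    by apply: bounded_measurableD; exact: bounded_measurableM.
  move=> u; set a := F (upd s k u); set b := F (upd s k z0).
  rewrite -subr_ge0 (_ : _ - _ = (2 * a - b - c) ^+ 2) ?sqr_ge0//; ring.
rewrite RintegralD_bounded; [|exact: bounded_measurableM|exact: bounded_measurableM].
by rewrite !RintegralZl_bounded// lerD2l ler_wpM2l.
Qed.

(** The same transfer for means. Young's inequality with weight [t] bounds the first absolute moment
    by the second moment, the only one that [oscillation_le] controls here. *)
Lemma oscillation_mean_shift (F : n.-tuple (p.-tuple R) -> R) k (X t : R) :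
  bounded_measurable F -> oscillation_le nu z0 2 F k X -> 0 < t ->
  `|\int[Pi]_s F (upd s k z0) - \int[Pi]_s F s| <= (t + X / t) / 2.
Proof.
move=> bF FX t0; have ti0 : 0 <= t^-1 by rewrite invr_ge0 ltW.
have bF0 : bounded_measurable (fun s => F (upd s k z0)).
  by apply: (bounded_measurable_comp bF); exact: measurable_upd.
rewrite (resampling_bounded Pi_iid k bF).
have bA : bounded_measurable (averaged nu k F) by exact: bounded_averaged.
have bc d (T : measurableType d) (a : R) : bounded_measurable (fun _ : T => a).
  exact: bounded_measurable_cst.
rewrite -[leRHS](Rintegral_prob_cst Pi).
apply: Rintegral_dist_le; try exact: bounded_integrable.
move=> s; rewrite -[F (upd s k z0)](Rintegral_prob_cst nu).
have b1 : bounded_measurable (fun u => F (upd s k u)).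
  exact: bounded_measurable_upd.
have b2 : bounded_measurable (fun u => (F (upd s k u) - F (upd s k z0)) ^+ 2).
  by apply: bounded_measurableX; exact: bounded_measurableB.
have b3 : bounded_measurable (fun u => (2^-1 * t^-1) *
   (F (upd s k u) - F (upd s k z0)) ^+ 2).
  exact: bounded_measurableM.
apply: (@le_trans _ _ (\int[nu]_u (t / 2 + (2^-1 * t^-1) *
   (F (upd s k u) - F (upd s k z0)) ^+ 2))).
  apply: Rintegral_dist_le; try exact: bounded_integrable.
    by apply: bounded_integrable; exact: bounded_measurableD.
  move=> u; rewrite distrC; apply: le_trans (young_abs _ t0) _.
  by apply/le_eq; field; exact: lt0r_neq0.
rewrite RintegralD_bounded// Rintegral_prob_cst RintegralZl_bounded//.
have -> : (t + X / t) / 2 = t / 2 + 2^-1 * t^-1 * X by field; exact: lt0r_neq0.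
rewrite lerD2l ler_wpM2l//.
by rewrite mulr_ge0.
Qed.

End Mean.

Section DotpBounds.
Context {R : realType} {p : nat}.
Implicit Types (u : p.-tuple R) (b c : 'cV[R]_p).

Lemma dotp_abs_le u c : `|dotp u c| <= (1 + sqnorm2 c) * weight u.
Proof.
have w1 := weight_ge1 u.
have uu : ip (cvec u) (cvec u) <= weight u.
  rewrite /weight /ip (eq_bigr (fun j => tnth u j ^+ 2)) ?lerDr//.
  by move=> j _; rewrite !mxE expr2.
have c0 : 0 <= sqnorm2 c by rewrite sqnorm2_ip ip_ge0.
have H1 := ip_young (cvec u) c (ltr01 : 0 < 1 :> R).
have H2 := ip_young (cvec u) (- c) (ltr01 : 0 < 1 :> R).
rewrite -scaleN1r !ipZr ipZl in H2.
rewrite dotp_ip ler_norml; rewrite -(sqnorm2_ip c) in H1 H2.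
have : 0 <= (weight u - 1) * sqnorm2 c by rewrite mulr_ge0// subr_ge0.
move: H1 H2 uu; set X := ip (cvec u) c; set S := ip (cvec u) (cvec u); set q := sqnorm2 c; set w := weight u.
by move=> *; apply/andP; split; lra.
Qed.

Lemma dotp_mul_abs_le u b c :
  `|dotp u b * dotp u c| <= (1 + sqnorm2 b) * (1 + sqnorm2 c) * weight u ^+ 2.
Proof.
rewrite normrM (_ : _ * _ ^+ 2 = ((1 + sqnorm2 b) * weight u) *
  ((1 + sqnorm2 c) * weight u)); last by ring.
by apply: ler_pM => //; exact: dotp_abs_le.
Qed.

End DotpBounds.

Section MeanEquation.
Context {R : realType} {n p : nat}.
Variables (mu : probability R R) (nu : probability (p.-tuple R) R).
Variable Pi : probability (n.-tuple (p.-tuple R)) R.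
Hypothesis nu_iid : iid_law nu mu.
Hypothesis Pi_iid : iid_law Pi nu.
Hypothesis mu4 : mu.-integrable setT (EFin \o (fun t : R => t ^+ 4)).
Hypothesis mu_mean : \int[mu]_t t = 0.
Hypothesis mu_var : \int[mu]_t (t ^+ 2) = 1.
Hypothesis n_gt0 : (0 < n)%N.
Variables (lam : R) (lam_gt0 : 0 < lam).
Variables (b : 'cV[R]_p) (t : R).
Hypotheses (b1 : sqnorm2 b = 1) (t_gt0 : 0 < t).
Implicit Types (s : n.-tuple (p.-tuple R)) (u : p.-tuple R) (c : 'cV[R]_p)
  (k : 'I_n).

Let N : R := n%:R.
Let N_gt0 : 0 < N. Proof. by rewrite ltr0n. Qed.
Let K4 : R := 4 + 3 * m4 mu.
Let K2 : R := 10 + 2 * m4 mu.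
Let y : R := p%:R / N.
Let V := osc2 (n := n) mu lam.
Let V_ge0 : 0 <= V. Proof. exact: osc2_ge0. Qed.
Let z0 : p.-tuple R := zrow.
Let res s := invmx (sgram lam s).
Let tau := mean_resolvent (n := n) (p := p) lam.
Let Q := Qform (n := n) lam b.
Let g := \int[Pi]_s tau s.
Let h := \int[Pi]_s Q s.

Let f k s := dotp (tnth s k) (res s *m b) * dotp (tnth s k) b.

(** Pair [b] with [M (M^-1 b) = b] and split [M] into its shift and its rank-one terms; [f k] is the
    contribution of row [k]. *)
Lemma resolvent_identity s : lam * Q s + N^-1 * \sum_k f k s = 1.
Proof.
have := coercive_mulK lam_gt0 b (sgram_coercive lam s).
move=> /(congr1 (ip b)); rewrite -sqnorm2_ip b1 => <-.
rewrite /sgram mulmxDl mul_scalar_mx ipDr ipZr -/(sgram lam s) addrC; congr (_ + _).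
rewrite -scalemxAl ipZr outer_sum mulmx_suml; congr (_ * _).
rewrite /ip (eq_bigr (fun j => \sum_k b j 0 *
   (ip (cvec (tnth s k)) (res s *m b) * cvec (tnth s k) j 0))); last first.
  move=> j _; rewrite summxE mulr_sumr; apply: eq_bigr => k _.
  by rewrite mulmx_outer mxE.
rewrite exchange_big/=; apply: eq_bigr => k _.
rewrite /f !dotp_ip [ip _ b]/ip mulr_sumr; apply: eq_bigr => j _.
by ring.
Qed.

Let li0 : 0 <= lam^-1. Proof. by rewrite invr_ge0 ltW. Qed.
Let Ni0 : 0 <= N^-1. Proof. by rewrite invr_ge0 ltW. Qed.

Let res_norm s : sqnorm2 (res s *m b) <= lam^-1 ^+ 2.
Proof. exact: resolvent_norm. Qed.

Let Cf : R := (1 + lam^-1 ^+ 2) * (1 + 1).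

Let f_le k s : `|f k s| <= Cf * weight (tnth s k) ^+ 2.
Proof.
apply: le_trans (dotp_mul_abs_le _ _ _) _; rewrite b1.
by rewrite ler_wpM2r ?sqr_ge0// ler_wpM2r// lerD2l.
Qed.

Let measurable_dotp_fun d (T : measurableType d) (x : T -> p.-tuple R)
    (v : T -> 'cV[R]_p) : measurable_fun setT x -> mx_measurable v ->
  measurable_fun setT (fun w => dotp (x w) (v w)).
Proof.
move=> mx mv; apply: measurable_sum => j; apply: measurable_funM => //.
by apply: (measurableT_comp (measurable_tnth j)).
Qed.

Let measurable_f k d (T : measurableType d) (x : T -> n.-tuple (p.-tuple R)) :
  measurable_fun setT x -> measurable_fun setT (fun w => f k (x w)).
Proof.
move=> mx.
have mk : measurable_fun setT (fun w => tnth (x w) k).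
  by apply: (measurableT_comp (measurable_tnth k)).
apply: measurable_funM; apply: measurable_dotp_fun => //.
exact: mx_measurable_resolvent.
Qed.

Let weight2_dominated : dominated 2 (fun u => weight u ^+ 2).
Proof.
split; first by apply: measurable_funX; exact: measurable_weight.
by exists 1 => // u; rewrite mul1r ger0_norm// sqr_ge0.
Qed.

Let f_integrable k : Pi.-integrable setT (EFin \o f k).
Proof.
have mw : measurable_fun setT (fun s : n.-tuple (p.-tuple R) => weight (tnth s k) ^+ 2).
  apply: measurable_funX; apply: (measurableT_comp measurable_weight).
  exact: measurable_tnth.
have iw : Pi.-integrable setT (EFin \o (fun s => weight (tnth s k) ^+ 2)).
  apply/integrableP; split; first exact/measurable_EFinP.
  rewrite (resampling_ge0 Pi_iid k); last 2 first.
  - by apply: measurableT_comp => //; exact/measurable_EFinP.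
  - by [].
  have /integrableP[_ H] := dominated_integrable nu_iid mu4 weight2_dominated.
  under eq_integral do under eq_integral do rewrite /= tnth_upd eqxx.
  rewrite integral_cst// [X in (_ * X)%E](probability_setT Pi) mule1.
  exact: H.
apply: le_integrable (integrableZl_real Cf iw) => //.
  by apply/measurable_EFinP; exact: (measurable_f k (x := id)).
move=> s _; rewrite /= lee_fin (le_trans (f_le k s))//.
by rewrite ler_norm.
Qed.

Let f_upd_dominated k s : dominated 2 (fun u => f k (upd s k u)).
Proof.
split; first by apply: measurable_f; exact: measurable_upd.
exists Cf; first by rewrite mulr_ge0// addr_ge0// sqr_ge0.
by move=> u; have := f_le k (upd s k u); rewrite tnth_upd eqxx.
Qed.

Let g_ge0 : 0 <= g.
Proof. by apply: Rintegral_ge0 => s _; exact: mean_resolvent_ge0. Qed.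

(** The three parts are the fourth moments of the linear forms, the variance of [x^T G x / n] about
    its trace, and the deviation of that trace from the constant [g]. *)
Let row_err (tz : R) : R := t / 4 * (K4 * (lam^-1 ^+ 4 + 1))
  + t^-1 * (N^-1 ^+ 2 * (K2 * (p%:R * lam^-1 ^+ 2))) + t^-1 * (tz - g) ^+ 2.

(** With the other rows frozen, Sherman-Morrison writes the term of row [k] as
    [(u.c)(u.b) / (1 + a u)], where [c] and the form [a] involve the leave-one-out resolvent only.
    Replacing [a u] by the constant [g] costs at most [|a u - g|] times the numerator, whose mean is
    [c.b], that is, the leave-one-out value of [Q]. *)
Let inner k s : `|\int[nu]_u f k (upd s k u) - Q (upd s k z0) / (1 + g)| <=
  row_err (tau (upd s k z0)).
Proof.
set s0 := upd s k z0; set c := res s0 *m b.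
have g1 : 0 < 1 + g by rewrite ltr_pwDl.
pose a u := N^-1 * quadp (res s0) u.
have a_ge0 u : 0 <= a u.
  rewrite mulr_ge0// quadp_ip; apply: (coercive_inv_ge0 lam_gt0).
  exact: sgram_coercive.
have fE u : f k (upd s k u) = dotp u c * dotp u b / (1 + a u).
  rewrite /f tnth_upd eqxx !dotp_ip /res (sgram_upd lam s k u).
  rewrite (rank_one_form lam_gt0)//; last exact: sgram_coercive.
  by rewrite /a quadp_ip mulrAC.
have d1 v w : dominated 2 (fun u => dotp u v * dotp u w).
  by apply: dominatedM; exact: dominated_dotp.
have intd F : dominated 2 F -> nu.-integrable setT (EFin \o F).
  exact: (dominated_integrable nu_iid mu4).
have -> : Q s0 / (1 + g) = \int[nu]_u ((1 + g)^-1 * (dotp u c * dotp u b)).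
  rewrite RintegralZl//; last exact: intd.
  rewrite (dotp_bilin nu_iid mu4 mu_mean mu_var) mulrC; congr (_ * _).
  by rewrite /Q /Qform ipC.
have d4 v : dominated 2 (fun u => dotp u v ^+ 4).
  under eq_fun do rewrite (exprM _ 2 2) expr2.
  by apply: dominatedM; exact: dominated_dotp_sqr.
have dq : dominated 2 (fun u => (quadp (res s0) u - \tr (res s0)) ^+ 2).
  under eq_fun do rewrite expr2.
  suff : dominated 1 (quadp (res s0)).
    by move=> H; apply: dominatedM; apply: dominatedB => //; exact: dominated_cst.
  apply: dominated_sum => i; apply: dominated_sum => j.
  under eq_fun do rewrite mulrAC mulrC.
  by apply: dominatedZ; exact: dominated_coordM.
pose U1 u := t / 4 * (dotp u c ^+ 4 + dotp u b ^+ 4).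
pose U2 u := (t^-1 * N^-1 ^+ 2) * (quadp (res s0) u - \tr (res s0)) ^+ 2.
pose C := t^-1 * (tau s0 - g) ^+ 2.
have i4 v : nu.-integrable setT (EFin \o (fun u => dotp u v ^+ 4)) by exact: intd.
have iU1 : nu.-integrable setT (EFin \o U1).
  by apply: integrableZl_real; exact: integrableD_real.
have iU2 : nu.-integrable setT (EFin \o U2).
  by apply: integrableZl_real; exact: intd.
have iC : nu.-integrable setT (EFin \o (fun=> C)).
  by apply: intd; exact: dominated_cst.
apply: (@le_trans _ _ (\int[nu]_u (U1 u + U2 u + C))).
  apply: Rintegral_dist_le.
  - by apply: intd; exact: f_upd_dominated.
  - by apply: integrableZl_real; exact: intd.
  - by apply: integrableD_real => //; exact: integrableD_real.
  move=> u; rewrite fE; set x := dotp u c; set w := dotp u b.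
  have a1 : 0 < 1 + a u by rewrite ltr_pwDl.
  have -> : x * w / (1 + a u) - (1 + g)^-1 * (x * w) =
     (x * w) * ((g - a u) / ((1 + a u) * (1 + g))).
    by field; apply/andP; split; exact: lt0r_neq0.
  rewrite normrM.
  have le1 : `|(g - a u) / ((1 + a u) * (1 + g))| <= `|a u - g|.
    rewrite normrM distrC ler_piMr// normfV invf_le1.
      rewrite ger0_norm; last by rewrite mulr_ge0 ?(ltW a1) ?(ltW g1).
      have := a_ge0 u; have := mulr_ge0 (a_ge0 u) g_ge0; have := g_ge0; nra.
    by rewrite normr_gt0 mulf_neq0// lt0r_neq0.
  apply: (@le_trans _ _ (`|x * w| * `|a u - g|)); first by rewrite ler_wpM2l.
  have tE : tau s0 = N^-1 * \tr (res s0) by rewrite /tau mean_resolvent_trace.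
  rewrite -normrM.
  (* Weighted Young: the product of the linear forms is only bounded in mean square, so it is
     charged to the small weight [t], and the concentrating difference to [1/t]. *)
  apply: (@le_trans _ _ (t / 2 * (x * w) ^+ 2 + t^-1 / 2 * (a u - g) ^+ 2)).
    rewrite ler_norml.
    have H1 : 0 <= (t * (x * w) - (a u - g)) ^+ 2 / t by rewrite divr_ge0 ?sqr_ge0// ltW.
    have H2 : 0 <= (t * (x * w) + (a u - g)) ^+ 2 / t by rewrite divr_ge0 ?sqr_ge0// ltW.
    have E1 : (t * (x * w) - (a u - g)) ^+ 2 / t = t * (x * w) ^+ 2 + t^-1 * (a u - g) ^+ 2
       - 2 * (x * w * (a u - g)) by field; exact: lt0r_neq0.
    have E2 : (t * (x * w) + (a u - g)) ^+ 2 / t = t * (x * w) ^+ 2 + t^-1 * (a u - g) ^+ 2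
       + 2 * (x * w * (a u - g)) by field; exact: lt0r_neq0.
    rewrite E1 in H1; rewrite E2 in H2.
    by apply/andP; split; lra.
  rewrite /U1 /U2 /C -/x -/w -addrA; apply: lerD.
    rewrite [leRHS](_ : _ = t / 2 * ((x ^+ 4 + w ^+ 4) / 2)); last by field.
    rewrite ler_wpM2l ?divr_ge0 ?(ltW t_gt0)//.
    rewrite -subr_ge0 (_ : _ - _ = (x ^+ 2 - w ^+ 2) ^+ 2 / 2); last by field.
    by rewrite divr_ge0 ?sqr_ge0.
  have -> : t^-1 * N^-1 ^+ 2 * (quadp (res s0) u - \tr (res s0)) ^+ 2 =
     t^-1 * (a u - tau s0) ^+ 2 by rewrite tE /a; ring.
  rewrite -mulrDr -mulrA ler_wpM2l ?invr_ge0 ?(ltW t_gt0)//.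
  set A := a u; set B := tau s0.
  rewrite -subr_ge0 (_ : _ - _ = (A - 2 * B + g) ^+ 2 / 2); last by field.
  by rewrite divr_ge0 ?sqr_ge0.
rewrite RintegralD//; last exact: integrableD_real.
rewrite RintegralD// Rintegral_prob_cst /row_err lerD2r; apply: lerD.
  rewrite RintegralZl//; last exact: integrableD_real.
  rewrite ler_wpM2l ?divr_ge0 ?(ltW t_gt0)// RintegralD// mulrDr mulr1.
  have K40 : 0 <= K4 by rewrite addr_ge0// mulr_ge0// m4_ge0.
  apply: lerD; apply: le_trans (dotp_moment4 nu_iid mu4 mu_mean mu_var _) _;
    rewrite -/K4 ?b1 ?expr1n ?mulr1// ler_wpM2l//.
  rewrite (_ : lam^-1 ^+ 4 = (lam^-1 ^+ 2) ^+ 2); last by rewrite -exprM.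
  rewrite ler_sqr ?nnegrE ?sqr_ge0//; first exact: res_norm.
  by rewrite sqnorm2_ip ip_ge0.
rewrite RintegralZl//; last exact: intd.
rewrite -mulrA ler_wpM2l ?invr_ge0 ?(ltW t_gt0)// ler_wpM2l ?sqr_ge0//.
have sym : (res s0)^T = res s0 by rewrite /res trmx_inv (sgram_coercive lam s0).1.
apply: le_trans (quadp_variance nu_iid mu4 mu_mean mu_var sym) _.
rewrite -/K2 ler_wpM2l ?addr_ge0 ?mulr_ge0 ?m4_ge0//.
rewrite exchange_big/= mulr_natl -[in leRHS](card_ord p) -sumr_const.
apply: ler_sum => j _.
have := resolvent_norm (n := n) lam_gt0 s0 (unitv1 j).
apply: le_trans; apply/le_eq; apply: eq_bigr => i _.
by rewrite mulmx_unitv.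
Qed.

(** The last two groups of terms come from going back from the leave-one-out sample to the full one.
    For fixed [t] everything not proportional to [t] is [O(1/n)] as long as [p/n] is bounded. *)
Definition mean_err : R := t / 4 * (K4 * (lam^-1 ^+ 4 + 1))
  + t^-1 * (N^-1 ^+ 2 * (K2 * (p%:R * lam^-1 ^+ 2)))
  + t^-1 * (2 * (N * (y ^+ 2 * V)) + 2 * (y ^+ 2 * V)) + (t + V / t) / 2.

Let row_mean k : `|\int[Pi]_s f k s - h / (1 + g)| <= mean_err.
Proof.
have g1 : 0 < 1 + g by rewrite ltr_pwDl.
have bQ : bounded_measurable Q by exact: bounded_Qform.
have btau : bounded_measurable tau by exact: bounded_mean_resolvent.
have bQ0 : bounded_measurable (fun s => Q (upd s k z0)).
  by apply: (bounded_measurable_comp bQ); exact: measurable_upd.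
have bt0 : bounded_measurable (fun s => (tau (upd s k z0) - g) ^+ 2).
  apply: bounded_measurableX; apply: bounded_measurableB; last first.
    exact: bounded_measurable_cst.
  by apply: (bounded_measurable_comp btau); exact: measurable_upd.
have [|iF ->] := resampling_integrable Pi_iid (k := k) (f_integrable k).
  by move=> s; apply: (dominated_integrable nu_iid mu4); exact: f_upd_dominated.
pose C := t / 4 * (K4 * (lam^-1 ^+ 4 + 1))
  + t^-1 * (N^-1 ^+ 2 * (K2 * (p%:R * lam^-1 ^+ 2))).
have H1 : `|\int[Pi]_s \int[nu]_u f k (upd s k u) -
    \int[Pi]_s ((1 + g)^-1 * Q (upd s k z0))| <=
    C + t^-1 * (2 * (N * (y ^+ 2 * V)) + 2 * (y ^+ 2 * V)).
  apply: (@le_trans _ _ (\int[Pi]_s (C + t^-1 * (tau (upd s k z0) - g) ^+ 2))).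
    apply: Rintegral_dist_le => //.
    - apply: bounded_integrable; apply: bounded_measurableM => //.
      exact: bounded_measurable_cst.
    - apply: bounded_integrable; apply: bounded_measurableD.
        exact: bounded_measurable_cst.
      by apply: bounded_measurableM => //; exact: bounded_measurable_cst.
    by move=> s; rewrite [_^-1 * _]mulrC; exact: inner.
  rewrite RintegralD_bounded; last 2 first.
  - exact: bounded_measurable_cst.
  - by apply: bounded_measurableM => //; exact: bounded_measurable_cst.
  rewrite Rintegral_prob_cst lerD2l RintegralZl_bounded//.
  rewrite ler_wpM2l ?invr_ge0 ?(ltW t_gt0)//.
  have osct : oscillation_le nu z0 2 tau k (y ^+ 2 * V).
    apply: (@mean_resolvent_osc _ _ _ _ n_gt0 _ lam_gt0 1).
      by move=> x; exact: sum_sqr_le.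
    move=> j; apply: (Qform_osc2 nu_iid mu4 mu_mean mu_var) => //.
    exact: unitv1.
  apply: le_trans (oscillation_shift Pi_iid g btau osct) _.
  rewrite lerD2r ler_wpM2l//.
  by have [] := mean_resolvent_concentration nu_iid Pi_iid mu4 mu_mean mu_var n_gt0 lam_gt0.
have H2 : `|\int[Pi]_s ((1 + g)^-1 * Q (upd s k z0)) - h / (1 + g)| <= (t + V / t) / 2.
  rewrite RintegralZl_bounded// mulrC -mulrBl normrM.
  apply: (@le_trans _ _ (`|\int[Pi]_s Q (upd s k z0) - h|)).
    rewrite ler_piMr// ger0_norm ?invr_ge0 ?(ltW g1)//.
    by rewrite invf_le1// lerDl.
  apply: (oscillation_mean_shift Pi_iid) => //.
  exact: (Qform_osc2 nu_iid mu4 mu_mean mu_var).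
apply: le_trans (ler_distD (\int[Pi]_s ((1 + g)^-1 * Q (upd s k z0))) _ _) _.
rewrite /mean_err -/C; exact: lerD.
Qed.

Lemma mean_equation : `|lam * h + h / (1 + g) - 1| <= mean_err.
Proof.
have bQ : bounded_measurable Q by exact: bounded_Qform.
have iQ : Pi.-integrable setT (EFin \o Q) by exact: bounded_integrable.
have isum : Pi.-integrable setT (EFin \o (fun s => \sum_k f k s)).
  rewrite (_ : _ \o _ = (fun s => \sum_(k < n) (f k s)%:E)%E); last first.
    by apply/funext => s; rewrite /= sumEFin.
  by apply: (integrable_sum measurableT) => k _; exact: f_integrable.
have E1 : 1 = lam * h + N^-1 * \sum_k \int[Pi]_s f k s.
  have -> : \sum_k \int[Pi]_s f k s = \int[Pi]_s (\sum_k f k s).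
    rewrite /Rintegral; under [in RHS]eq_integral do rewrite -sumEFin.
    rewrite integral_sum// sum_fine// => k _.
    by apply: integrable_fin_num => //; exact: f_integrable.
  rewrite -!RintegralZl// -RintegralD//; [|exact: integrableZl_real|exact: integrableZl_real].
  rewrite -[LHS](Rintegral_prob_cst Pi); apply: eq_Rintegral => s _.
  by rewrite resolvent_identity.
have N0 : N != 0 by exact: lt0r_neq0.
have -> : lam * h + h / (1 + g) - 1 =
    N^-1 * \sum_(k < n) (h / (1 + g) - \int[Pi]_s f k s).
  rewrite {2}E1 sumrB sumr_const card_ord -mulr_natl mulrBr mulrA -/N mulVf//.
  by ring.
rewrite normrM ger0_norm// mulrC ler_pdivrMr//.
apply: le_trans (ler_norm_sum _ _ _) _.
rewrite mulr_natr -[in leRHS](card_ord n) -sumr_const.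
by apply: ler_sum => k _; rewrite distrC; exact: row_mean.
Qed.

End MeanEquation.

(** * Rates from the entry moments *)

Section EntryLaw.
Context {R : realType}.
Variable mu : probability R R.
Hypotheses (std : standardized_law mu) (fin4 : finite_moment_above mu 4).

Lemma pow_le_moment (e t : R) : 0 <= e -> `|t| ^+ 4 <= 1 + `|t| `^ (4 + e).
Proof.
move=> e0; have [t1|t1] := leP `|t| 1.
  by apply: ler_wpDr; [exact: powR_ge0|rewrite exprn_ile1].
apply: ler_wpDl => //; rewrite -powR_mulrn//.
by apply: ler_powR; [exact: ltW|rewrite lerDl].
Qed.

Let powR_integrable (s : R) : ('E_mu[fun u : R => (`|u| `^ s)%R] < +oo)%E ->
  mu.-integrable setT (EFin \o (fun u : R => `|u| `^ s)).
Proof.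
rewrite unlock => H.
have mp : measurable_fun setT (fun u : R => `|u| `^ s).
  have := measurableT_comp (measurable_powR s) (@normr_measurable R setT).
  by [].
apply/integrableP; split; first exact/measurable_EFinP.
apply: le_lt_trans H; apply: ge0_le_integral => //.
- by apply: measurableT_comp => //; exact/measurable_EFinP.
- exact/measurable_EFinP.
by move=> u _; rewrite /= lee_fin ger0_norm// powR_ge0.
Qed.

Lemma entry4_integrable : mu.-integrable setT (EFin \o (fun t : R => t ^+ 4)).
Proof.
have [e e0 He] := fin4; have ip := powR_integrable He.
have i1 : mu.-integrable setT (EFin \o (fun t : R => 1 + `|t| `^ (4 + e))).
  apply: integrableD_real => //.
  by apply: bounded_integrable; exact: bounded_measurable_cst.
apply: le_integrable i1 => //.
  by apply/measurable_EFinP; exact: measurable_funX.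
move=> t _; rewrite /= lee_fin normrX.
by apply: le_trans (pow_le_moment t (ltW e0)) _; exact: ler_norm.
Qed.

Lemma entry_mean : \int[mu]_t t = 0.
Proof. by have [H _] := std; rewrite unlock in H; rewrite /Rintegral H. Qed.

Lemma entry_var : \int[mu]_t (t ^+ 2) = 1.
Proof.
have [H1 H2] := std; move: H2; rewrite /variance unlock H1 unlock /=.
rewrite /Rintegral => H; rewrite (_ : (\int[mu]_t _)%E = 1%E)//.
rewrite -H; apply: eq_integral => t _ /=; congr (_%:E).
by transitivity ((t - 0) * (t - 0)); [rewrite subr0 expr2|].
Qed.

(** Write [phi L t = t^4 z / (1 + z)] with [z = t^2 / L]. For [0 < del <= 1] one has
    [z / (1 + z) <= z^del], which extracts [L^(-del)] at the price of a moment of order [4 + 2 del].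
    The minimum of [1] and [e / 2] meets both constraints on [del]. *)
Lemma phi_tail_decay : exists2 del : R, 0 < del &
  exists2 M : R, 0 <= M & forall L : R, 0 < L -> phi_tail mu L <= M * L `^ (- del).
Proof.
have [e e0 He] := fin4; have ip := powR_integrable He.
pose del : R := Num.min 1 (e / 2).
have del0 : 0 < del by rewrite lt_min ltr01 divr_gt0.
have del1 : del <= 1 by rewrite ge_min lexx.
have dele : del <= e / 2 by rewrite ge_min lexx orbT.
have i1 : mu.-integrable setT (EFin \o (fun t : R => 1 + `|t| `^ (4 + e))).
  apply: integrableD_real => //.
  by apply: bounded_integrable; exact: bounded_measurable_cst.
exists del => //; exists (\int[mu]_t (1 + `|t| `^ (4 + e))).
  by apply: Rintegral_ge0 => t _; rewrite addr_ge0// powR_ge0.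
move=> L L0; rewrite mulrC -RintegralZl//; apply: le_Rintegral => //.
- exact: (mu_phi_integrable entry4_integrable).
- exact: integrableZl_real.
move=> t _; have Lt := denom_gt0 t L0.
pose z := t ^+ 2 / L.
have z0 : 0 <= z by rewrite divr_ge0 ?sqr_ge0// ltW.
have z1 : 0 < 1 + z by rewrite ltr_pwDl.
have -> : phi L t = t ^+ 4 * (z / (1 + z)).
  have := lt0r_neq0 Lt; rewrite /phi /z => Ln; field.
  by rewrite Ln lt0r_neq0.
have zd : z / (1 + z) <= z `^ del.
  have [zle|zgt] := leP z 1.
    apply: (@le_trans _ _ z).
      by rewrite ler_pdivrMr// ler_peMr// lerDl.
    have [->|zn0] := eqVneq z 0; first exact: powR_ge0.
    by apply: ger1_powR => //; rewrite zle lt_neqAle eq_sym zn0 z0.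
  apply: (@le_trans _ _ 1); first by rewrite ler_pdivrMr// mul1r lerDr.
  rewrite -[leLHS](powRr0 z); apply: ler_powR; exact: ltW.
apply: (@le_trans _ _ (t ^+ 4 * z `^ del)).
  by rewrite ler_wpM2l// exprn_even_ge0.
have -> : z `^ del = (t ^+ 2) `^ del * L `^ (- del).
  rewrite /z powRM ?sqr_ge0 ?invr_ge0 ?(ltW L0)//; congr (_ * _).
  by rewrite -powR_inv1 ?(ltW L0)// -powRrM mulN1r.
rewrite mulrA mulrC ler_wpM2l ?powR_ge0//.
have -> : t ^+ 4 * (t ^+ 2) `^ del = `|t| `^ (4 + 2 * del).
  have [->|tn0] := eqVneq t 0.
    rewrite expr0n mul0r normr0 powR0//.
    by rewrite lt0r_neq0// addr_gt0// mulr_gt0.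
  have t0 : 0 < `|t| by rewrite normr_gt0.
  rewrite powRD; last by rewrite (lt0r_neq0 t0) implybT.
  have -> : t ^+ 2 = `|t| `^ 2 by rewrite powR_mulrn// real_normK ?num_real.
  rewrite -powRrM powR_mulrn//; congr (_ * _).
  by rewrite -normrX ger0_norm// exprn_even_ge0.
have [t1|t1] := leP `|t| 1.
  apply: ler_wpDr; first exact: powR_ge0.
  apply: (@le_trans _ _ (1 `^ (4 + 2 * del))); last by rewrite powR1.
  apply: ge0_ler_powR; rewrite ?nnegrE//.
  by rewrite addr_ge0// mulr_ge0// ltW.
by apply: ler_wpDl => //; apply: ler_powR; [exact: ltW|rewrite lerD2l; lra].
Qed.

End EntryLaw.

Section AlmostSure.
Context {R : realType}.

(** Telescoping form of the integral test. The induction carries the bound with the tail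
    [del^-1 n^(-del)] subtracted; one step reduces to [(c/a)^del >= 1 + del / c] for consecutive
    integers [a] and [c], which follows from [exp x >= 1 + x] and [ln (a/c) <= -1/c]. *)
Lemma powR_series_bound (del : R) (n : nat) : 0 < del ->
  \sum_(k < n) (k.+1%:R^-1 * k.+1%:R `^ (- del)) <= 1 + del^-1.
Proof.
move=> d0.
suff H : \sum_(k < n.+1) (k.+1%:R^-1 * k.+1%:R `^ (- del)) <=
    1 + del^-1 - del^-1 * n.+1%:R `^ (- del) :> R.
  rewrite big_ord_recr /= in H.
  have : 0 <= n.+1%:R^-1 * n.+1%:R `^ (- del) :> R by rewrite mulr_ge0 ?powR_ge0.
  have : 0 <= del^-1 * n.+1%:R `^ (- del) by rewrite mulr_ge0 ?powR_ge0 ?invr_ge0 ?ltW.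
  rewrite -lerBrDr in H => H1 H2; apply: le_trans H _.
  by rewrite lerBlDr; apply: ler_wpDr => //; rewrite lerBlDr; exact: ler_wpDr.
elim: n => [|n IH].
  by rewrite big_ord_recr big_ord0/= add0r !powR1 invr1 !mulr1 addrK.
rewrite big_ord_recr/=; apply: le_trans (lerD IH (lexx _)) _.
set a : R := n.+1%:R; set c : R := n.+2%:R.
have a0 : 0 < a by rewrite ltr0n.
have c0 : 0 < c by rewrite ltr0n.
suff H2 : c^-1 * c `^ (- del) <= del^-1 * (a `^ (- del) - c `^ (- del)).
  move: H2; set A := a `^ _; set C := c `^ _; set D := del^-1; set E := c^-1 => H2; lra.
rewrite [leRHS]mulrC ler_pdivlMr//.
rewrite [leLHS](_ : _ = c `^ (- del) * (del * c^-1)); last by ring.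
have cE : a `^ (- del) = c `^ (- del) * (c / a) `^ del.
  rewrite powRM ?invr_ge0 ?(ltW c0) ?(ltW a0)// mulrA -powRD; last first.
    by rewrite (lt0r_neq0 c0) implybT.
  rewrite addNr powRr0 mul1r -powR_inv1 ?(ltW a0)// -powRrM mulN1r//.
rewrite cE -[X in _ - X]mulr1 -mulrBr ler_wpM2l ?powR_ge0//.
rewrite lerBrDr addrC /powR ifF; last first.
  by apply/negbTE; rewrite mulf_neq0 ?invr_eq0// lt0r_neq0.
apply: le_trans (expR_ge1Dx _); rewrite lerD2l ler_wpM2l ?(ltW d0)//.
have := @le_ln1Dx R (- c^-1); rewrite ltrN2 invf_lt1// ltr1n => /(_ isT).
have -> : 1 - c^-1 = (c / a)^-1.
  rewrite invf_div (_ : a = c - 1); last by rewrite /c -(natr1 n.+1) addrK.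
  by field; exact: lt0r_neq0.
by rewrite lnV ?posrE ?divr_gt0// lerN2.
Qed.

(** Borel-Cantelli in integrated form: the sum of the series has finite mean by monotone
    convergence, so it is finite almost everywhere and its terms tend to zero. *)
Lemma summable_ae_cvg0 d (T : measurableType d) (P : probability T R)
    (f : nat -> T -> R) (e : nat -> R) (B : R) :
  (forall n, measurable_fun setT (f n)) -> (forall n w, 0 <= f n w) ->
  (forall n, (\int[P]_w (f n w)%:E <= (e n)%:E)%E) ->
  (forall n, 0 <= e n) ->
  (forall n, \sum_(k < n) e k <= B) ->
  {ae P, forall w, f ^~ w @ \oo --> (0 : R)}.
Proof.
move=> mf f0 fe e0 eB.
pose F w := (\sum_(n <oo) (f n w)%:E)%E.
have F0 w : (0 <= F w)%E.
  by apply: nneseries_ge0 => n _ _; rewrite lee_fin.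
have mF : measurable_fun setT F.
  by apply: ge0_emeasurable_sum => [n w _ _|n _]; [rewrite lee_fin|exact/measurable_EFinP].
have iF : P.-integrable setT F.
  apply/integrableP; split => //.
  apply: (@le_lt_trans _ _ B%:E); last exact: ltry.
  rewrite (eq_integral F); last by move=> w _; rewrite gee0_abs.
  rewrite integral_nneseries//; last 2 first.
  - by move=> n; exact/measurable_EFinP.
  - by move=> n w _; rewrite lee_fin.
  apply: lime_le.
    by apply: is_cvg_nneseries => n _ _; apply: integral_ge0 => w _; rewrite lee_fin.
  apply: nearW => n; rewrite big_mkord.
  apply: (@le_trans _ _ (\sum_(k < n) (e k)%:E)%E); first exact: lee_sum.
  by rewrite sumEFin lee_fin.
have := integrable_ae measurableT iF.
apply: filterS => w /(_ I) Fw.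
have cs : cvgn (series (f ^~ w)).
  apply: nondecreasing_is_cvgn; first exact: nondecreasing_series.
  exists (fine (F w)) => _ [n _ <-].
  rewrite -lee_fin fineK// /series/= -sumEFin.
  by apply: nneseries_lim_ge => k _ _; rewrite lee_fin.
exact: cvg_series_cvg_0.
Qed.

End AlmostSure.

(** * The Marchenko-Pastur transform *)

Section MPStieltjes.
Context {R : realType}.
Variables (gamma : R) (gamma_gt0 : 0 < gamma).
Implicit Types lam : R.

Definition mp lam : R := mp_stieltjes gamma (- lam).

Definition mp_sqrt lam : R :=
  Num.sqrt ((1 - gamma + lam) ^+ 2 + 4 * gamma * lam).

Lemma mp_discr_gt lam : 0 < lam ->
  (1 - gamma + lam) ^+ 2 < (1 - gamma + lam) ^+ 2 + 4 * gamma * lam.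
Proof. by move=> l0; rewrite ltrDl !mulr_gt0. Qed.

Lemma mp_discr_gt0 lam : 0 < lam -> 0 < (1 - gamma + lam) ^+ 2 + 4 * gamma * lam.
Proof. by move=> l0; apply: le_lt_trans (mp_discr_gt l0); exact: sqr_ge0. Qed.

Lemma mpE lam : 0 < lam ->
  mp lam = (mp_sqrt lam - (1 - gamma + lam)) / (2 * gamma * lam).
Proof.
move=> l0; rewrite /mp /mp_stieltjes /mp_sqrt opprK mulrN opprK.
by field; apply/andP; split; exact: lt0r_neq0.
Qed.

Lemma mp_sqrtE lam : 0 < lam -> mp_sqrt lam = 2 * gamma * lam * mp lam + (1 - gamma + lam).
Proof.
move=> l0; rewrite mpE//; field.
by apply/andP; split; exact: lt0r_neq0.
Qed.

Lemma mp_gt0 lam : 0 < lam -> 0 < mp lam.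
Proof.
move=> l0; rewrite mpE// divr_gt0 ?mulr_gt0// subr_gt0.
apply: le_lt_trans (ler_norm _) _.
rewrite -sqrtr_sqr ltr_sqrt; first exact: mp_discr_gt.
exact: mp_discr_gt0.
Qed.

Lemma mp_quadratic lam : 0 < lam ->
  gamma * lam * mp lam ^+ 2 + (1 - gamma + lam) * mp lam = 1.
Proof.
move=> l0; have := sqr_sqrtr (ltW (mp_discr_gt0 l0)).
rewrite -/(mp_sqrt lam) mp_sqrtE//; set m := mp lam => H.
have H2 : 4 * gamma * lam * (gamma * lam * m ^+ 2 + (1 - gamma + lam) * m - 1) = 0.
  by apply/eqP; rewrite -[_ == 0](subr_eq0) subr0; apply/eqP; move: H; lra.
have : 4 * gamma * lam != 0 by rewrite lt0r_neq0// !mulr_gt0.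
move: H2 => /eqP; rewrite mulf_eq0 => /orP[/eqP->|]; first by rewrite eqxx.
by rewrite subr_eq0 => /eqP.
Qed.

(** The quadratic equation rearranged into the limit of the leave-one-out equation, with [h = m] and
    [g = gamma m]. *)
Lemma mp_fixpoint lam : 0 < lam ->
  lam * mp lam + mp lam / (1 + gamma * mp lam) = 1.
Proof.
move=> l0; have := mp_quadratic l0; have m0 := mp_gt0 l0; set m := mp lam in m0 * => H.
have gm : 0 < 1 + gamma * m by rewrite addr_gt0// mulr_gt0.
apply: (mulIf (lt0r_neq0 gm)); rewrite mulrDl divfK ?lt0r_neq0// mul1r.
by move: H; lra.
Qed.

End MPStieltjes.

Section Sequence.
Context {R : realType}.
Variables (mu : probability R R) (gamma : R) (p : nat -> nat).
Hypotheses (std : standardized_law mu) (fin4 : finite_moment_above mu 4).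
Hypothesis gamma_gt0 : 0 < gamma.
Hypothesis p_cvg : (fun n => (p n)%:R / n%:R : R) @ \oo --> gamma.
Context {d : measure_display} {T : measurableType d}.
Variable P : probability T R.
Variable nu : forall n, probability ((p n).-tuple R) R.
Variable X : forall n, {RV P >-> n.-tuple ((p n).-tuple R)}.
Hypothesis nu_iid : forall n, (0 < n)%N -> iid_law (nu n) mu.
Hypothesis X_iid : forall n, (0 < n)%N -> iid_law (distribution P (X n)) (nu n).

Let Pi n : probability (n.-tuple ((p n).-tuple R)) R := distribution P (X n).
Let y n : R := (p n)%:R / n%:R.
Let mu4 := entry4_integrable fin4.
Let mu1 := entry_mean std.
Let mu2 := entry_var std.

Lemma ratio_bounded : exists2 Y, 0 <= Y & forall n, y n <= Y.
Proof.
have [M [Mr HM]] := cvg_seq_bounded (cvgP gamma p_cvg).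
exists (`|M| + 1); first by rewrite addr_ge0.
move=> n; apply: le_trans (ler_norm _) _.
by apply: (HM (`|M| + 1)) => //; rewrite (le_lt_trans (ler_norm _))// ltrDl.
Qed.

Section Fixed.
Variables (lam : R) (lam_gt0 : 0 < lam).

Let m := mp gamma lam.

(** [A] is the total coefficient of [t] in [mean_err], and [t] is chosen so that [t A = e / 2]; the
    rest is at most [C / n], where [Y] bounds the ratios [p / n]. *)
Lemma mean_err_small (e : R) : 0 < e -> exists2 t, 0 < t &
  \forall n \near \oo, mean_err (n := n) (p := p n) mu lam t <= e.
Proof.
move=> e0; pose K4 := 4 + 3 * m4 mu; pose K2 := 10 + 2 * m4 mu.
have m40 := m4_ge0 mu.
have K40 : 0 <= K4 by rewrite /K4; lra.
have K20 : 0 <= K2 by rewrite /K2; lra.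
have li0 : 0 <= lam^-1 by rewrite invr_ge0 ltW.
pose A := K4 * (lam^-1 ^+ 4 + 1) / 4 + 1 / 2.
have A0 : 0 < A.
  by rewrite ltr_wpDl// divr_ge0// mulr_ge0// addr_ge0// exprn_ge0.
pose t := e / 2 / A.
have t0 : 0 < t by rewrite !divr_gt0.
have [Y Y0 HY] := ratio_bounded.
pose K := K4 / lam ^+ 4.
have K0 : 0 <= K by rewrite divr_ge0// exprn_ge0// ltW.
pose C := t^-1 * (K2 * lam^-1 ^+ 2 * Y + 4 * (Y ^+ 2 * K) + K / 2).
have C0 : 0 <= C.
  rewrite mulr_ge0 ?invr_ge0 ?(ltW t0)//; apply: addr_ge0; last exact: divr_ge0.
  apply: addr_ge0; first by rewrite mulr_ge0// mulr_ge0// sqr_ge0.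
  by rewrite mulr_ge0// mulr_ge0// sqr_ge0.
exists t => //.
near=> n.
have n0 : (0 < n)%N by near: n; exists 1%N.
have N0 : 0 < n%:R :> R by rewrite ltr0n.
pose u : R := n%:R^-1.
have u0 : 0 <= u by rewrite invr_ge0 ltW.
have u1 : u <= 1 by rewrite invf_le1// ler1n.
have uC : u * C <= e / 2.
  rewrite mulrC ler_pdivrMr//.
  rewrite mulrC -ler_pdivrMr ?divr_gt0//.
  near: n; exists (Num.truncn (C / (e / 2))).+1 => // k /= tk.
  apply: ltW; apply: lt_le_trans (truncnS_gt _) _.
  by rewrite ler_nat.
have y0 : 0 <= y n by rewrite divr_ge0.
have yY := HY n.
have yY2 : y n ^+ 2 <= Y ^+ 2 by rewrite ler_sqr ?nnegrE.
have u2 : u ^+ 2 <= u by rewrite expr2 ler_piMl.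
have -> : mean_err (n := n) (p := p n) mu lam t = t * A +
   t^-1 * (K2 * lam^-1 ^+ 2 * (y n * u) + 2 * (y n ^+ 2 * (K * u))
     + 2 * (y n ^+ 2 * (K * u ^+ 2)) + K * u ^+ 2 / 2).
  rewrite /mean_err /osc2 -/K4 -/K2 /A /y /u /K; field.
  by rewrite !lt0r_neq0.
have -> : e = t * A + e / 2 by rewrite /t; field; exact: lt0r_neq0.
rewrite lerD2l; apply: le_trans uC.
have -> : u * C = t^-1 * (K2 * lam^-1 ^+ 2 * (Y * u) + 2 * (Y ^+ 2 * (K * u))
   + 2 * (Y ^+ 2 * (K * u)) + K * u / 2) by rewrite /C; ring.
rewrite ler_wpM2l ?invr_ge0 ?(ltW t0)//.
have H1 : K2 * lam^-1 ^+ 2 * (y n * u) <= K2 * lam^-1 ^+ 2 * (Y * u).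
  by rewrite ler_wpM2l ?mulr_ge0 ?sqr_ge0// ler_wpM2r.
have H2 : y n ^+ 2 * (K * u) <= Y ^+ 2 * (K * u) by apply: ler_wpM2r => //; exact: mulr_ge0.
have H3 : y n ^+ 2 * (K * u ^+ 2) <= Y ^+ 2 * (K * u).
  apply: ler_pM => //; [exact: sqr_ge0|by rewrite mulr_ge0// sqr_ge0|].
  exact: ler_wpM2l.
have H4 : K * u ^+ 2 <= K * u by exact: ler_wpM2l.
apply: lerD; last by apply: ler_wpM2r; rewrite ?invr_ge0.
by apply: lerD; [apply: lerD => //|]; apply: ler_wpM2l.
Unshelve. all: by end_near. Qed.

Let g n := \int[Pi n]_s mean_resolvent (n := n) (p := p n) lam s.

Let g_ge0 n : (0 < n)%N -> 0 <= g n.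
Proof. by move=> n0; apply: Rintegral_ge0 => s _; exact: mean_resolvent_ge0. Qed.

(** Sum of the equations for the [p] unit vectors divided by [n]. The right-hand sides [1] add up to
    [p / n], and the unknown [h] averages to [g], which closes the equation. *)
Lemma mean_trace_equation n t : (0 < n)%N -> 0 < t ->
  `|lam * g n + g n / (1 + g n) - y n| <= y n * mean_err (n := n) (p := p n) mu lam t.
Proof.
move=> n0 t0; have N0 : 0 < n%:R :> R by rewrite ltr0n.
pose h j := \int[Pi n]_s Qform (n := n) lam (unitv j : 'cV[R]_(p n)) s.
have gE : g n = n%:R^-1 * \sum_j h j.
  have iQ (j : 'I_(p n)) :
      (Pi n).-integrable setT (EFin \o Qform (n := n) lam (unitv j)).
    by apply: bounded_integrable; exact: bounded_Qform.
  have isum : (Pi n).-integrable setT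
      (EFin \o (fun s => \sum_j Qform (n := n) lam (unitv j : 'cV[R]_(p n)) s)).
    rewrite (_ : _ \o _ = (fun s => \sum_(j < p n)
       (Qform lam (unitv j : 'cV[R]_(p n)) s)%:E)%E); last first.
      by apply/funext => s; rewrite /= sumEFin.
    by apply: (integrable_sum measurableT) => j _; exact: iQ.
  rewrite /g /mean_resolvent RintegralZl//; congr (_ * _).
  rewrite /Rintegral; under [in LHS]eq_integral do rewrite -sumEFin.
  rewrite integral_sum// sum_fine// => j _.
  by apply: integrable_fin_num => //; exact: iQ.
have -> : lam * g n + g n / (1 + g n) - y n =
    n%:R^-1 * \sum_(j < p n) (lam * h j + h j / (1 + g n) - 1).
  rewrite sumrB big_split/= -mulr_sumr -mulr_suml sumr_const card_ord.
  by rewrite {1 2}gE /y; ring.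
rewrite normrM ger0_norm ?invr_ge0 ?(ltW N0)// mulrC ler_pdivrMr//.
apply: le_trans (ler_norm_sum _ _ _) _.
rewrite [leRHS](_ : _ = (p n)%:R * mean_err (n := n) (p := p n) mu lam t); last first.
  by rewrite /y; field; exact: lt0r_neq0.
set E := mean_err _ _ _.
rewrite mulr_natl -[in leRHS](card_ord (p n)) -sumr_const; apply: ler_sum => j _.
exact: (mean_equation (nu_iid n0) (X_iid n0) mu4 mu1 mu2 n0 lam_gt0 (unitv1 j) t0).
Qed.

(** No compactness is involved: on nonnegative arguments, [x -> lam x + x / (1 + x)] expands
    distances by at least [lam], so [g n], which nearly solves the equation, is near its exact
    solution [gamma m]. *)
Lemma mean_trace_cvg : g @ \oo --> gamma * m.
Proof.
have m0 : 0 < m by exact: mp_gt0.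
have gm0 : 0 < gamma * m by exact: mulr_gt0.
have psi_m : lam * (gamma * m) + (gamma * m) / (1 + gamma * m) = gamma.
  transitivity (gamma * (lam * m + m / (1 + gamma * m))); first by ring.
  by rewrite mp_fixpoint// mulr1.
have [Y Y0 HY] := ratio_bounded.
apply/cvgrPdist_le => e e0.
(* The error is going to be multiplied by [y n <= Y]; [Y + 1] keeps the divisor positive. *)
have e1 : 0 < lam * e / 2 / (Y + 1) by rewrite !divr_gt0 ?mulr_gt0// ltr_wpDl.
have [t t0 Ht] := mean_err_small e1.
have le2 : 0 < lam * e / 2 by rewrite divr_gt0 ?mulr_gt0.
have /cvgrPdist_le /(_ _ le2) Hy := p_cvg.
near=> n.
have n0 : (0 < n)%N by near: n; exists 1%N.
have H1 : mean_err (n := n) (p := p n) mu lam t <= lam * e / 2 / (Y + 1) by near: n.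
have H2 : `|gamma - y n| <= lam * e / 2 by near: n.
have H3 := mean_trace_equation n0 t0.
have g0 := g_ge0 n0.
have y0 : 0 <= y n by rewrite divr_ge0.
have H4 : y n * mean_err (n := n) (p := p n) mu lam t <= lam * e / 2.
  apply: (@le_trans _ _ (Y * (lam * e / 2 / (Y + 1)))).
    apply: (@le_trans _ _ (y n * (lam * e / 2 / (Y + 1)))); first exact: ler_wpM2l.
    by rewrite ler_wpM2r// ltW.
  rewrite mulrA ler_pdivrMr; last by rewrite ltr_wpDl.
  by rewrite mulrC ler_wpM2l ?(ltW le2)// lerDl.
rewrite -(ler_pM2l lam_gt0).
set a := gamma * m in gm0 psi_m *; set b := g n in g0 H3 *.
apply: (@le_trans _ _ `|lam * a + a / (1 + a) - (lam * b + b / (1 + b))|).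
  have a1 : 0 < 1 + a by rewrite addr_gt0.
  have b1 : 0 < 1 + b by rewrite ltr_pwDl.
  have -> : lam * a + a / (1 + a) - (lam * b + b / (1 + b)) =
     (lam + ((1 + a) * (1 + b))^-1) * (a - b).
    by field; rewrite !lt0r_neq0.
  have q0 : 0 <= ((1 + a) * (1 + b))^-1 by rewrite invr_ge0 mulr_ge0// ltW.
  rewrite normrM (ger0_norm (addr_ge0 (ltW lam_gt0) q0)) ler_wpM2r// lerDl//.
rewrite psi_m.
apply: le_trans (ler_distD (y n) _ _) _.
rewrite [X in _ + X]distrC; lra.
Unshelve. all: by end_near. Qed.

(** Once [g n] converges, the mean equation is linear in [h] with slope at least [lam], so
    comparison with [mp_fixpoint] suffices. *)
Lemma mean_quadratic_cvg (b : forall n, 'cV[R]_(p n)) :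
  (forall n, (0 < n)%N -> sqnorm2 (b n) = 1) ->
  (fun n => \int[Pi n]_s Qform (n := n) lam (b n) s) @ \oo --> m.
Proof.
move=> b1.
have m0 : 0 < m by exact: mp_gt0.
have gm0 : 0 < gamma * m by exact: mulr_gt0.
apply/cvgrPdist_le => e e0.
have e1 : 0 < lam * e / 2 by rewrite divr_gt0// mulr_gt0.
have [t t0 Ht] := mean_err_small e1.
have e2 : 0 < lam * e / 2 / m by rewrite divr_gt0.
have /cvgrPdist_le /(_ _ e2) Hg := mean_trace_cvg.
near=> n.
have n0 : (0 < n)%N by near: n; exists 1%N.
have H1 : mean_err (n := n) (p := p n) mu lam t <= lam * e / 2 by near: n.
have H2 : `|gamma * m - g n| <= lam * e / 2 / m by near: n.
have := mean_equation (nu_iid n0) (X_iid n0) mu4 mu1 mu2 n0 lam_gt0 (b1 n n0) t0.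
have g0 := g_ge0 n0.
rewrite -/(Pi n) -/(g n); set h := \int[_]_s _ => H3.
rewrite -(ler_pM2l lam_gt0).
have H4 : `|lam * h + h / (1 + g n) - 1| <= lam * e / 2 by exact: le_trans H1.
have := mp_fixpoint gamma_gt0 lam_gt0; rewrite -/m.
set a := gamma * m in gm0 H2 *; set b' := g n in g0 H2 H4 * => Hm.
have a1 : 0 < 1 + a by rewrite addr_gt0.
have c1 : 0 < 1 + b' by rewrite ltr_pwDl.
apply: (@le_trans _ _ ((lam + (1 + b')^-1) * `|m - h|)).
  by rewrite ler_wpM2r// lerDl invr_ge0 ltW.
have q0 : 0 <= (1 + b')^-1 by rewrite invr_ge0 ltW.
rewrite -[lam + (1 + b')^-1]ger0_norm; last by rewrite addr_ge0// ltW.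
rewrite -normrM.
have -> : (lam + (1 + b')^-1) * (m - h) =
    m * ((a - b') / ((1 + a) * (1 + b'))) - (lam * h + h / (1 + b') - 1).
  transitivity (m * ((a - b') / ((1 + a) * (1 + b'))) -
      (lam * h + h / (1 + b') - (lam * m + m / (1 + a)))); last by rewrite Hm.
  by field; rewrite !lt0r_neq0.
apply: le_trans (ler_normB _ _) _.
have -> : lam * e = lam * e / 2 + lam * e / 2 by field.
apply: lerD => //; rewrite normrM (gtr0_norm m0) mulrC -ler_pdivlMr//.
apply: le_trans H2; rewrite normrM ler_piMr// normfV invf_le1.
  rewrite ger0_norm ?mulr_ge0 ?(ltW a1) ?(ltW c1)//.
  by have := mulr_ge0 (ltW gm0) g0; lra.
by rewrite normr_gt0 mulf_neq0// lt0r_neq0.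
Unshelve. all: by end_near. Qed.

End Fixed.

End Sequence.

(** * Derivative of the transform and the optimal penalty *)

Section MPDerivative.
Context {R : realType}.
Variables (gamma : R) (gamma_gt0 : 0 < gamma).
Implicit Types lam : R.

Let m lam := mp gamma lam.

Lemma mp_le_inv lam : 0 < lam -> lam * m lam < 1.
Proof.
move=> l0; have m0 := mp_gt0 gamma_gt0 l0.
rewrite -(mp_fixpoint gamma_gt0 l0) ltrDl divr_gt0// addr_gt0// mulr_gt0//.
Qed.

(* The spectral meaning of [mp] is an integral of [1 / (s + lam)]; here its
   increments are read off the quadratic equation instead. *)
Lemma mp_increment lam1 lam2 : 0 < lam1 -> 0 < lam2 ->
  m lam1 - m lam2 = (lam2 - lam1) *
    (m lam1 * m lam2 * (1 + gamma * m lam2) / (1 + gamma * lam1 * m lam1 * m lam2)).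
Proof.
move=> l1 l2; have := mp_quadratic gamma_gt0 l1; have := mp_quadratic gamma_gt0 l2.
have := mp_gt0 gamma_gt0 l1; have := mp_gt0 gamma_gt0 l2.
rewrite -/(m lam1) -/(m lam2); move: (m lam1) (m lam2) => x z z0 x0 Hz Hx.
have den : 0 < 1 + gamma * lam1 * x * z by rewrite addr_gt0 ?mulr_gt0.
apply: (mulIf (lt0r_neq0 den)).
rewrite [RHS](_ : _ = (lam2 - lam1) * (x * z * (1 + gamma * z))); last first.
  by field; exact: lt0r_neq0.
have E1 : z * (gamma * lam1 * x ^+ 2 + (1 - gamma + lam1) * x) = z by rewrite Hx mulr1.
have E2 : x * (gamma * lam2 * z ^+ 2 + (1 - gamma + lam2) * z) = x by rewrite Hz mulr1.
by lra.
Qed.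

(** The diagonal value of the quotient in [mp_increment]: minus the derivative of [m] in [lam], that
    is, the derivative of the transform in [z] at [z = -lam]. *)
Definition mp_slope lam : R :=
  m lam ^+ 2 * (1 + gamma * m lam) / (1 + gamma * lam * m lam ^+ 2).

Lemma mp_lipschitz lam1 lam2 : 0 < lam1 -> 0 < lam2 ->
  `|m lam1 - m lam2| <= `|lam2 - lam1| * (m lam2 * (1 + gamma * m lam2) / lam1).
Proof.
move=> l1 l2; rewrite mp_increment// normrM ler_wpM2l//.
have x0 := mp_gt0 gamma_gt0 l1; have z0 := mp_gt0 gamma_gt0 l2.
have lm := mp_le_inv l1; move: x0 z0 lm.
rewrite -/(m lam1) -/(m lam2); move: (m lam1) (m lam2) => x z x0 z0 lm.
have w0 : 0 < 1 + gamma * z by rewrite addr_gt0// mulr_gt0.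
have den : 1 <= 1 + gamma * lam1 * x * z by rewrite lerDl !mulr_ge0// ltW.
have den0 : 0 < 1 + gamma * lam1 * x * z by exact: lt_le_trans den.
rewrite ger0_norm; last by rewrite divr_ge0 ?ltW// !mulr_gt0.
apply: (@le_trans _ _ (x * z * (1 + gamma * z))).
  rewrite ler_pdivrMr// ler_peMr//.
  by rewrite ltW// !mulr_gt0.
rewrite -!mulrA [leRHS](_ : _ = lam1^-1 * (z * (1 + gamma * z))); last by ring.
rewrite ler_wpM2r ?mulr_ge0 ?(ltW z0) ?(ltW w0)//.
by rewrite -[leRHS]mul1r ler_pdivlMr// mulrC ltW.
Qed.

Lemma mp_continuous lam : 0 < lam -> m (lam - h) @[h --> (0 : R)] --> m lam.
Proof.
move=> l0; apply/cvgrPdist_le => e e0.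
pose C := m lam * (1 + gamma * m lam) / (lam / 2).
have m0 := mp_gt0 gamma_gt0 l0; rewrite -/(m lam) in m0.
have C0 : 0 < C.
  by rewrite divr_gt0 ?divr_gt0// mulr_gt0// addr_gt0// mulr_gt0.
have l2 : 0 < lam / 2 by rewrite divr_gt0.
have eC : 0 < e / C by rewrite divr_gt0.
near=> h.
have h1 : `|h| <= lam / 2.
  by near: h; apply/nbhs_normP; exists (lam / 2) => //= h /=; rewrite sub0r normrN => /ltW.
have h2 : `|h| <= e / C.
  by near: h; apply/nbhs_normP; exists (e / C) => //= h /=; rewrite sub0r normrN => /ltW.
have lh : lam / 2 <= lam - h.
  by move: h1; rewrite ler_norml => /andP[_ ?]; lra.
have lh0 : 0 < lam - h by exact: lt_le_trans lh.
rewrite distrC; apply: le_trans (mp_lipschitz lh0 l0) _.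
rewrite opprB addrCA subrr addr0.
apply: (@le_trans _ _ (`|h| * C)); last by rewrite -ler_pdivlMr.
rewrite ler_wpM2l// /C ler_wpM2l//.
  by rewrite mulr_ge0 ?(ltW m0)// addr_ge0// mulr_ge0 ?(ltW m0)// ltW.
by rewrite lef_pV2.
Unshelve. all: by end_near. Qed.

(** The step is [lam - h] because the derivative is taken in [z = -lam]. The quotient is the
    explicit function [k] of [mp_increment], so continuity of [m] is enough. *)
Lemma mp_quotient_cvg lam : 0 < lam ->
  (h^-1 * (m (lam - h) - m lam)) @[h --> (0 : R)^'] --> mp_slope lam.
Proof.
move=> l0; have m0 := mp_gt0 gamma_gt0 l0; rewrite -/(m lam) in m0.
pose k h := m (lam - h) * m lam * (1 + gamma * m lam) /
   (1 + gamma * (lam - h) * m (lam - h) * m lam).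
have ck : k h @[h --> (0 : R)] --> mp_slope lam.
  have cm := mp_continuous l0.
  have cl : lam - h @[h --> (0 : R)] --> lam.
    rewrite -[X in _ --> X]subr0; apply: cvgB; [exact: cvg_cst|exact: cvg_id].
  have -> : mp_slope lam = m lam * m lam * (1 + gamma * m lam) /
     (1 + gamma * lam * m lam * m lam) by rewrite /mp_slope; congr (_ / _); ring.
  apply: cvgM.
    by do 2 (apply: cvgM; last exact: cvg_cst).
  apply: cvgV.
    by move: (m lam) m0 => x x0; rewrite lt0r_neq0 ?addr_gt0 ?mulr_gt0.
  apply: cvgD; first exact: cvg_cst.
  apply: cvgM; last exact: cvg_cst.
  by apply: cvgM => //; apply: cvgM => //; exact: cvg_cst.
have ck' : k h @[h --> (0 : R)^'] --> mp_slope lam.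
  by apply: cvg_trans ck; apply: cvg_app; exact: cvg_within.
apply: cvg_trans ck'; apply: near_eq_cvg.
near=> h.
have h0 : h != 0 by near: h; exact: nbhs_dnbhs_neq.
have h1 : `|h| < lam.
  near: h; apply: nbhs_dnbhs; apply/nbhs_normP; exists lam => //= h /=.
  by rewrite sub0r normrN.
have lh0 : 0 < lam - h by rewrite subr_gt0 (le_lt_trans (ler_norm _)).
rewrite mp_increment// (_ : lam - (lam - h) = h); last by ring.
by rewrite mulKf.
Unshelve. all: by end_near. Qed.

Lemma mp_derive1 lam : 0 < lam ->
  derive1 (mp_stieltjes gamma) (- lam) = mp_slope lam.
Proof.
move=> l0; rewrite /derive1; apply: cvg_lim => //.
have := mp_quotient_cvg l0; rewrite (_ : (fun h => _) = (fun h : R =>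
  h^-1 *: (mp_stieltjes gamma (h - lam) - mp_stieltjes gamma (- lam))))//.
by apply/funext => h; rewrite /m /mp opprB.
Qed.

Lemma ridge_limit_riskE (r2 s2 : R) lam : 0 < lam ->
  ridge_limit_risk gamma r2 s2 lam = r2 * lam ^+ 2 * mp_slope lam
    + s2 * gamma * (m lam - lam * mp_slope lam).
Proof. by move=> l0; rewrite /ridge_limit_risk mp_derive1. Qed.

Section Optimum.
Variables (r2 s2 : R) (r2_gt0 : 0 < r2) (s2_gt0 : 0 < s2).
Let opt := s2 * gamma / r2.

Let opt_gt0 : 0 < opt.
Proof. by rewrite divr_gt0 ?mulr_gt0. Qed.

Let optE : s2 * gamma = r2 * opt.
Proof. by rewrite /opt; field; exact: lt0r_neq0. Qed.

Lemma ridge_limit_risk_opt :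
  ridge_limit_risk gamma r2 s2 opt = s2 * gamma * mp_stieltjes gamma (- opt).
Proof.
by rewrite ridge_limit_riskE// optE -/(mp gamma opt) /m; ring.
Qed.

(** With [x = m lam] and [z = m opt], the excess risk is a positive multiple of
    [(opt - lam)(x - z)(1 - lam x)]. By [mp_increment] the difference [x - z] has the sign of
    [opt - lam], and [lam x < 1]. *)
Lemma ridge_limit_risk_min :
  minimized_over_pos_at (ridge_limit_risk gamma r2 s2) opt.
Proof.
split=> // lam l0; rewrite ridge_limit_risk_opt ridge_limit_riskE// optE.
rewrite -/(mp gamma opt) -/(m opt) -subr_ge0.
have := mp_increment l0 opt_gt0; have := mp_gt0 gamma_gt0 l0.
have := mp_gt0 gamma_gt0 opt_gt0; have := mp_le_inv l0.
have := mp_quadratic gamma_gt0 l0; have := mp_quadratic gamma_gt0 opt_gt0.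
rewrite /mp_slope -/(m lam) -/(m opt); move: (m lam) (m opt) => x z.
move=> Hz Hx lx z0 x0 inc.
have d1 : 0 < 1 + gamma * lam * x ^+ 2 by rewrite addr_gt0 ?mulr_gt0 ?exprn_gt0.
have d2 : 0 < 1 + gamma * lam * x * z by rewrite addr_gt0 ?mulr_gt0.
set D := x ^+ 2 * _ / _.
have -> : r2 * lam ^+ 2 * D + r2 * opt * (x - lam * D) - r2 * opt * z =
   r2 * (opt * (x - z) + lam * (lam - opt) * D) by ring.
apply: mulr_ge0; first exact: ltW.
(* The two quadratic equations make the numerators affine in [x] and [z], after which the excess
   factors. *)
have Ex : lam * x * (1 + gamma * x) = 1 + (gamma - 1) * x by lra.
have Ez : opt * z * (1 + gamma * z) = 1 + (gamma - 1) * z by lra.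
have -> : opt * (x - z) + lam * (lam - opt) * D =
    (opt - lam) * (x - z) * (x * (1 - gamma + gamma * lam * x)) /
    ((1 + gamma * lam * x ^+ 2) * (1 + gamma * lam * x * z)).
  transitivity ((lam - opt) * (x * ((lam * x * (1 + gamma * x)) / (1 + gamma * lam * x ^+ 2)
      - (opt * z * (1 + gamma * z)) / (1 + gamma * lam * x * z)))).
    by rewrite inc /D; field; rewrite !lt0r_neq0.
  by rewrite Ex Ez; field; rewrite !lt0r_neq0.
apply: divr_ge0; last by rewrite mulr_ge0// ltW.
apply: mulr_ge0; last first.
  rewrite (_ : x * _ = 1 - lam * x); last lra.
  by rewrite subr_ge0 ltW.
rewrite inc mulrA -expr2 mulr_ge0 ?sqr_ge0// divr_ge0 ?(ltW d2)//.
by rewrite ltW// !mulr_gt0// addr_gt0// mulr_gt0.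
Qed.

End Optimum.

End MPDerivative.

(** * Almost sure limits *)

Section AlmostSureLimits.
Context {R : realType}.
Variables (mu : probability R R) (gamma : R) (p : nat -> nat).
Hypotheses (std : standardized_law mu) (fin4 : finite_moment_above mu 4).
Hypothesis gamma_gt0 : 0 < gamma.
Hypothesis p_cvg : (fun n => (p n)%:R / n%:R : R) @ \oo --> gamma.
Context {d : measure_display} {T : measurableType d}.
Variable P : probability T R.
Variable nu : forall n, probability ((p n).-tuple R) R.
Variable X : forall n, {RV P >-> n.-tuple ((p n).-tuple R)}.
Hypothesis nu_iid : forall n, (0 < n)%N -> iid_law (nu n) mu.
Hypothesis X_iid : forall n, (0 < n)%N -> iid_law (distribution P (X n)) (nu n).

Let Pi n : probability (n.-tuple ((p n).-tuple R)) R := distribution P (X n).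
Let mu4 := entry4_integrable fin4.
Let mu1 := entry_mean std.
Let mu2 := entry_var std.

Definition tail_rate (n : nat) : R :=
  n%:R^-1 * n%:R^-1 + n%:R^-1 * phi_tail mu n%:R.

(** The centred fourth powers have summable means by [phi_tail_decay], so they tend to zero almost
    surely, and so does the centred sequence; adding back the means [c] gives the limit. *)
Lemma ae_cvg_of_fourth_moments (F : forall n, n.-tuple ((p n).-tuple R) -> R)
    (c : nat -> R) (C l : R) : 0 <= C ->
  (forall n, (0 < n)%N -> bounded_measurable (F n)) ->
  (forall n, (0 < n)%N ->
     \int[Pi n]_s ((F n s - c n) ^+ 4) <= C * tail_rate n) ->
  c @ \oo --> l ->
  {ae P, forall w, (fun n => F n (X n w)) @ \oo --> l}.
Proof.
move=> C0 bF HF cl.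
have [del d0 [M M0 HM]] := phi_tail_decay fin4.
pose f n w := (F n.+1 (X n.+1 w) - c n.+1) ^+ 4.
have bFc n : (0 < n)%N -> bounded_measurable (fun s => (F n s - c n) ^+ 4).
  move=> n0; apply: bounded_measurableX; apply: bounded_measurableB; first exact: bF.
  exact: bounded_measurable_cst.
(* Indices start at [n + 1] to avoid the empty sample. The term [n^-2] is written as [n^-1] times a
   power with exponent [-1], so that one series bound serves both terms. *)
pose e n : R := C * (n.+1%:R^-1 * n.+1%:R `^ (- 1) + M * (n.+1%:R^-1 * n.+1%:R `^ (- del))).
have e0 n : 0 <= e n.
  by rewrite mulr_ge0// addr_ge0// ?mulr_ge0 ?mulr_ge0 ?powR_ge0 ?invr_ge0.
have := @summable_ae_cvg0 R d T P f e (C * ((1 + 1^-1) + M * (1 + del^-1))).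
case.
- move=> n; have [mF _] := bFc n.+1 isT.
  exact: (measurableT_comp mF).
- by move=> n w; exact: exprn_even_ge0.
- move=> n.
  have -> : (\int[P]_w (f n w)%:E = \int[Pi n.+1]_s ((F n.+1 s - c n.+1) ^+ 4)%:E)%E.
    rewrite ge0_integral_distribution//.
      by apply/measurable_EFinP; case: (bFc n.+1 isT).
    by move=> s; rewrite lee_fin exprn_even_ge0.
  rewrite -[leLHS]fineK; last first.
    by apply: integrable_fin_num => //; apply: bounded_integrable; exact: bFc.
  rewrite lee_fin; apply: le_trans (HF n.+1 isT) _.
  rewrite /e ler_wpM2l// /tail_rate powR_inv1// lerD2l mulrCA ler_wpM2l ?invr_ge0//.
  exact: HM.
- exact: e0.
- move=> n; rewrite -mulr_sumr ler_wpM2l// big_split/= -mulr_sumr.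
  apply: lerD; first exact: powR_series_bound.
  by rewrite ler_wpM2l// powR_series_bound.
move=> A [mA PA HA]; exists A; split => // w /= nw; apply: HA => /= fw; apply: nw.
rewrite -[X in X @ _](_ : (fun n => (F n (X n w) - c n) + c n) = _); last first.
  by apply/funext => n; rewrite subrK.
rewrite -[l]add0r; apply: cvgD => //.
rewrite -cvg_shiftS; apply/cvgrPdist_lt => eps eps0.
have eps4 : 0 < eps ^+ 4 by exact: exprn_gt0.
have /cvgrPdist_lt /(_ _ eps4) := fw.
apply: filterS => n; rewrite !sub0r !normrN /f normrX => H.
by rewrite -(@ltr_pXn2r _ 4)// nnegrE// ltW.
Qed.

Section Fixed.
Variables (lam : R) (lam_gt0 : 0 < lam).
Let m := mp gamma lam.


Let rate_const : exists2 C : R, 0 <= C & forall n, (0 < n)%N ->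
  8 * n%:R ^+ 2 * osc2 (n := n) mu lam ^+ 2 + 48 * n%:R * osc4 (n := n) mu lam
   <= C * tail_rate n.
Proof.
pose K4 := 4 + 3 * m4 mu.
pose K := K4 / lam ^+ 4.
pose Kw := (2 + 2 * lam^-1 ^+ 4) *
  ((1 + lam^-1) ^+ 2 * (59 * (K4 * (1 + lam^-1) ^+ 4) + 28 * (1 + lam^-1) ^+ 4)).
have K40 : 0 <= K4 by rewrite addr_ge0// mulr_ge0// m4_ge0.
have li0 : 0 <= lam^-1 by rewrite invr_ge0 ltW.
have B0 : 0 <= 1 + lam^-1 by exact: addr_ge0.
have Kw0 : 0 <= Kw.
  rewrite mulr_ge0//; first by rewrite addr_ge0// mulr_ge0// exprn_ge0.
  by rewrite mulr_ge0 ?sqr_ge0// addr_ge0// ?mulr_ge0// exprn_ge0.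
exists (8 * K ^+ 2 + 48 * Kw).
  by apply: addr_ge0; rewrite mulr_ge0 ?sqr_ge0.
move=> n n0; have N0 : 0 < n%:R :> R by rewrite ltr0n.
have pt0 := phi_tail_ge0 mu N0.
rewrite [leRHS]mulrDl; apply: lerD.
  rewrite /osc2 -/K4 -/K.
  rewrite [leLHS](_ : _ = 8 * K ^+ 2 * (n%:R^-1 * n%:R^-1)); last first.
    by field; exact: lt0r_neq0.
  apply: ler_wpM2l; first by rewrite mulr_ge0// sqr_ge0.
  by rewrite lerDl mulr_ge0// invr_ge0 ltW.
rewrite /osc4 -/K4 -/Kw /tail_rate.
rewrite [leLHS](_ : _ = 48 * Kw *
  (n%:R^-1 * n%:R^-1 + n%:R^-1 * phi_tail mu n%:R))//.
by field; exact: lt0r_neq0.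
Qed.

Lemma quadratic_ae_cvg (b : forall n, 'cV[R]_(p n)) :
  (forall n, (0 < n)%N -> sqnorm2 (b n) = 1) ->
  {ae P, forall w, (fun n => Qform lam (b n) (X n w)) @ \oo --> m}.
Proof.
move=> b1; have [C C0 HC] := rate_const.
apply: (@ae_cvg_of_fourth_moments (fun n => Qform (n := n) lam (b n))
  (fun n => \int[Pi n]_s Qform (n := n) lam (b n) s) C m C0).
- by move=> n n0; exact: bounded_Qform.
- move=> n n0; apply: le_trans (HC n n0).
  have [] := Qform_concentration (nu_iid n0) (X_iid n0) mu4 mu1 mu2 n0 lam_gt0 (b1 n n0).
  by [].
- exact: (mean_quadratic_cvg std fin4 gamma_gt0 p_cvg nu_iid X_iid lam_gt0 b1).
Qed.

Lemma trace_ae_cvg :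
  {ae P, forall w, (fun n => mean_resolvent lam (X n w)) @ \oo --> gamma * m}.
Proof.
have [C C0 HC] := rate_const; have [Y Y0 HY] := ratio_bounded p_cvg.
apply: (@ae_cvg_of_fourth_moments (fun n => mean_resolvent (n := n) lam)
  (fun n => \int[Pi n]_s mean_resolvent (n := n) lam s) (Y ^+ 4 * C)).
- by rewrite mulr_ge0// exprn_ge0.
- by move=> n n0; exact: bounded_mean_resolvent.
- move=> n n0; have [_ H] := mean_resolvent_concentration
    (nu_iid n0) (X_iid n0) mu4 mu1 mu2 n0 lam_gt0.
  apply: le_trans H _; rewrite -[leRHS]mulrA.
  have y0 : 0 <= (p n)%:R / n%:R :> R by rewrite divr_ge0.
  apply: (@le_trans _ _ (((p n)%:R / n%:R) ^+ 4 * (C * tail_rate n))).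
    rewrite [leLHS](_ : _ = ((p n)%:R / n%:R) ^+ 4 *
      (8 * n%:R ^+ 2 * osc2 (n := n) mu lam ^+ 2 + 48 * n%:R * osc4 (n := n) mu lam)).
      by rewrite ler_wpM2l ?exprn_ge0// HC.
    by ring.
  apply: ler_wpM2r; last by rewrite lerXn2r ?nnegrE.
  have N0 : 0 < n%:R :> R by rewrite ltr0n.
  rewrite mulr_ge0// addr_ge0// mulr_ge0 ?invr_ge0 ?(ltW N0)//.
  exact: phi_tail_ge0.
- exact: (mean_trace_cvg std fin4 gamma_gt0 p_cvg nu_iid X_iid lam_gt0).
Qed.

End Fixed.

(* [a lam] is replaced by the derivative of [a] through difference quotients
   whose error is uniform in [n]. *)
Lemma difference_quotient_cvg (a : R -> nat -> R) (A : R -> R) (q : nat -> R)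
    (lam B D : R) : 0 <= B ->
  a lam @ \oo --> A lam ->
  (forall k, a (lam + k.+1%:R^-1) @ \oo --> A (lam + k.+1%:R^-1)) ->
  (forall k n, (0 < n)%N ->
     `|q n - (a lam n - a (lam + k.+1%:R^-1) n) / k.+1%:R^-1| <= B / k.+1%:R) ->
  (fun k : nat => (A lam - A (lam + k.+1%:R^-1)) / k.+1%:R^-1) @ \oo --> D ->
  q @ \oo --> D.
Proof.
move=> B0 a0 ak Hq AD; apply/cvgrPdist_le => e e0.
have e3 : 0 < e / 3 by rewrite divr_gt0.
have /cvgrPdist_le /(_ _ e3) [k1 _ Hk1] := AD.
(* The step [1 / (k + 1)] is fixed before [n]: small enough for the limiting quotient to be near [D]
   and for the uniform error [B / (k + 1)] to be below [e / 3]. *)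
pose k := maxn k1 (Num.truncn (B / (e / 3))).
have kB : B / k.+1%:R <= e / 3.
  rewrite ler_pdivrMr// mulrC -ler_pdivrMr//.
  apply: ltW; apply: lt_le_trans (truncnS_gt _) _.
  by rewrite ler_nat ltnS leq_maxr.
have Hk := Hk1 k (leq_maxl _ _).
pose h : R := k.+1%:R^-1.
have h0 : 0 < h by rewrite invr_gt0.
have : (fun n => (a lam n - a (lam + h) n) / h) @ \oo -->
    (A lam - A (lam + h)) / h.
  by apply: cvgM; [apply: cvgB; [exact: a0|exact: (ak k)]|exact: cvg_cst].
move=> /cvgrPdist_le /(_ _ e3) Hn.
near=> n.
have n0 : (0 < n)%N by near: n; exists 1%N.
have H1 : `|(A lam - A (lam + h)) / h - (a lam n - a (lam + h) n) / h| <= e / 3.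
  by near: n.
have H2 := le_trans (Hq k n n0) kB; rewrite -/h in H2.
have H3 : `|D - (A lam - A (lam + h)) / h| <= e / 3 by exact: Hk.
apply: le_trans (ler_distD ((A lam - A (lam + h)) / h) _ _) _.
apply: (@le_trans _ _ (e / 3 + (e / 3 + e / 3))); last lra.
apply: lerD => //.
apply: le_trans (ler_distD ((a lam n - a (lam + h) n) / h) _ _) _.
by apply: lerD => //; rewrite distrC.
Unshelve. all: by end_near. Qed.

End AlmostSureLimits.

(** * Bias and variance of the ridge estimator *)

Section RidgeAlgebra.
Context {R : realType} {n p : nat}.
Variables (lam : R) (lam_gt0 : 0 < lam).
Hypothesis n_gt0 : (0 < n)%N.
Implicit Types (s : n.-tuple (p.-tuple R)) (b : 'cV[R]_p) (e : 'I_n -> R).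

Let N : R := n%:R.
Let N_gt0 : 0 < N. Proof. by rewrite ltr0n. Qed.

Definition noise_map s : 'M[R]_(p, n) :=
  N^-1 *: (invmx (sgram lam s) *m (design (tnth s))^T).

Definition bias_vec b s : 'cV[R]_p := - lam *: (invmx (sgram lam s) *m b).

(** The penalty [n lam] makes the ridge matrix equal to [n] times [sgram]; since [X^T X / n] is
    [sgram - lam], the estimator without noise is [b - lam G b]. *)
Lemma ridge_error s b e :
  ridge_fit lam (tnth s) (fun i => dotp (tnth s i) b + e i) - b =
  bias_vec b s + noise_map s *m (\col_i e i).
Proof.
have uM : sgram lam s \in unitmx by apply: (coercive_unit lam_gt0); exact: sgram_coercive.
have N0 : N != 0 by exact: lt0r_neq0.
set D := design (tnth s).
have ME : D^T *m D + (n%:R * lam)%:M = N *: sgram lam s.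
  by rewrite /sgram scalerDr scalerA mulfV// scale1r scale_scalar_mx.
have yE : \col_i (dotp (tnth s i) b + e i) = D *m b + \col_i e i.
  apply/colP => i; rewrite !mxE; congr (_ + _).
  by apply: eq_bigr => j _; rewrite mxE.
rewrite /ridge_fit /ridge -/D ME yE invmxZ; last first.
  by rewrite unitmxZ// unitfE.
set G := invmx (sgram lam s).
have key : N^-1 *: (G *m (D^T *m (D *m b))) = b - lam *: (G *m b).
  rewrite scalemxAr [D^T *m (D *m b)]mulmxA scalemxAl.
  have -> : N^-1 *: (D^T *m D) = sgram lam s - lam%:M by rewrite /sgram addrK.
  by rewrite mulmxBl mul_scalar_mx mulmxBr -scalemxAr mulmxA mulVmx// mul1mx.
have -> : N^-1 *: G *m D^T *m (D *m b + \col_i e i) =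
    N^-1 *: (G *m (D^T *m (D *m b))) + noise_map s *m \col_i e i.
  rewrite mulmxDr /noise_map -/G -/D -!scalemxAl !mulmxA.
  by [].
by rewrite key /bias_vec -/G scaleNr addrAC [b - _]addrC addrK.
Qed.

Definition mean_resolvent2 s : R := N^-1 * \sum_(j < p)
  ip (invmx (sgram lam s) *m unitv j) (invmx (sgram lam s) *m unitv j).

(** The left side is the trace of [noise_map] times its transpose. This product is
    [G (X^T X / n) G / n], which is [(G - lam G^2) / n]. *)
Lemma noise_map_sqnorm s : \sum_j \sum_i noise_map s j i ^+ 2 =
  mean_resolvent lam s - lam * mean_resolvent2 s.
Proof.
have cM := sgram_coercive lam s.
set D := design (tnth s); set G := invmx (sgram lam s).
have -> : \sum_j \sum_i noise_map s j i ^+ 2 =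
   \sum_j ip (unitv j) ((noise_map s *m (noise_map s)^T) *m unitv j).
  apply: eq_bigr => j _; rewrite ip_unitv mulmx_unitv mxE.
  by apply: eq_bigr => i _; rewrite [(noise_map s)^T i j]mxE expr2.
have Gs : G^T = G by rewrite /G trmx_inv cM.1.
have -> : noise_map s *m (noise_map s)^T = N^-1 *: (G - lam *: (G *m G)).
  rewrite /noise_map linearZ/= trmx_mul trmxK -/G -/D Gs -scalemxAl -scalemxAr.
  congr (_ *: _).
  rewrite mulmxA -[_ *m D^T *m D]mulmxA scalemxAl scalemxAr.
  have -> : N^-1 *: (D^T *m D) = sgram lam s - lam%:M by rewrite /sgram addrK.
  rewrite mulmxBr mulmxBl mulVmx ?mul1mx; last exact: (coercive_unit lam_gt0).
  by rewrite mul_mx_scalar -scalemxAl.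
rewrite /mean_resolvent /mean_resolvent2 !mulr_sumr -sumrB; apply: eq_bigr => j _.
rewrite /Qform -/G -scalemxAl ipZr mulmxBl ipBr -scalemxAl ipZr.
rewrite -[G *m G *m _]mulmxA [ip _ (G *m (G *m _))]ip_adj Gs mulrBr; congr (_ - _).
by rewrite mulrCA.
Qed.

Definition det_risk (s2 : R) b s : R :=
  lam ^+ 2 * ip (invmx (sgram lam s) *m b) (invmx (sgram lam s) *m b)
  + s2 * (mean_resolvent lam s - lam * mean_resolvent2 s).

Lemma det_riskE (s2 : R) b s : det_risk s2 b s =
  \sum_j (bias_vec b s j 0 ^+ 2 + s2 * \sum_i noise_map s j i ^+ 2).
Proof.
rewrite big_split/= -mulr_sumr noise_map_sqnorm; congr (_ + _).
rewrite mulr_sumr; apply: eq_bigr => j _; rewrite [in RHS]mxE; ring.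
Qed.

End RidgeAlgebra.

Section RiskLimit.
Context {R : realType}.
Variables (mu : probability R R) (gamma : R) (p : nat -> nat).
Hypotheses (std : standardized_law mu) (fin4 : finite_moment_above mu 4).
Hypothesis gamma_gt0 : 0 < gamma.
Hypothesis p_cvg : (fun n => (p n)%:R / n%:R : R) @ \oo --> gamma.
Context {d : measure_display} {T : measurableType d}.
Variable P : probability T R.
Variable nu : forall n, probability ((p n).-tuple R) R.
Variable X : forall n, {RV P >-> n.-tuple ((p n).-tuple R)}.
Hypothesis nu_iid : forall n, (0 < n)%N -> iid_law (nu n) mu.
Hypothesis X_iid : forall n, (0 < n)%N -> iid_law (distribution P (X n)) (nu n).
Variables (lam : R) (lam_gt0 : 0 < lam).

Lemma mp_slope_seq : (fun k : nat => (mp gamma lam - mp gamma (lam + k.+1%:R^-1))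
  / k.+1%:R^-1) @ \oo --> mp_slope gamma lam.
Proof.
have H := mp_quotient_cvg gamma_gt0 lam_gt0.
rewrite (_ : (fun k : nat => _) = (fun h : R => h^-1 *
   (mp gamma (lam - h) - mp gamma lam)) \o (fun k : nat => - k.+1%:R^-1)); last first.
  by apply/funext => k /=; rewrite opprK invrN; ring.
apply: cvg_comp H => A [e e0 HA].
have : (fun k : nat => - (@harmonic R k)) @ \oo --> - (0 : R).
  by apply: cvgN; exact: cvg_harmonic.
rewrite oppr0 => /cvgrPdist_lt /(_ e e0); apply: filterS => k Hk.
apply: HA; first exact: Hk.
by rewrite /= oppr_eq0 invr_eq0 pnatr_eq0.
Qed.

Lemma resolvent_sqr_bounds n (l h : R) (b : 'cV[R]_(p n)) s : 0 < l -> 0 < h ->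
  0 <= ip (invmx (sgram l s) *m b) (invmx (sgram l s) *m b)
    - (Qform (n := n) l b s - Qform (n := n) (l + h) b s) / h
  <= h * (sqnorm2 b / l ^+ 3).
Proof.
move=> l0 h0; rewrite /Qform sgram_shift sqnorm2_ip.
by apply: resolvent_derivative => //; exact: sgram_coercive.
Qed.

(** Limits at [lam] and at the countably many points [lam + 1 / (k + 1)] hold off a single null set;
    on its complement [difference_quotient_cvg] yields the squared resolvents deterministically. *)
Lemma risk_ae_cvg (r2 s2 : R) (beta : forall n, 'cV[R]_(p n)) : 0 < r2 ->
  (forall n, (0 < n)%N -> sqnorm2 (beta n) = r2) ->
  {ae P, forall w, (fun n => det_risk lam s2 (beta n) (X n w)) @ \oo -->
                   ridge_limit_risk gamma r2 s2 lam}.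
Proof.
move=> r20 betaE.
(* Convergence of quadratic forms is available for unit vectors, so the signal is normalised and the
   factor [r2] restored at the end. *)
pose b n := (Num.sqrt r2)^-1 *: beta n.
have sr0 : Num.sqrt r2 != 0 by rewrite lt0r_neq0// sqrtr_gt0.
have b1 n : (0 < n)%N -> sqnorm2 (b n) = 1.
  move=> n0; rewrite sqnorm2_ip ipZl ipZr -sqnorm2_ip betaE//.
  rewrite -{3}[r2]sqr_sqrtr ?(ltW r20)//.
  by field.
have betab n : beta n = Num.sqrt r2 *: b n by rewrite scalerA mulfV// scale1r.
have pos k : 0 < lam + k.+1%:R^-1 by rewrite addr_gt0// invr_gt0.
have [Y Y0 HY] := ratio_bounded p_cvg.
have l3 : 0 <= (lam ^+ 3)^-1 by rewrite invr_ge0 exprn_ge0// ltW.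
have aQ := quadratic_ae_cvg std fin4 gamma_gt0 p_cvg nu_iid X_iid lam_gt0 b1.
have aT := trace_ae_cvg std fin4 gamma_gt0 p_cvg nu_iid X_iid lam_gt0.
have aQk : {ae P, forall w, forall k : nat,
    (fun n => Qform (lam + k.+1%:R^-1) (b n) (X n w)) @ \oo --> mp gamma (lam + k.+1%:R^-1)}.
  apply/ae_foralln => k.
  exact: (quadratic_ae_cvg std fin4 gamma_gt0 p_cvg nu_iid X_iid (pos k) b1).
have aTk : {ae P, forall w, forall k : nat,
    (fun n => mean_resolvent (lam + k.+1%:R^-1) (X n w)) @ \oo -->
      gamma * mp gamma (lam + k.+1%:R^-1)}.
  apply/ae_foralln => k.
  exact: (trace_ae_cvg std fin4 gamma_gt0 p_cvg nu_iid X_iid (pos k)).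
near=> w.
have Qw : (fun n => Qform lam (b n) (X n w)) @ \oo --> mp gamma lam by near: w.
have Tw : (fun n => mean_resolvent lam (X n w)) @ \oo --> gamma * mp gamma lam.
  by near: w.
have Qwk : forall k : nat, (fun n => Qform (lam + k.+1%:R^-1) (b n) (X n w)) @ \oo -->
   mp gamma (lam + k.+1%:R^-1) by near: w.
have Twk : forall k : nat, (fun n => mean_resolvent (lam + k.+1%:R^-1) (X n w)) @ \oo -->
   gamma * mp gamma (lam + k.+1%:R^-1) by near: w.
have Q2w : (fun n => ip (invmx (sgram lam (X n w)) *m b n)
    (invmx (sgram lam (X n w)) *m b n)) @ \oo --> mp_slope gamma lam.
  apply: (difference_quotient_cvg (a := fun l n => Qform l (b n) (X n w))
     (A := mp gamma) (B := (lam ^+ 3)^-1) l3 Qw Qwk _ mp_slope_seq).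
  move=> k n n0; have h0 : 0 < k.+1%:R^-1 :> R by rewrite invr_gt0.
  have /andP[H1 H2] := resolvent_sqr_bounds (b n) (X n w) lam_gt0 h0.
  rewrite ger0_norm//; apply: le_trans H2 _.
  by rewrite b1// mul1r mulrC.
have T2w : (fun n => mean_resolvent2 lam (X n w)) @ \oo --> gamma * mp_slope gamma lam.
  have slope : (fun k : nat => (gamma * mp gamma lam - gamma * mp gamma (lam + k.+1%:R^-1))
      / k.+1%:R^-1) @ \oo --> gamma * mp_slope gamma lam.
    under eq_fun do rewrite -mulrBr -mulrA.
    by apply: cvgM; [exact: cvg_cst|exact: mp_slope_seq].
  apply: (difference_quotient_cvg (a := fun l n => mean_resolvent l (X n w))
     (A := fun l => gamma * mp gamma l) (B := Y * (lam ^+ 3)^-1) _ Tw Twk _ slope).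
    exact: mulr_ge0.
  move=> k n n0; have h0 : 0 < k.+1%:R^-1 :> R by rewrite invr_gt0.
  have N0 : 0 < n%:R :> R by rewrite ltr0n.
  have -> : mean_resolvent2 lam (X n w) - (mean_resolvent lam (X n w) -
       mean_resolvent (lam + k.+1%:R^-1) (X n w)) / k.+1%:R^-1 =
    n%:R^-1 * \sum_(j < p n) (ip (invmx (sgram lam (X n w)) *m unitv j)
        (invmx (sgram lam (X n w)) *m unitv j) -
       (Qform lam (unitv j) (X n w) - Qform (lam + k.+1%:R^-1) (unitv j) (X n w)) / k.+1%:R^-1).
    rewrite /mean_resolvent2 /mean_resolvent sumrB -mulr_suml sumrB; ring.
  have HS (j : 'I_(p n)) := resolvent_sqr_bounds (unitv j) (X n w) lam_gt0 h0.
  rewrite ger0_norm; last first.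
    rewrite mulr_ge0 ?invr_ge0 ?(ltW N0)// sumr_ge0// => j _.
    by have /andP[] := HS j.
  apply: (@le_trans _ _ (n%:R^-1 * \sum_(j < p n) (k.+1%:R^-1 * (lam ^+ 3)^-1))).
    rewrite ler_wpM2l ?invr_ge0 ?(ltW N0)//; apply: ler_sum => j _.
    by have /andP[_] := HS j; rewrite unitv1 div1r.
  rewrite sumr_const card_ord -[_ *+ p n]mulr_natl.
  rewrite [leLHS](_ : _ = (p n)%:R / n%:R * ((lam ^+ 3)^-1 / k.+1%:R)); last by ring.
  by rewrite -[leRHS]mulrA ler_wpM2r// divr_ge0.
have betaw : (fun n => ip (invmx (sgram lam (X n w)) *m beta n)
    (invmx (sgram lam (X n w)) *m beta n)) @ \oo --> r2 * mp_slope gamma lam.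
  rewrite (_ : (fun n => _) = (fun n => r2 * ip (invmx (sgram lam (X n w)) *m b n)
    (invmx (sgram lam (X n w)) *m b n))); last first.
    apply/funext => n; rewrite {1 2}betab -!scalemxAr ipZl ipZr mulrA.
    by rewrite -expr2 sqr_sqrtr// ltW.
  by apply: cvgM; [exact: cvg_cst|exact: Q2w].
rewrite ridge_limit_riskE//.
rewrite (_ : r2 * lam ^+ 2 * mp_slope gamma lam +
    s2 * gamma * (mp gamma lam - lam * mp_slope gamma lam) =
  lam ^+ 2 * (r2 * mp_slope gamma lam) +
    s2 * (gamma * mp gamma lam - lam * (gamma * mp_slope gamma lam))); last by ring.
apply: cvgD; first by apply: cvgM; [exact: cvg_cst|exact: betaw].
apply: cvgM; first exact: cvg_cst.
by apply: cvgB => //; apply: cvgM; [exact: cvg_cst|exact: T2w].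
Unshelve. all: by end_near. Qed.

End RiskLimit.

(** * Identification of the conditional risk *)

Section ConditionalExpectation.
Context {d : measure_display} {T : measurableType d} {R : realType}.
Variable P : probability T R.

Lemma integral_preimage_indic dE (E : measurableType dE) (X : T -> E) (C : set E)
    (Y : T -> R) :
  (\int[P]_(w in X @^-1` C) (Y w)%:E = \int[P]_w (\1_C (X w) * Y w)%:E)%E.
Proof.
rewrite integral_mkcond; apply: eq_integral => w _.
have wC : (w \in X @^-1` C) = (X w \in C) by apply/idP/idP; rewrite !inE.
rewrite /patch wC indicE.
by case: (X w \in C); rewrite ?mul1r ?mul0r.
Qed.

(** Both functions are measurable for the sigma-algebra of [X], hence so is the event where one lies
    below the other. Their integrals agree on it and on its complement, so the difference vanishes
    in mean absolute value. *)
Lemma cond_expectation_unique dE (E : measurableType dE) (X : T -> E)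
    (Y Z : T -> R) (rho : E -> R) :
  measurable_fun setT X -> measurable_fun setT rho ->
  P.-integrable setT (EFin \o (rho \o X)) ->
  (forall C, measurable C ->
    (\int[P]_(w in X @^-1` C) (Y w)%:E = \int[P]_(w in X @^-1` C) (rho (X w))%:E)%E) ->
  cond_expectation P X Y Z -> {ae P, forall w, Z w = rho (X w)}.
Proof.
move=> mX mrho irho Yrho [Zm Zi Zint].
have mXC C : measurable C -> measurable (X @^-1` C).
  by move=> mC; rewrite -[X in measurable X]setTI; exact: mX.
pose g w := rho (X w) - Z w.
have ig : P.-integrable setT (EFin \o g) by exact: integrableB_real.
have g0 C : measurable C -> (\int[P]_(w in X @^-1` C) (g w)%:E = 0)%E.
  move=> mC; have mD := mXC C mC.
  have iA : P.-integrable (X @^-1` C) (EFin \o (rho \o X)) by exact: integrableS irho.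
  have iB : P.-integrable (X @^-1` C) (EFin \o Z) by exact: integrableS Zi.
  rewrite integralB_EFin// -Yrho// -Zint; last by exists C => //; rewrite setTI.
  by rewrite subee//; exact: (integrable_fin_num mD iB).
(* {Z < rho o X} is the union over rationals of events of sigma(X) *)
have [C mC CE] : exists2 C, measurable C & [set w | Z w < rho (X w)] = X @^-1` C.
  have /boolp.choice [B HB] : forall q : rat, exists D : set E, measurable D /\
      X @^-1` D = Z @^-1` `]-oo, ratr q[%classic.
    move=> q; have [B mB BE] := Zm `]-oo, ratr q[%classic (measurable_itv _).
    by exists B; split; [exact: mB|rewrite -BE setTI].
  exists (\bigcup_(q : rat) (B q `&` rho @^-1` `]ratr q, +oo[%classic)).
    apply: bigcupT_measurable_rat => q; apply: measurableI; first by case: (HB q).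
    by rewrite -[X in measurable X]setTI; apply: mrho => //; exact: measurable_itv.
  apply/seteqP; split => w /=.
    move=> Zr; have [q] := rat_in_itvoo Zr; rewrite in_itv/= => /andP[q1 q2].
    exists q => //; split; last by rewrite /= in_itv/= q2.
    by have [_ BE] := HB q; rewrite -[B q (X w)]/((X @^-1` B q) w) BE /= in_itv/= q1.
  move=> [q _ [Bq]]; rewrite /= in_itv/= andbT => q2.
  have [_ BE] := HB q; have : (X @^-1` B q) w by [].
  by rewrite BE /= in_itv/= => q1; exact: lt_trans q2.
have abs0 : (\int[P]_w `|(g w)%:E| = 0)%E.
  have mg : measurable_fun setT (EFin \o g) := measurable_int _ ig.
  rewrite -(setUv (X @^-1` C)) ge0_integral_setU//; last 4 first.
  - exact: mXC.
  - by apply: measurableC; exact: mXC.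
  - by apply: measurable_funTS; apply: measurableT_comp.
  - by rewrite disj_set2E setICr.
  rewrite (eq_integral (fun w => (g w)%:E)); last first.
    move=> w; rewrite inE -CE => Zr; rewrite gee0_abs// lee_fin subr_ge0.
    exact: ltW.
  rewrite g0// add0e (eq_integral (fun w => - (g w)%:E)%E); last first.
    move=> w; rewrite inE -CE => /negP; rewrite -leNgt => Zr.
    by rewrite lee0_abs// lee_fin subr_le0.
  rewrite integralN; last first.
    apply: integrable_add_def; first exact: measurableC (mXC C mC).
    exact: (integrableS measurableT (measurableC (mXC C mC)) (@subsetT _ _) ig).
  by rewrite preimage_setC g0 ?oppe0//; exact: measurableC.
have mg : measurable_fun setT (EFin \o g) := measurable_int _ ig.
have /(ae_eq_integral_abs _ measurableT mg) := abs0.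
apply: filterS => w /(_ I) /= [] /eqP; rewrite subr_eq0 => /eqP.
by move->.
Qed.

End ConditionalExpectation.

Section Identification.
Context {d : measure_display} {T : measurableType d} {R : realType}.
Variable P : probability T R.
Context {n p : nat}.
Variables (lam : R) (lam_gt0 : 0 < lam) (beta : 'cV[R]_p).
Variables (X : T -> n.-tuple (p.-tuple R)) (dl : T -> n.-tuple R).
Variables (x0 : T -> p.-tuple R) (e0 : T -> R).
Hypotheses (mX : measurable_fun setT X) (mdl : measurable_fun setT dl).
Hypotheses (mx0 : measurable_fun setT x0) (me0 : measurable_fun setT e0).
Hypothesis ind_noise : independent P dl X.
Hypothesis ind_test : independent P (fun w => (x0 w, e0 w)) (fun w => (X w, dl w)).
Variables (s2 t2 : R).
Hypotheses (s2_ge0 : 0 <= s2) (t2_ge0 : 0 <= t2).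
Hypothesis test_moment : forall v,
  (\int[P]_w ((dotp (x0 w) v - e0 w) ^+ 2)%:E = (sqnorm2 v + t2)%:E)%E.
Hypothesis noise_moment : forall (c : R) (a : 'I_n -> R),
  (\int[P]_w ((c + \sum_i a i * tnth (dl w) i) ^+ 2)%:E
   = (c ^+ 2 + s2 * \sum_i a i ^+ 2)%:E)%E.

Let B (s : n.-tuple (p.-tuple R)) (e : n.-tuple R) : 'cV[R]_p :=
  bias_vec lam beta s + noise_map lam s *m \col_i tnth e i.

Lemma mx_measurable_noise_map d' (U : measurableType d')
    (f : U -> n.-tuple (p.-tuple R)) : measurable_fun setT f ->
  mx_measurable (fun w => noise_map lam (f w)).
Proof.
move=> mf i j; under eq_fun do rewrite mxE.
apply: measurable_funM => //; apply: mx_measurableM => [k l|k l].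
  apply: mx_measurable_inv; first exact: mx_measurable_sgram.
  by move=> w; apply: (coercive_unit lam_gt0); exact: sgram_coercive.
under eq_fun do rewrite !mxE.
apply: (measurableT_comp (measurable_tnth _)).
by apply: (measurableT_comp (measurable_tnth _)).
Qed.

Let mB d' (U : measurableType d') (f : U -> n.-tuple (p.-tuple R))
    (g : U -> n.-tuple R) : measurable_fun setT f -> measurable_fun setT g ->
  mx_measurable (fun w => B (f w) (g w)).
Proof.
move=> mf mg i j; under eq_fun do rewrite mxE.
apply: measurable_funD.
  under eq_fun do rewrite mxE.
  by apply: measurable_funM => //; exact: mx_measurable_resolvent.
apply: mx_measurableM; first exact: mx_measurable_noise_map.
move=> k l; under eq_fun do rewrite mxE.
by apply: (measurableT_comp (measurable_tnth _)).
Qed.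

Let measurable_indicT (C : set (n.-tuple (p.-tuple R))) d' (U : measurableType d')
    (f : U -> n.-tuple (p.-tuple R)) : measurable C -> measurable_fun setT f ->
  measurable_fun setT (fun w => \1_C (f w) : R).
Proof.
move=> mC mf; have m1 : measurable_fun setT (\1_C : _ -> R) by exact: measurable_indic.
exact: measurableT_comp m1 mf.
Qed.

Let measurable_sqn d' (U : measurableType d') (v : U -> 'cV[R]_p) :
  mx_measurable v -> measurable_fun setT (fun w => sqnorm2 (v w)).
Proof.
by move=> mv; apply: measurable_sum => j; apply: measurable_funX.
Qed.

Let measurable_dotp2 d' (U : measurableType d') (a : U -> p.-tuple R)
    (v : U -> 'cV[R]_p) : measurable_fun setT a -> mx_measurable v ->
  measurable_fun setT (fun w => dotp (a w) (v w)).
Proof.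
move=> ma mv; apply: measurable_sum => j; apply: measurable_funM => //.
by apply: (measurableT_comp (measurable_tnth j)).
Qed.

Lemma measurable_det_risk : measurable_fun setT (@det_risk R n p lam s2 beta).
Proof.
rewrite (_ : det_risk _ _ _ = fun s => \sum_j (bias_vec lam beta s j 0 ^+ 2
    + s2 * \sum_i noise_map lam s j i ^+ 2)); last first.
  by apply/funext => s; rewrite (det_riskE lam_gt0).
apply: measurable_sum => j; apply: measurable_funD.
  apply: measurable_funX; under eq_fun do rewrite mxE.
  apply: measurable_funM => //.
  exact: (mx_measurable_resolvent beta (f := id)).
apply: measurable_funM => //; apply: measurable_sum => i; apply: measurable_funX.
exact: (mx_measurable_noise_map (f := id)).
Qed.

Lemma det_risk_ge0 s : 0 <= det_risk (n := n) lam s2 beta s.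
Proof.
rewrite (det_riskE lam_gt0) sumr_ge0// => j _.
rewrite addr_ge0 ?sqr_ge0// mulr_ge0// sumr_ge0// => i _; exact: sqr_ge0.
Qed.

(** Two decouplings: the test pair is averaged with the training data frozen, giving a squared norm
    plus [t2]; then the residual noise is averaged with the covariates frozen, giving squared bias
    plus variance. The indicator of [C] depends on the covariates only and passes through both. *)
Lemma risk_integral (C : set (n.-tuple (p.-tuple R))) : measurable C ->
  (\int[P]_(w in X @^-1` C) ((dotp (x0 w) (B (X w) (dl w)) - e0 w) ^+ 2)%:E =
   \int[P]_(w in X @^-1` C) (det_risk lam s2 beta (X w) + t2)%:E)%E.
Proof.
move=> mC; rewrite !integral_preimage_indic.
have C0 s : 0 <= \1_C s :> R by rewrite indicE.
pose psi1 (z : (p.-tuple R * R) * (n.-tuple (p.-tuple R) * n.-tuple R)) :=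
  (\1_C z.2.1 * (dotp z.1.1 (B z.2.1 z.2.2) - z.1.2) ^+ 2)%:E.
have m21 : measurable_fun setT (fun z : (p.-tuple R * R) *
    (n.-tuple (p.-tuple R) * n.-tuple R) => z.2.1) by exact: measurableT_comp.
have m22 : measurable_fun setT (fun z : (p.-tuple R * R) *
    (n.-tuple (p.-tuple R) * n.-tuple R) => z.2.2) by exact: measurableT_comp.
have m11 : measurable_fun setT (fun z : (p.-tuple R * R) *
    (n.-tuple (p.-tuple R) * n.-tuple R) => z.1.1) by exact: measurableT_comp.
have m12 : measurable_fun setT (fun z : (p.-tuple R * R) *
    (n.-tuple (p.-tuple R) * n.-tuple R) => z.1.2) by exact: measurableT_comp.
have mpsi1 : measurable_fun setT psi1.
  rewrite /psi1; apply/measurable_EFinP; apply: measurable_funM; first exact: measurable_indicT.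
  apply: measurable_funX; apply: measurable_funB => //.
  by apply: measurable_dotp2 => //; exact: mB.
have psi10 z : (0 <= psi1 z)%E by rewrite lee_fin mulr_ge0// sqr_ge0.
have mU : measurable_fun setT (fun w => (x0 w, e0 w)) by exact: measurable_fun_pair.
have mV : measurable_fun setT (fun w => (X w, dl w)) by exact: measurable_fun_pair.
have := decoupling mU mV ind_test mpsi1 psi10; rewrite /psi1 /= => ->.
pose psi2 (z : n.-tuple R * n.-tuple (p.-tuple R)) :=
  (\1_C z.2 * (sqnorm2 (B z.2 z.1) + t2))%:E.
have mpsi2 : measurable_fun setT psi2.
  rewrite /psi2; apply/measurable_EFinP; apply: measurable_funM; first exact: measurable_indicT.
  by apply: measurable_funD => //; apply: measurable_sqn; exact: mB.
have psi20 z : (0 <= psi2 z)%E.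
  by rewrite lee_fin mulr_ge0// addr_ge0// sqnorm2_ip ip_ge0.
transitivity (\int[P]_w psi2 (dl w, X w))%E.
  apply: eq_integral => w _; rewrite /psi2 /= EFinM -test_moment.
  rewrite -ge0_integralZl_EFin//; last 2 first.
  - by move=> w' _; rewrite lee_fin sqr_ge0.
  - apply/measurable_EFinP; apply: measurable_funX; apply: measurable_funB => //.
    apply: measurable_dotp2 => //; exact: mx_measurable_cst.
have := decoupling mdl mX ind_noise mpsi2 psi20; rewrite /psi2 /= => ->.
apply: eq_integral => w _.
rewrite EFinM (det_riskE lam_gt0) EFinD -sumEFin.
have msq j : measurable_fun setT (fun w' => (bias_vec lam beta (X w) j 0 +
    \sum_i noise_map lam (X w) j i * tnth (dl w') i) ^+ 2).
  apply: measurable_funX; apply: measurable_funD => //; apply: measurable_sum => i.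
  apply: measurable_funM => //.
  by apply: (measurableT_comp (measurable_tnth i)).
transitivity (\int[P]_w' ((\1_C (X w))%:E * (\sum_j ((bias_vec lam beta (X w) j 0 +
    \sum_i noise_map lam (X w) j i * tnth (dl w') i) ^+ 2)%:E + t2%:E)))%E.
  apply: eq_integral => w' _; rewrite EFinM EFinD sumEFin; congr (_ * (_%:E + _))%E.
  rewrite /sqnorm2 /B; apply: eq_bigr => j _; rewrite mxE; congr ((_ + _) ^+ 2).
  by rewrite mxE; apply: eq_bigr => i _; rewrite [(\col_i _) _ _]mxE.
have msum : measurable_fun setT (fun w' => \sum_j ((bias_vec lam beta (X w) j 0 +
    \sum_i noise_map lam (X w) j i * tnth (dl w') i) ^+ 2)%:E)%E.
  by apply: emeasurable_sum => j; exact/measurable_EFinP.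
rewrite ge0_integralZl_EFin//; last 2 first.
- move=> w' _; rewrite adde_ge0 ?lee_fin// sume_ge0// => j _.
  by rewrite lee_fin sqr_ge0.
- by apply: emeasurable_funD.
congr (_ * _)%E.
rewrite ge0_integralD//; last first.
  by move=> w' _; apply: sume_ge0 => j _; rewrite lee_fin sqr_ge0.
rewrite ge0_integral_sum//; last 2 first.
- by move=> j; exact/measurable_EFinP.
- by move=> j w' _; rewrite lee_fin sqr_ge0.
rewrite integral_cst// [X in (_ * X)%E](probability_setT P) mule1.
by congr (_ + _)%E; apply: eq_bigr => j _; rewrite noise_moment.
Qed.

Lemma risk_identification (Y risk : T -> R) :
  (forall w, Y w = (dotp (x0 w) (B (X w) (dl w)) - e0 w) ^+ 2) ->
  cond_expectation P X Y risk ->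
  {ae P, forall w, risk w = det_risk lam s2 beta (X w) + t2}.
Proof.
move=> YE cE.
have mrho : measurable_fun setT (fun s => det_risk (n := n) lam s2 beta s + t2).
  by apply: measurable_funD => //; exact: measurable_det_risk.
have int_eq C : measurable C -> (\int[P]_(w in X @^-1` C) (Y w)%:E =
   \int[P]_(w in X @^-1` C) (det_risk lam s2 beta (X w) + t2)%:E)%E.
  move=> mC; rewrite -risk_integral//.
  by apply: eq_integral => w _; rewrite YE.
apply: (cond_expectation_unique mX mrho _ int_eq cE).
apply/integrableP; split.
  by apply/measurable_EFinP; exact: measurableT_comp.
rewrite (eq_integral (fun w => (det_risk lam s2 beta (X w) + t2)%:E)); last first.
  move=> w _; rewrite gee0_abs// lee_fin addr_ge0//; exact: det_risk_ge0.
(* The explicit risk is nonnegative, so it suffices that its total integral is finite; that integral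
   is the one of [Y], hence of the integrable version [risk]. *)
have := int_eq setT measurableT; rewrite preimage_setT => <-.
have [_ iZ Zint] := cE.
rewrite -(Zint setT); last by exists setT => //; rewrite preimage_setT setTI.
by have := integrable_fin_num measurableT iZ; rewrite fin_numElt => /andP[].
Qed.

End Identification.

Section LawAndIndependence.
Context {d : measure_display} {T : measurableType d} {R : realType}.
Variable P : probability T R.

Definition law_of dE (E : measurableType dE) (f : T -> E)
    (mf : measurable_fun setT f) : probability E R :=
  distribution P (HB.pack f (isMeasurableFun.Build _ _ _ _ f mf) : {mfun T >-> E}).

Lemma integral_law dE (E : measurableType dE) (f : T -> E)
    (mf : measurable_fun setT f) (psi : E -> \bar R) :
  measurable_fun setT psi -> (forall s, (0 <= psi s)%E) ->
  (\int[P]_w psi (f w) = \int[law_of mf]_s psi s)%E.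
Proof. by move=> mpsi psi0; rewrite ge0_integral_distribution. Qed.

Lemma measurable_mktuple dE (E : measurableType dE) n (f : 'I_n -> T -> E) :
  (forall i, measurable_fun setT (f i)) ->
  measurable_fun setT (fun w => [tuple f i w | i < n]).
Proof.
move=> mf; apply/measurable_fun_tnthP => i.
by rewrite (_ : _ \o _ = f i)//; apply/funext => w /=; rewrite tnth_mktuple.
Qed.

Lemma mutually_independent_forall dE (E : measurableType dE) n
    (f : 'I_n -> T -> E) (A : 'I_n -> set E) :
  mutually_independent P f -> (forall i, measurable (A i)) ->
  P [set w | forall i, A i (f i w)] = (\prod_(i < n) P (f i @^-1` A i))%E.
Proof.
move=> ind mA; have := ind [set: 'I_n]%SET A mA.
rewrite (eq_bigl xpredT); last by move=> i; rewrite inE.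
move=> <-; congr (P _); apply/seteqP; split=> w /=; first by move=> H i _; exact: H.
by move=> H i; apply: H => /=; rewrite inE.
Qed.

(** On boxes, mutual independence factors over the sample and the hypothesis on [u] and [v] factors
    within each observation; the products then regroup. *)
Lemma mutually_independent_tuples dE dF dG (E : measurableType dE)
    (F : measurableType dF) (G : measurableType dG) n (f : 'I_n -> T -> E)
    (u : E -> F) (v : E -> G) :
  (forall i, measurable_fun setT (f i)) ->
  measurable_fun setT u -> measurable_fun setT v ->
  mutually_independent P f -> (forall i, independent P (u \o f i) (v \o f i)) ->
  independent P (fun w => [tuple u (f i w) | i < n]) (fun w => [tuple v (f i w) | i < n]).
Proof.
move=> mf mu mv ind uv.
have muf i : measurable_fun setT (fun w => u (f i w)) by exact: measurableT_comp.
have mvf i : measurable_fun setT (fun w => v (f i w)) by exact: measurableT_comp.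
apply: (independent_pi (measurable_mktuple muf) (measurable_mktuple mvf)
  (measurable_boxesE F n) (@boxes_setI _ F n) (boxes_setT F n)
  (measurable_boxesE G n) (@boxes_setI _ G n) (boxes_setT G n)).
move=> _ _ [A mA <-] [B mB <-].
have muA i : measurable (u @^-1` A i).
  by rewrite -[X in measurable X]setTI; exact: mu.
have mvB i : measurable (v @^-1` B i).
  by rewrite -[X in measurable X]setTI; exact: mv.
have -> : (fun w => [tuple u (f i w) | i < n]) @^-1` box A =
    [set w | forall i, (u @^-1` A i) (f i w)].
  by apply/seteqP; split=> w /= H i; have := H i; rewrite tnth_mktuple.
have -> : (fun w => [tuple v (f i w) | i < n]) @^-1` box B =
    [set w | forall i, (v @^-1` B i) (f i w)].
  by apply/seteqP; split=> w /= H i; have := H i; rewrite tnth_mktuple.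
have -> : [set w | forall i, (u @^-1` A i) (f i w)] `&`
    [set w | forall i, (v @^-1` B i) (f i w)] =
    [set w | forall i, (u @^-1` A i `&` v @^-1` B i) (f i w)].
  apply/seteqP; split=> w /=; first by move=> [H1 H2] i; split.
  by move=> H; split=> i; have [] := H i.
rewrite (mutually_independent_forall ind muA) (mutually_independent_forall ind mvB).
rewrite (mutually_independent_forall ind (fun i => measurableI _ _ (muA i) (mvB i))).
by rewrite -big_split/=; apply: eq_bigr => i _; exact: uv.
Qed.

(** It suffices that the pair [(h Z, e)] is independent of [g Z]. On rectangles, independence of [e]
    from [Z] is used once to split [e] off from [(h Z, g Z)] and once to join it again with
    [h Z]. *)
Lemma independent_sum_noise dE dF (E : measurableType dE) (F : measurableType dF)
    (Z : T -> E) (e : T -> R) (g : E -> F) (h : E -> R) :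
  measurable_fun setT Z -> measurable_fun setT e ->
  measurable_fun setT g -> measurable_fun setT h ->
  independent P e Z -> independent P (h \o Z) (g \o Z) ->
  independent P (fun w => h (Z w) + e w) (g \o Z).
Proof.
move=> mZ me mg mh eZ hg.
have mhZ : measurable_fun setT (h \o Z) by exact: measurableT_comp.
have mgZ : measurable_fun setT (g \o Z) by exact: measurableT_comp.
have pair : independent P (fun w => (h (Z w), e w)) (g \o Z).
  apply: (independent_pi_l (G := [set A `*` B | A in measurable & B in measurable])).
  - exact: measurable_fun_pair.
  - by [].
  - by rewrite measurable_prod_measurableType.
  - exact: rectangles_setI.
  - by exists setT => //; exists setT => //; rewrite setXTT.
  move=> _ B [A mA [A' mA' <-]] mB.
  have mhA : measurable (h @^-1` A) by rewrite -[X in measurable X]setTI; exact: mh.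
  have mgB : measurable (g @^-1` B) by rewrite -[X in measurable X]setTI; exact: mg.
  have E1 : P (e @^-1` A' `&` Z @^-1` (h @^-1` A `&` g @^-1` B)) =
    (P (e @^-1` A') * P ((h \o Z) @^-1` A `&` (g \o Z) @^-1` B))%E.
    by rewrite eZ//; exact: measurableI.
  have E2 := eZ A' (h @^-1` A) mA' mhA.
  transitivity (P (e @^-1` A' `&` Z @^-1` (h @^-1` A `&` g @^-1` B))).
    by congr (P _); apply/seteqP; split=> w /=; tauto.
  rewrite E1 hg// muleA; congr (_ * _)%E.
  by rewrite -E2; congr (P _); apply/seteqP; split=> w /=; tauto.
have msum : measurable_fun setT (fun z : R * R => z.1 + z.2) by exact: measurable_funD.
exact: (independent_comp msum (@measurable_id _ F setT) pair).
Qed.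

End LawAndIndependence.

Section SecondMoments.
Context {d : measure_display} {T : measurableType d} {R : realType}.
Variable P : probability T R.
Implicit Types U V : T -> R.

Definition square_integrable U : Prop :=
  measurable_fun setT U /\ P.-integrable setT (EFin \o (fun w => U w ^+ 2)).

Lemma square_integrableM U V : square_integrable U -> square_integrable V ->
  P.-integrable setT (EFin \o (fun w => U w * V w)).
Proof.
move=> [mU U2] [mV V2].
apply: (le_integrable measurableT _ _ (integrableD_real U2 V2)).
  by apply/measurable_EFinP; exact: measurable_funM.
move=> w _; rewrite /= lee_fin [leRHS]ger0_norm ?addr_ge0 ?sqr_ge0//.
have := sqr_ge0 (U w - V w); have := sqr_ge0 (U w + V w).
by rewrite ler_norml !expr2 => *; apply/andP; split; lra.
Qed.

Lemma square_integrable_cst (c : R) : square_integrable (fun=> c).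
Proof.
by split=> //; apply: bounded_integrable; exact: bounded_measurable_cst.
Qed.

Lemma square_integrableW U : square_integrable U -> P.-integrable setT (EFin \o U).
Proof.
move=> sU; have := square_integrableM sU (square_integrable_cst 1).
by under [X in _ \o X]eq_fun do rewrite mulr1.
Qed.

Lemma square_integrable_int U (a : R) : measurable_fun setT U ->
  (\int[P]_w (U w ^+ 2)%:E = a%:E)%E -> square_integrable U.
Proof.
move=> mU Ua; split=> //; apply/integrableP; split.
  by apply/measurable_EFinP; exact: measurable_funX.
under eq_integral do rewrite /= ger0_norm ?sqr_ge0//.
by rewrite Ua ltry.
Qed.

Lemma integral_Rintegral (f : T -> R) : P.-integrable setT (EFin \o f) ->
  (\int[P]_w (f w)%:E)%E = (\int[P]_w f w)%:E.
Proof. by move=> fi; rewrite /Rintegral fineK//; exact: integrable_fin_num. Qed.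

Lemma Rintegral_sum I (r : seq I) (F : I -> T -> R) :
  (forall i, P.-integrable setT (EFin \o F i)) ->
  P.-integrable setT (EFin \o (fun w => \sum_(i <- r) F i w)) /\
  \int[P]_w (\sum_(i <- r) F i w) = \sum_(i <- r) \int[P]_w F i w.
Proof.
move=> iF; elim: r => [|i r [iS IH]].
  under [in X in _ /\ X]eq_Rintegral do rewrite big_nil.
  rewrite big_nil Rintegral_prob_cst; split=> //.
  under [X in _ \o X]eq_fun do rewrite big_nil.
  by apply: bounded_integrable; exact: bounded_measurable_cst.
under [in X in _ /\ X]eq_Rintegral do rewrite big_cons.
rewrite big_cons RintegralD// IH; split=> //.
under [X in _ \o X]eq_fun do rewrite big_cons.
exact: integrableD_real.
Qed.

Lemma independent_sum_moment U V (a b : R) :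
  measurable_fun setT U -> measurable_fun setT V -> independent P U V ->
  \int[P]_w U w = 0 -> (\int[P]_w (U w ^+ 2)%:E = a%:E)%E ->
  (\int[P]_w (V w ^+ 2)%:E = b%:E)%E ->
  (\int[P]_w ((U w + V w) ^+ 2)%:E = (a + b)%:E)%E.
Proof.
move=> mU mV UV U0 Ua Vb.
have sU := square_integrable_int mU Ua; have sV := square_integrable_int mV Vb.
have iU := square_integrableW sU.
have ic (c : R) : P.-integrable setT (EFin \o (fun=> c)).
  by apply: bounded_integrable; exact: bounded_measurable_cst.
have Ua' : \int[P]_w (U w ^+ 2) = a by rewrite /Rintegral Ua.
have Vb' : \int[P]_w (V w ^+ 2) = b by rewrite /Rintegral Vb.
pose psi (z : R * R) := ((z.1 + z.2) ^+ 2)%:E.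
have mpsi : measurable_fun setT psi.
  by rewrite /psi; apply/measurable_EFinP; apply: measurable_funX; exact: measurable_funD.
have psi0 z : (0 <= psi z)%E by rewrite lee_fin sqr_ge0.
have := decoupling mU mV UV mpsi psi0; rewrite /psi/= => ->.
transitivity (\int[P]_w (a + V w ^+ 2)%:E)%E.
  apply: eq_integral => w _; set v := V w.
  have i1 : P.-integrable setT (EFin \o (fun w' => (2 * v) * U w')).
    exact: integrableZl_real.
  have i2 : P.-integrable setT (EFin \o (fun w' => U w' ^+ 2 + (2 * v) * U w')).
    by apply: integrableD_real => //; exact: sU.2.
  transitivity (\int[P]_w' (U w' ^+ 2 + (2 * v) * U w' + v ^+ 2)%:E)%E.
    by apply: eq_integral => w' _; congr _%:E; ring.
  rewrite integral_Rintegral; last exact: integrableD_real.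
  rewrite !RintegralD//; last exact: sU.2.
  by rewrite RintegralZl// U0 mulr0 addr0 Ua' Rintegral_prob_cst.
rewrite integral_Rintegral; last by apply: integrableD_real => //; exact: sV.2.
by rewrite RintegralD//; [rewrite Rintegral_prob_cst Vb'|exact: sV.2].
Qed.

(** Covariances vanish by comparing the second moment of [f i + f j] from [independent_sum_moment]
    with its expansion; only the diagonal of the double sum remains. *)
Lemma pairwise_independent_moment n (f : 'I_n -> T -> R) (s2 c : R) (a : 'I_n -> R) :
  (forall i, measurable_fun setT (f i)) ->
  (forall i j, i != j -> independent P (f i) (f j)) ->
  (forall i, \int[P]_w f i w = 0) ->
  (forall i, \int[P]_w (f i w ^+ 2)%:E = s2%:E)%E ->
  (\int[P]_w ((c + \sum_i a i * f i w) ^+ 2)%:E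
   = (c ^+ 2 + s2 * \sum_i a i ^+ 2)%:E)%E.
Proof.
move=> mf ind f0 f2.
have sf i := square_integrable_int (mf i) (f2 i).
have if1 i := square_integrableW (sf i).
have iff i j := square_integrableM (sf i) (sf j).
have f2' i : \int[P]_w (f i w ^+ 2) = s2 by rewrite /Rintegral f2.
have ff i j : \int[P]_w (f i w * f j w) = if i == j then s2 else 0.
  case: eqP => [<-|/eqP ij]; first by rewrite -(f2' i); apply: eq_Rintegral => w _; rewrite expr2.
  have H := independent_sum_moment (mf i) (mf j) (ind i j ij) (f0 i) (f2 i) (f2 j).
  have : \int[P]_w ((f i w + f j w) ^+ 2) = s2 + s2 by rewrite /Rintegral H.
  under eq_Rintegral do rewrite sqrrD -[_ *+ 2]mulr_natl addrAC.
  have i2 : P.-integrable setT (EFin \o (fun w => 2 * (f i w * f j w))).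
    exact: integrableZl_real.
  have i3 : P.-integrable setT (EFin \o (fun w => f i w ^+ 2 + f j w ^+ 2)).
    by apply: integrableD_real; [exact: (sf i).2|exact: (sf j).2].
  rewrite RintegralD// RintegralD//; [|exact: (sf i).2|exact: (sf j).2].
  by rewrite RintegralZl// !f2'; lra.
have ilin i : P.-integrable setT (EFin \o (fun w => (2 * c * a i) * f i w)).
  exact: integrableZl_real.
have iquad (ij : 'I_n * 'I_n) : P.-integrable setT
    (EFin \o (fun w => (a ij.1 * a ij.2) * (f ij.1 w * f ij.2 w))).
  exact: integrableZl_real.
have ic : P.-integrable setT (EFin \o (fun=> c ^+ 2)).
  by apply: bounded_integrable; exact: bounded_measurable_cst.
have [iL EL] := Rintegral_sum (index_enum 'I_n) ilin.
have [iQ EQ] := Rintegral_sum (index_enum ('I_n * 'I_n)%type) iquad.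
transitivity (\int[P]_w (c ^+ 2 + \sum_i (2 * c * a i) * f i w
   + \sum_ij (a ij.1 * a ij.2) * (f ij.1 w * f ij.2 w))%:E)%E.
  apply: eq_integral => w _; congr _%:E.
  rewrite sqrrD; congr (_ + _ + _).
    rewrite -[_ *+ 2]mulr_natl !mulr_sumr; apply: eq_bigr => i _; ring.
  rewrite expr2 mulr_suml -(pair_bigA _ (fun i j => a i * a j * (f i w * f j w)))/=.
  by apply: eq_bigr => i _; rewrite mulr_sumr; apply: eq_bigr => j _; ring.
rewrite integral_Rintegral; last by do 2 apply: integrableD_real => //.
rewrite RintegralD//; last exact: integrableD_real.
rewrite RintegralD// EL EQ Rintegral_prob_cst big1 ?addr0; last first.
  by move=> i _; rewrite RintegralZl// f0 mulr0.
congr (_ + _)%:E.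
rewrite (eq_bigr (fun ij => if ij.1 == ij.2 then s2 * (a ij.1 * a ij.2) else 0)); last first.
  by move=> ij _; rewrite RintegralZl// ff; case: ifP; rewrite ?mulr0// mulrC.
rewrite -(pair_bigA _ (fun i j => if i == j then s2 * (a i * a j) else 0))/= mulr_sumr.
apply: eq_bigr => i _; rewrite -big_mkcond/= (big_pred1 i); first by rewrite expr2.
by move=> j; rewrite eq_sym.
Qed.

End SecondMoments.

(** * The two models *)

Section CovariateLaw.
Context {d : measure_display} {T : measurableType d} {R : realType}.
Variable P : probability T R.
Variables (mu : probability R R) (k : nat) (z0 : T -> k.-tuple R).
Hypothesis mz0 : measurable_fun setT z0.
Hypothesis z0_iid : iid_law (law_of P mz0) mu.
Hypotheses (std : standardized_law mu) (fin4 : finite_moment_above mu 4).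

Let mu4 := entry4_integrable fin4.

Lemma measurable_dotp (c : 'cV[R]_k) : measurable_fun setT (fun u : k.-tuple R => dotp u c).
Proof. by have [] := dominated_dotp c. Qed.

Lemma dotp_second_moment c :
  (\int[P]_w (dotp (z0 w) c ^+ 2)%:E = (sqnorm2 c)%:E)%E.
Proof.
have m2 : measurable_fun setT (fun u : k.-tuple R => (dotp u c ^+ 2)%:E).
  by apply/measurable_EFinP; apply: measurable_funX; exact: measurable_dotp.
rewrite (integral_law P mz0 m2); last by move=> s; rewrite lee_fin sqr_ge0.
rewrite integral_Rintegral; last first.
  apply: (dominated_integrable z0_iid mu4); apply: dominatedW.
  exact: dominated_dotp_sqr.
by rewrite (dotp_moment2 z0_iid mu4 (entry_mean std) (entry_var std)).
Qed.

Lemma dotp_mean c : \int[P]_w dotp (z0 w) c = 0.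
Proof.
have mc := measurable_dotp c.
have ic := square_integrableW (square_integrable_int
  (measurableT_comp mc mz0) (dotp_second_moment c)).
have it (j : 'I_k) : (law_of P mz0).-integrable setT (EFin \o (fun u => tnth u j)).
  by apply: (dominated_integrable z0_iid mu4); exact/dominatedW/dominated_coord.
have [iS ES] := Rintegral_sum (index_enum 'I_k)
  (fun j => integrableZl_real (c j 0) (it j)).
transitivity (\int[law_of P mz0]_u (\sum_j c j 0 * tnth u j)).
  rewrite /Rintegral (eq_integral (fun u => (dotp u c)%:E)); last first.
    by move=> u _; congr _%:E; apply: eq_bigr => j _; rewrite mulrC.
  by rewrite integral_distribution//; exact/measurable_EFinP.
rewrite ES big1// => j _; rewrite RintegralZl//.
have [_ ->] := resampling_dominated z0_iid mu4 j (dominatedW (dominated_coord j)).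
under eq_Rintegral do under eq_Rintegral do rewrite tnth_upd eqxx.
by rewrite (entry_mean std) Rintegral_prob_cst mulr0.
Qed.

End CovariateLaw.

Lemma measurable_cat_tuple {R : realType} d (T : measurableType d) p q
    (a : T -> p.-tuple R) (b : T -> q.-tuple R) :
  measurable_fun setT a -> measurable_fun setT b ->
  measurable_fun setT (fun w => cat_tuple (a w) (b w)).
Proof.
move=> ma mb; apply/measurable_fun_tnthP => j; case: (split_ordP j) => i ->.
  rewrite (_ : _ \o _ = (fun u => tnth u i) \o a).
    exact: (measurableT_comp (measurable_tnth i) ma).
  by apply/funext => w /=; rewrite tnth_lshift.
rewrite (_ : _ \o _ = (fun u => tnth u i) \o b).
  exact: (measurableT_comp (measurable_tnth i) mb).
by apply/funext => w /=; rewrite tnth_rshift.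
Qed.

Section Blocks.
Context {d : measure_display} {T : measurableType d} {R : realType}.
Variable P : probability T R.
Variables (mu : probability R R) (p q : nat) (z0 : T -> (p + q).-tuple R).
Hypothesis mz0 : measurable_fun setT z0.
Hypothesis z0_iid : iid_law (law_of P mz0) mu.

Definition left_block (u : (p + q).-tuple R) : p.-tuple R :=
  [tuple tnth u (lshift q j) | j < p].
Definition right_block (u : (p + q).-tuple R) : q.-tuple R :=
  [tuple tnth u (rshift p j) | j < q].

Lemma measurable_left_block : measurable_fun setT left_block.
Proof. by apply: measurable_mktuple => j; exact: measurable_tnth. Qed.

Lemma measurable_right_block : measurable_fun setT right_block.
Proof. by apply: measurable_mktuple => j; exact: measurable_tnth. Qed.

Lemma blocks_law (A : 'I_p -> set R) (B : 'I_q -> set R) :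
  (forall j, measurable (A j)) -> (forall j, measurable (B j)) ->
  P ((left_block \o z0) @^-1` box A `&` (right_block \o z0) @^-1` box B)
  = ((\prod_(j < p) mu (A j)) * \prod_(j < q) mu (B j))%E.
Proof.
move=> mA mB.
pose C (j : 'I_(p + q)) := match fintype.split j with inl i => A i | inr i => B i end.
have mC j : measurable (C j) by rewrite /C; case: fintype.split.
have Cl j : C (lshift q j) = A j by rewrite /C (unsplitK (inl j)).
have Cr j : C (rshift p j) = B j by rewrite /C (unsplitK (inr j)).
have -> : (\prod_(j < p) mu (A j) * \prod_(j < q) mu (B j) =
    \prod_(j < p + q) mu (C j))%E.
  rewrite big_split_ord/=; congr (_ * _)%E; apply: eq_bigr => j _.
    by rewrite Cl.
  by rewrite Cr.
rewrite -(z0_iid mC); congr (P _); apply/seteqP; split=> w /=.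
  move=> [HA HB] j; case: (split_ordP j) => i ->.
    by have := HA i; rewrite tnth_mktuple Cl.
  by have := HB i; rewrite tnth_mktuple Cr.
move=> HC; split=> j; rewrite tnth_mktuple.
  by have := HC (lshift q j); rewrite Cl.
by have := HC (rshift p j); rewrite Cr.
Qed.

Lemma left_block_law (A : 'I_p -> set R) : (forall j, measurable (A j)) ->
  P ((left_block \o z0) @^-1` box A) = (\prod_(j < p) mu (A j))%E.
Proof.
move=> mA; have := blocks_law mA (fun=> measurableT).
rewrite (_ : box (fun=> setT) = setT); last by apply/seteqP; split.
rewrite preimage_setT setIT => ->.
by rewrite [X in (_ * X)%E]big1 ?mule1// => j _; exact: probability_setT.
Qed.

Lemma right_block_law (B : 'I_q -> set R) : (forall j, measurable (B j)) ->
  P ((right_block \o z0) @^-1` box B) = (\prod_(j < q) mu (B j))%E.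
Proof.
move=> mB; have := blocks_law (fun=> measurableT) mB.
rewrite (_ : box (fun=> setT) = setT); last by apply/seteqP; split.
rewrite preimage_setT setTI => ->.
by rewrite [X in (X * _)%E]big1 ?mul1e// => j _; exact: probability_setT.
Qed.

Lemma blocks_independent : independent P (right_block \o z0) (left_block \o z0).
Proof.
apply: (independent_pi (measurableT_comp measurable_right_block mz0)
  (measurableT_comp measurable_left_block mz0)
  (measurable_boxesE R q) (@boxes_setI _ R q) (boxes_setT R q)
  (measurable_boxesE R p) (@boxes_setI _ R p) (boxes_setT R p)).
move=> _ _ [B mB <-] [A mA <-].
by rewrite setIC blocks_law// left_block_law// right_block_law// muleC.
Qed.

End Blocks.

(** * A common frame for both models: observed covariate [g z], hidden signal [h z] *)

Section RidgeSample.
Context {d : measure_display} {T : measurableType d} {R : realType}.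
Variable P : probability T R.
Variables (mu : probability R R) (sigma : R) (n k p : nat).
Hypothesis n_gt0 : (0 < n)%N.
Variables (z : 'I_n -> T -> k.-tuple R) (eps y : 'I_n -> T -> R) (z0 : T -> k.-tuple R).
Hypothesis model : iid_sample P mu sigma z eps y z0.
Hypotheses (mz : forall i, measurable_fun setT (z i)).
Hypotheses (meps : forall i, measurable_fun setT (eps i)).
Hypotheses (my : forall i, measurable_fun setT (y i)).
Hypothesis mz0 : measurable_fun setT z0.

(** The law of the entries is prescribed on training rows; a nonempty sample provides one, and the
    test covariate shares its law. *)
Lemma test_iid : iid_law (law_of P mz0) mu.
Proof.
move=> A mA; have i0 := Ordinal n_gt0.
transitivity (P (z i0 @^-1` box A)).
  by apply: (test_same_law model i0); exact: measurable_box.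
rewrite (_ : _ @^-1` _ = [set w | forall j, A j (tnth (z i0 w) j)])//.
rewrite (mutually_independent_forall (f := fun j w => tnth (z i0 w) j))//; last first.
  exact: (entries_independent model).
by apply: eq_bigr => j _; exact: (entries_law model).
Qed.

Lemma noise_square i : (\int[P]_w (eps i w ^+ 2)%:E = (sigma ^+ 2)%:E)%E.
Proof.
have H1 := noise_mean model i; have := noise_variance model i.
rewrite /variance unlock H1 unlock /= => <-.
apply: eq_integral => w _ /=; congr (_%:E).
by transitivity ((eps i w - 0) * (eps i w - 0)); [rewrite subr0 expr2|].
Qed.

Lemma noise_mean0 i : \int[P]_w eps i w = 0.
Proof. by have := noise_mean model i; rewrite unlock /Rintegral => ->. Qed.

Variables (lam : R) (lam_gt0 : 0 < lam) (beta : 'cV[R]_p) (t2 : R).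
Variables (g : k.-tuple R -> p.-tuple R) (h : k.-tuple R -> R).
Hypotheses (mg : measurable_fun setT g) (mh : measurable_fun setT h).
Hypothesis t2_ge0 : 0 <= t2.
Hypothesis y_def : forall i w, y i w = dotp (g (z i w)) beta + (h (z i w) + eps i w).
Hypothesis signal_independent : independent P (h \o z0) (g \o z0).
Hypothesis test_moment : forall v,
  (\int[P]_w ((dotp (g (z0 w)) v - h (z0 w)) ^+ 2)%:E = (sqnorm2 v + t2)%:E)%E.
Hypothesis h_mean : \int[P]_w h (z0 w) = 0.

Let X w := [tuple g (z i w) | i < n].

Lemma measurable_covariates : measurable_fun setT X.
Proof. by apply: measurable_mktuple => i; exact: measurableT_comp. Qed.

Lemma covariates_iid (mgz0 : measurable_fun setT (g \o z0)) :
  iid_law (law_of P measurable_covariates) (law_of P mgz0).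
Proof.
move=> A mA.
have mgA i : measurable (g @^-1` A i).
  by rewrite -[X in measurable X]setTI; exact: mg.
transitivity (P [set w | forall i, (g @^-1` A i `*` setT) (z i w, y i w)]).
  congr (P _); apply/seteqP; split=> w /= H i; have := H i; rewrite tnth_mktuple//.
  by case.
rewrite (mutually_independent_forall (A := fun i => g @^-1` A i `*` setT)
  (sample_independent model)); last by move=> i; exact: measurableX.
apply: eq_bigr => i _; transitivity (P (z i @^-1` (g @^-1` A i))).
  by congr (P _); apply/seteqP; split=> w /=; tauto.
by rewrite -(test_same_law model i (mgA i)).
Qed.

(** The effective noise of the regression on [g z]: the hidden signal plus [eps], centred,
    independent of the observed covariate, and of variance [sigma^2 + t2]. *)
Let residual i w := y i w - dotp (g (z i w)) beta.

Let residualE i : residual i = fun w => h (z i w) + eps i w.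
Proof. by apply/funext => w; rewrite /residual y_def addrAC subrr add0r. Qed.

Let signal_law i (f : k.-tuple R -> \bar R) : measurable_fun setT f ->
  (forall s, (0 <= f s)%E) -> (\int[P]_w f (z i w) = \int[P]_w f (z0 w))%E.
Proof.
move=> mf f0; rewrite (integral_law P (mz i) mf f0) (integral_law P mz0 mf f0).
apply: eq_measure_integral => A mA _; exact/esym/(test_same_law model i).
Qed.

Let residual_independent i : independent P (residual i) (g \o z i).
Proof.
rewrite residualE; apply: independent_sum_noise => //.
  exact: (noise_independent model).
move=> A B mA mB.
have mhA : measurable (h @^-1` A) by rewrite -[X in measurable X]setTI; exact: mh.
have mgB : measurable (g @^-1` B) by rewrite -[X in measurable X]setTI; exact: mg.
have sl C : measurable C -> P (z i @^-1` C) = P (z0 @^-1` C).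
  by move=> mC; rewrite (test_same_law model i).
have := signal_independent mA mB.
rewrite -[P (_ `&` _)]/(P (z0 @^-1` (h @^-1` A `&` g @^-1` B))).
rewrite -[P ((h \o z0) @^-1` _)]/(P (z0 @^-1` (h @^-1` A))).
rewrite -[P ((g \o z0) @^-1` _)]/(P (z0 @^-1` (g @^-1` B))).
by rewrite -!sl//; exact: measurableI.
Qed.

Let h_square : (\int[P]_w (h (z0 w) ^+ 2)%:E = t2%:E)%E.
Proof.
have := test_moment 0; rewrite /sqnorm2 big1 ?add0r; last first.
  by move=> j _; rewrite mxE expr0n.
move=> <-; apply: eq_integral => w _; congr _%:E.
by rewrite /dotp big1 ?sub0r ?sqrrN// => j _; rewrite mxE mulr0.
Qed.

Let mhz i : measurable_fun setT (fun w => h (z i w)).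
Proof. exact: measurableT_comp. Qed.

Let hz_square i : (\int[P]_w (h (z i w) ^+ 2)%:E = t2%:E)%E.
Proof.
rewrite -h_square (signal_law i (f := fun s => (h s ^+ 2)%:E))//.
  by apply/measurable_EFinP; exact: measurable_funX.
by move=> s; rewrite lee_fin sqr_ge0.
Qed.

Let hz_mean i : \int[P]_w h (z i w) = 0.
Proof.
rewrite -h_mean /Rintegral; congr fine.
have mhE : measurable_fun setT (EFin \o h) by exact/measurable_EFinP.
have ihz := square_integrableW (square_integrable_int (mhz i) (hz_square i)).
have ih0 := square_integrableW (square_integrable_int
  (measurableT_comp mh mz0) h_square).
transitivity (\int[law_of P (mz i)]_s (h s)%:E)%E.
  by rewrite integral_distribution.
transitivity (\int[law_of P mz0]_s (h s)%:E)%E; last by rewrite integral_distribution.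
by apply: eq_measure_integral => A mA _; exact/esym/(test_same_law model i).
Qed.

Let residual_mean i : \int[P]_w residual i w = 0.
Proof.
rewrite residualE RintegralD//.
- by rewrite hz_mean noise_mean0 addr0.
- exact: square_integrableW (square_integrable_int (mhz i) (hz_square i)).
- exact: square_integrableW (square_integrable_int (meps i) (noise_square i)).
Qed.

Let residual_square i :
  (\int[P]_w (residual i w ^+ 2)%:E = (sigma ^+ 2 + t2)%:E)%E.
Proof.
rewrite residualE; under eq_integral do rewrite addrC.
apply: independent_sum_moment => //.
- exact: (independent_comp (@measurable_id _ _ setT) mh (noise_independent model i)).
- exact: noise_mean0.
- exact: noise_square.
Qed.

Let residual_of (a : k.-tuple R * R) := a.2 - dotp (g a.1) beta.

Let measurable_residual_of : measurable_fun setT residual_of.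
Proof.
apply: measurable_funB => //; apply: (measurableT_comp (measurable_dotp beta)).
exact: measurableT_comp.
Qed.

Let mresidual i : measurable_fun setT (residual i).
Proof. by rewrite residualE; exact: measurable_funD. Qed.

Let mzy i : measurable_fun setT (fun w => (z i w, y i w)).
Proof. exact: measurable_fun_pair. Qed.

Let residual_pairwise i j : i != j -> independent P (residual i) (residual j).
Proof.
move=> ij A B mA mB.
have mpre (C : set R) : measurable C -> measurable (residual_of @^-1` C).
  by move=> mC; rewrite -[X in measurable X]setTI; exact: measurable_residual_of.
pose C l := if l == i then residual_of @^-1` A
  else if l == j then residual_of @^-1` B else setT.
have mC l : measurable (C l).
  by rewrite /C; case: ifP => _; [exact: mpre|case: ifP => _ //; exact: mpre].
have H := sample_independent model [set i; j]%SET mC.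
have Ci : C i = residual_of @^-1` A by rewrite /C eqxx.
have Cj : C j = residual_of @^-1` B by rewrite /C eq_sym (negbTE ij) eqxx.
rewrite big_setU1/= ?inE// big_set1 Ci Cj in H.
rewrite -[P (residual i @^-1` A)]/(P ((fun w => (z i w, y i w)) @^-1` (residual_of @^-1` A))).
rewrite -[P (residual j @^-1` B)]/(P ((fun w => (z j w, y j w)) @^-1` (residual_of @^-1` B))).
rewrite -H; congr (P _); apply/seteqP; split=> w /=.
  move=> [HA HB] l /=; rewrite !inE => /orP[/eqP->|/eqP->]; first by rewrite Ci.
  by rewrite Cj.
move=> HC; split.
  by have := HC i; rewrite /= !inE eqxx Ci; exact.
by have := HC j; rewrite /= !inE eqxx orbT Cj; exact.
Qed.

Lemma sample_risk risk :
  cond_expectation P X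
    (fun w => (dotp (g (z0 w)) (ridge_fit lam (fun i => g (z i w)) (fun i => y i w))
       - dotp (g (z0 w)) beta - h (z0 w)) ^+ 2) risk ->
  {ae P, forall w, risk w = det_risk lam (sigma ^+ 2 + t2) beta (X w) + t2}.
Proof.
pose dl w := [tuple residual i w | i < n].
have mdl : measurable_fun setT dl by exact: measurable_mktuple.
have mgz0 : measurable_fun setT (g \o z0) by exact: measurableT_comp.
have mhz0 : measurable_fun setT (h \o z0) by exact: measurableT_comp.
have mg1 : measurable_fun setT (fun a : k.-tuple R * R => g a.1).
  exact: measurableT_comp.
have ind_noise : independent P dl X.
  apply: (mutually_independent_tuples mzy measurable_residual_of mg1
    (sample_independent model)) => i.
  exact: residual_independent.
have ind_test : independent P (fun w => ((g \o z0) w, (h \o z0) w)) (fun w => (X w, dl w)).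
  (* Covariates and residuals together are a measurable function of the training pairs, so
     independence of the test point from the sample carries over to them. *)
  pose v (s : n.-tuple (k.-tuple R * R)) :=
    ([tuple g (tnth s i).1 | i < n], [tuple residual_of (tnth s i) | i < n]).
  have mv : measurable_fun setT v.
    apply: measurable_fun_pair; apply: measurable_mktuple => i.
      by apply: (measurableT_comp mg1); exact: measurable_tnth.
    by apply: (measurableT_comp measurable_residual_of); exact: measurable_tnth.
  have mgh : measurable_fun setT (fun s => (g s, h s)) by exact: measurable_fun_pair.
  rewrite (_ : (fun w => (X w, dl w)) = v \o (fun w => [tuple (z i w, y i w) | i < n])).
    exact: (independent_comp mgh mv (test_independent model)).
  apply/funext => w; rewrite /v /=; congr pair.
    by apply: eq_mktuple => i; rewrite tnth_mktuple.
  by apply: eq_mktuple => i; rewrite tnth_mktuple.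
apply: (risk_identification lam_gt0 measurable_covariates mdl mgz0 mhz0 ind_noise
  ind_test _ t2_ge0 test_moment).
- by rewrite addr_ge0// sqr_ge0.
- move=> c a; under eq_integral do under eq_bigr do rewrite tnth_mktuple.
  exact: pairwise_independent_moment.
move=> w; congr ((_ - _) ^+ 2); rewrite -dotpN -dotpD; congr (dotp _ _).
rewrite -(ridge_error lam_gt0 n_gt0); congr (ridge_fit _ _ _ - _).
  by apply/funext => i; rewrite tnth_mktuple.
by apply/funext => i; rewrite !tnth_mktuple /residual addrC subrK.
Qed.

End RidgeSample.

Lemma finite_moment_above_le {R : realType} (mu : probability R R) (a b : R) :
  a <= b -> finite_moment_above mu b -> finite_moment_above mu a.
Proof.
move=> ab [e e0 H]; exists (b - a + e); first by rewrite ltr_wpDl// subr_ge0.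
by rewrite addrA [a + _]addrC subrK.
Qed.

Lemma independent_cst {R : realType} d (T : measurableType d) (P : probability T R)
    dF (F : measurableType dF) (c : R) (f : T -> F) :
  measurable_fun setT f -> independent P (fun=> c) f.
Proof.
move=> mf A B mA mB; have mB' : measurable (f @^-1` B).
  by rewrite -[X in measurable X]setTI; exact: mf.
have [Ac|Ac] := pselect (A c).
  rewrite (_ : _ @^-1` A = setT); last by apply/seteqP; split.
  by rewrite setTI [X in (X * _)%E](probability_setT P) mul1e.
rewrite (_ : _ @^-1` A = set0); last by apply/seteqP; split.
by rewrite set0I measure0 mul0e.
Qed.

(** Both models are instances. The limit is the risk for noise variance [sigma^2 + t2], since the
    hidden signal acts as noise in training, plus [t2] for the hidden signal in the test error. *)
Lemma risk_convergence {R : realType} d (T : measurableType d) (P : probability T R)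
    (mu : probability R R) (gamma sigma r2 t2 lam : R) (k p : nat -> nat)
    (z : forall n, 'I_n -> T -> (k n).-tuple R) (eps y : forall n, 'I_n -> T -> R)
    (z0 : forall n, T -> (k n).-tuple R)
    (g : forall n, (k n).-tuple R -> (p n).-tuple R) (h : forall n, (k n).-tuple R -> R)
    (beta : forall n, 'cV[R]_(p n)) :
  standardized_law mu -> finite_moment_above mu 4 ->
  0 < gamma -> 0 < lam -> 0 < r2 -> 0 <= t2 ->
  (fun n => (p n)%:R / n%:R : R) @ \oo --> gamma ->
  (forall n i, measurable_fun setT (z n i)) ->
  (forall n i, measurable_fun setT (eps n i)) ->
  (forall n i, measurable_fun setT (y n i)) ->
  (forall n, measurable_fun setT (z0 n)) ->
  (forall n, measurable_fun setT (g n)) -> (forall n, measurable_fun setT (h n)) ->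
  (forall n, (0 < n)%N -> iid_sample P mu sigma (z n) (eps n) (y n) (z0 n)) ->
  (forall n i w, y n i w =
    dotp (g n (z n i w)) (beta n) + (h n (z n i w) + eps n i w)) ->
  (forall n, (0 < n)%N -> sqnorm2 (beta n) = r2) ->
  (forall n (A : 'I_(p n) -> set R), (0 < n)%N -> (forall j, measurable (A j)) ->
    P ((g n \o z0 n) @^-1` box A) = (\prod_(j < p n) mu (A j))%E) ->
  (forall n, (0 < n)%N -> independent P (h n \o z0 n) (g n \o z0 n)) ->
  (forall n v, (0 < n)%N -> (\int[P]_w ((dotp (g n (z0 n w)) v - h n (z0 n w)) ^+ 2)%:E
     = (sqnorm2 v + t2)%:E)%E) ->
  (forall n, (0 < n)%N -> \int[P]_w h n (z0 n w) = 0) ->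
  forall risk : nat -> T -> R,
  (forall n, (0 < n)%N -> cond_expectation P
    (fun w => [tuple g n (z n i w) | i < n])
    (fun w => (dotp (g n (z0 n w))
         (ridge_fit lam (fun i => g n (z n i w)) (fun i => y n i w))
       - dotp (g n (z0 n w)) (beta n) - h n (z0 n w)) ^+ 2) (risk n)) ->
  {ae P, forall w, (fun n => risk n w) @ \oo -->
    t2 + ridge_limit_risk gamma r2 (sigma ^+ 2 + t2) lam}.
Proof.
move=> std fin4 gamma0 lam0 r20 t20 p_cvg mz meps my mz0 mg mh model y_def betaE
  g_law gh_ind test_moment h_mean risk cE.
have mX n := measurable_covariates (mz n) (mg n).
have mgz0 n : measurable_fun setT (g n \o z0 n).
  exact: (measurableT_comp (mg n) (mz0 n)).
have X_iid n : (0 < n)%N -> iid_law (law_of P (mX n)) (law_of P (mgz0 n)).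
  by move=> n0 A mA; exact: (covariates_iid (model n n0) (mz n) (mg n) (mgz0 n) mA).
have nu_iid n : (0 < n)%N -> iid_law (law_of P (mgz0 n)) mu.
  by move=> n0 A mA; exact: g_law.
have lim := @risk_ae_cvg R mu gamma p std fin4 gamma0 p_cvg d T P
  (fun n => law_of P (mgz0 n)) 
  (fun n => HB.pack (fun w => [tuple g n (z n i w) | i < n])
     (isMeasurableFun.Build _ _ _ _ _ (mX n))) nu_iid X_iid lam lam0 r2
     (sigma ^+ 2 + t2) beta r20 betaE.
have ident : {ae P, forall w, forall n, risk n.+1 w =
    det_risk lam (sigma ^+ 2 + t2) (beta n.+1) [tuple g n.+1 (z n.+1 i w) | i < n.+1] + t2}.
  apply/ae_foralln => n.
  apply: (sample_risk (n := n.+1) _ (model _ _) (mz _) (meps _) (my _) (mz0 _) lam0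
    (mg _) (mh _) t20 (y_def n.+1) (gh_ind _ _) _ (h_mean _ _) (cE _ _)) => //.
  by move=> v; exact: test_moment.
near=> w.
have lw : (fun n => det_risk lam (sigma ^+ 2 + t2) (beta n)
   [tuple g n (z n i w) | i < n]) @ \oo --> ridge_limit_risk gamma r2 (sigma ^+ 2 + t2) lam.
  by near: w; exact: lim.
have iw : forall n, risk n.+1 w = det_risk lam (sigma ^+ 2 + t2) (beta n.+1)
  [tuple g n.+1 (z n.+1 i w) | i < n.+1] + t2 by near: w.
(* The risk is identified for nonempty samples only, so the limit is taken along the shifted
   sequence. *)
rewrite -(cvg_shiftS (fun n => risk n w)).
under eq_fun do rewrite iw; rewrite addrC; apply: cvgD; last exact: cvg_cst.
by rewrite (cvg_shiftS (fun n => det_risk _ _ (beta n) [tuple g n (z n i w) | i < n])).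
Unshelve. all: by end_near. Qed.

Theorem corollary5 (R : realType) (gamma r sigma : R)
    (gamma_gt0 : 0 < gamma) (r_gt0 : 0 < r) (sigma_gt0 : 0 < sigma) :
  ((forall (d : measure_display) (T : measurableType d) (P : probability T R)
       (mu : probability R R) (p : nat -> nat)
       (x : forall n, 'I_n -> {RV P >-> (p n).-tuple R})
       (eps y : forall n, 'I_n -> {RV P >-> R})
       (x0 : forall n, {RV P >-> (p n).-tuple R})
       (beta : forall n, 'cV[R]_(p n)),
     standardized_law mu ->
     finite_moment_above mu 4 ->
     (forall n, (0 < n)%N ->
        iid_sample P mu sigma (x n) (eps n) (y n) (x0 n)) ->
     (forall n i w, y n i w = dotp (x n i w) (beta n) + eps n i w) ->
     (forall n, (0 < n)%N -> sqnorm2 (beta n) = r ^+ 2) ->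
     (fun n => (p n)%:R / n%:R : R) @ \oo --> gamma ->
     forall (lambda : R), 0 < lambda ->
     forall risk : nat -> T -> R,
     (forall n, (0 < n)%N ->
        cond_expectation P
          (fun w => [tuple x n i w | i < n])
          (fun w =>
             let betahat :=
               ridge_fit lambda (fun i => x n i w) (fun i => y n i w) in
             (dotp (x0 n w) betahat - dotp (x0 n w) (beta n)) ^+ 2)
          (risk n)) ->
     {ae P, forall w, (fun n => risk n w) @ \oo -->
                      ridge_limit_risk gamma (r ^+ 2) (sigma ^+ 2) lambda})
   /\
   (let lambda_opt := sigma ^+ 2 * gamma / r ^+ 2 in
    minimized_over_pos_at
      (ridge_limit_risk gamma (r ^+ 2) (sigma ^+ 2)) lambda_opt /\
    ridge_limit_risk gamma (r ^+ 2) (sigma ^+ 2) lambda_opt =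
      sigma ^+ 2 * gamma * mp_stieltjes gamma (- lambda_opt)))
  /\
  (forall kappa : R, 0 < kappa -> kappa <= 1 ->
   let r2_t := r ^+ 2 * kappa in
   let sigma2_t := sigma ^+ 2 + r ^+ 2 * (1 - kappa) in
   let limit_risk := fun lambda =>
     r ^+ 2 * (1 - kappa) + ridge_limit_risk gamma r2_t sigma2_t lambda in
   (forall (d : measure_display) (T : measurableType d) (P : probability T R)
       (mu : probability R R) (p q : nat -> nat)
       (x : forall n, 'I_n -> {RV P >-> (p n).-tuple R})
       (w : forall n, 'I_n -> {RV P >-> (q n).-tuple R})
       (eps y : forall n, 'I_n -> {RV P >-> R})
       (x0 : forall n, {RV P >-> (p n).-tuple R})
       (w0 : forall n, {RV P >-> (q n).-tuple R})
       (beta : forall n, 'cV[R]_(p n)) (theta : forall n, 'cV[R]_(q n)),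
     standardized_law mu ->
     finite_moment_above mu 8 ->
     (forall n, (0 < n)%N ->
        iid_sample P mu sigma
          (fun i t => cat_tuple (x n i t) (w n i t)) (eps n) (y n)
          (fun t => cat_tuple (x0 n t) (w0 n t))) ->
     (forall n i t, y n i t =
        dotp (x n i t) (beta n) + dotp (w n i t) (theta n) + eps n i t) ->
     (forall n, (0 < n)%N ->
        sqnorm2 (beta n) + sqnorm2 (theta n) = r ^+ 2) ->
     (forall n, (0 < n)%N -> sqnorm2 (beta n) / r ^+ 2 = kappa) ->
     (fun n => (p n)%:R / n%:R : R) @ \oo --> gamma ->
     forall (lambda : R), 0 < lambda ->
     forall risk : nat -> T -> R,
     (forall n, (0 < n)%N ->
        cond_expectation P
          (fun t => [tuple x n i t | i < n])
          (fun t =>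
             let betahat :=
               ridge_fit lambda (fun i => x n i t) (fun i => y n i t) in
             (dotp (x0 n t) betahat - dotp (x0 n t) (beta n)
              - dotp (w0 n t) (theta n)) ^+ 2)
          (risk n)) ->
     {ae P, forall t, (fun n => risk n t) @ \oo --> limit_risk lambda})
   /\
   (let lambda_opt := sigma2_t * gamma / r2_t in
    minimized_over_pos_at limit_risk lambda_opt /\
    limit_risk lambda_opt =
      r ^+ 2 * (1 - kappa)
      + sigma2_t * gamma * mp_stieltjes gamma (- lambda_opt))).
Proof.
have r2_gt0 : 0 < r ^+ 2 by exact: exprn_gt0.
have s2_gt0 : 0 < sigma ^+ 2 by exact: exprn_gt0.
split; last move=> kappa kappa_gt0 kappa_le1 r2_t sigma2_t limit_risk.
  split; last by split; [exact: ridge_limit_risk_min|exact: ridge_limit_risk_opt].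
  move=> d T P mu p x eps y x0 beta std fin4 model y_def betaE p_cvg lam lam0 risk cE.
  have x0_iid n (n0 : (0 < n)%N) := test_iid n0 (model n n0) (measurable_funPT (x0 n)).
  (* The well-specified model is the case of identity [g], zero hidden signal and [t2 = 0]. *)
  have -> : ridge_limit_risk gamma (r ^+ 2) (sigma ^+ 2) lam =
    0 + ridge_limit_risk gamma (r ^+ 2) (sigma ^+ 2 + 0) lam by rewrite add0r addr0.
  apply: (risk_convergence (z := fun n i => x n i) (eps := fun n i => eps n i)
    (y := fun n i => y n i) (z0 := fun n => x0 n) (g := fun n => id)
    (h := fun n => fun=> 0) (k := p) (p := p) (beta := beta) std fin4
    gamma_gt0 lam0 r2_gt0 (lexx 0) p_cvg) => //.
  - by move=> n i w; rewrite y_def add0r.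
  - by move=> n A n0 mA; exact: (x0_iid n n0 A mA).
  - by move=> n n0; exact: independent_cst.
  - move=> n v n0; under eq_integral do rewrite subr0.
    by rewrite addr0 (dotp_second_moment (x0_iid n n0) std fin4).
  - by move=> n n0; rewrite Rintegral_prob_cst.
  move=> n n0; have := cE n n0; congr (cond_expectation P _ _ _).
  by apply/funext => w /=; rewrite subr0.
have k1 : 0 <= r ^+ 2 * (1 - kappa) by rewrite mulr_ge0 ?subr_ge0// ltW.
have r2t0 : 0 < r2_t by rewrite mulr_gt0.
have s2t0 : 0 < sigma2_t by rewrite ltr_pwDl.
split; last first.
  have [l0 lmin] := ridge_limit_risk_min gamma_gt0 r2t0 s2t0.
  split; last by rewrite /limit_risk ridge_limit_risk_opt.
  by split=> // l l0'; rewrite lerD2l; exact: lmin.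
move=> d T P mu p q x w eps y x0 w0 beta theta std fin8 model y_def normE kappaE p_cvg
  lam lam0 risk cE.
have fin4 : finite_moment_above mu 4 by apply: finite_moment_above_le fin8; lra.
have mz0 n := measurable_cat_tuple (measurable_funPT (x0 n)) (measurable_funPT (w0 n)).
have z0_iid n (n0 : (0 < n)%N) := test_iid n0 (model n n0) (mz0 n).
have leftE n (a : (p n).-tuple R) (b : (q n).-tuple R) : left_block (cat_tuple a b) = a.
  by apply: eq_from_tnth => j; rewrite tnth_mktuple tnth_lshift.
have rightE n (a : (p n).-tuple R) (b : (q n).-tuple R) : right_block (cat_tuple a b) = b.
  by apply: eq_from_tnth => j; rewrite tnth_mktuple tnth_rshift.
have betaE n : (0 < n)%N -> sqnorm2 (beta n) = r2_t.
  by move=> n0; rewrite /r2_t -(kappaE n n0) mulrCA mulfV ?mulr1// lt0r_neq0.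
have thetaE n : (0 < n)%N -> sqnorm2 (theta n) = r ^+ 2 * (1 - kappa).
  by move=> n0; have := normE n n0; rewrite betaE// /r2_t; lra.
pose h n (u : (p n + q n).-tuple R) := dotp (right_block u) (theta n).
have mh n : measurable_fun setT (h n).
  exact: (measurableT_comp (measurable_dotp (theta n)) (@measurable_right_block _ _ _)).
(* The test error is a linear form in the whole vector [(x, w)] with coefficients [(v, -theta)], so
   its second moment is [|v|^2 + |theta|^2], and the second term is [t2]. *)
have hE n (u : (p n + q n).-tuple R) v :
    dotp (left_block u) v - h n u = dotp u (col_mx v (- theta n)).
  rewrite /h /dotp big_split_ord/= -sumrN; congr (_ + _); apply: eq_bigr => j _.
    by rewrite tnth_mktuple col_mxEu.
  by rewrite tnth_mktuple col_mxEd mxE mulrN.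
apply: (risk_convergence (z := fun n i t => cat_tuple (x n i t) (w n i t))
  (eps := fun n i => eps n i) (y := fun n i => y n i)
  (z0 := fun n t => cat_tuple (x0 n t) (w0 n t)) (g := fun n => @left_block R (p n) (q n))
  (h := h) (k := fun n => (p n + q n)%N) (p := p) (beta := beta) std fin4
  gamma_gt0 lam0 r2t0 k1 p_cvg) => //.
- by move=> n i; exact: measurable_cat_tuple.
- by move=> n; exact: measurable_left_block.
- by move=> n i t; rewrite leftE /h rightE y_def addrA.
- by move=> n A n0 mA; exact: (left_block_law (z0_iid n n0)).
- move=> n n0; exact: (independent_comp (measurable_dotp (theta n))
    (@measurable_id _ _ setT) (blocks_independent (z0_iid n n0))).
- move=> n v n0; under eq_integral do rewrite hE.
  rewrite (dotp_second_moment (z0_iid n n0) std fin4); congr _%:E.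
  rewrite -(thetaE n n0) /sqnorm2 big_split_ord/=; congr (_ + _); apply: eq_bigr => j _.
    by rewrite col_mxEu.
  by rewrite col_mxEd mxE sqrrN.
- move=> n n0; have := dotp_mean (z0_iid n n0) std fin4 (col_mx 0 (theta n)).
  move=> <-; apply: eq_Rintegral => t _.
  rewrite /h /dotp big_split_ord/= [X in _ = X + _]big1 ?add0r; last first.
    by move=> j _; rewrite col_mxEu mxE mulr0.
  by apply: eq_bigr => j _; rewrite tnth_mktuple col_mxEd.
move=> n n0; have := cE n n0; congr (cond_expectation P _ _ _); apply/funext => t.
  by apply: eq_mktuple => i; rewrite leftE.
rewrite (_ : (fun i => left_block _) = fun i => x n i t); last first.
  by apply/funext => i; rewrite leftE.
by rewrite leftE /h rightE.
Qed.
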